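(* Let $u:\mathbb{R}\to\mathbb{C}$ be an $l$-periodic, twice continuously differentiable $n$-gap potential (in the sense defined in the context). Then the periodic Cauchy problem for the nonlinear Schrödinger equation $$i v_t+v_{xx}+2|v|^2v=0,\qquad v(x,0)=u(x),\quad x\in\mathbb{R},$$ in the class of functions $v(x,t)$ that are $l$-periodic in $x$, twice continuously differentiable in $x$ and continuously differentiable in $t$, is uniquely solvable. Moreover, for every fixed $t$ the solution $v(\cdot,t)$ is an $l$-periodic $n$-gap potential.
   Context: For an $l$-periodic, twice continuously differentiable function $v:\mathbb{R}\to\mathbb{C}$ consider the Dirac-type system $J\frac{dy}{dx}+Q(x)y=zy$, $z\in\mathbb{C}$, where $J=\begin{pmatrix}i&0\\0&-i\end{pmatrix}$ and $Q(x)=\begin{pmatrix}0& i v(x)\\ i\overline{v(x)}&0\end{pmatrix}$. Let $\Phi(x,z)$ be its fundamental matrix solution with $\Phi(0,z)=I$, and call $\Phi(z)=\Phi(l,z)$ the monodromy matrix of $v$; its entries $\Phi_{ik}(z)$ are entire functions of $z$. Associate with $v$ the entire functions $f=\frac{1}{2i}(\Phi_{11}-\Phi_{22})$, $\psi=\Phi_{12}$, $\varphi=\Phi_{21}$. The periodic potential $v$ is called finite-gap if there exist an entire function $h(z)$ and polynomials $\tilde f_0,\tilde\psi_0,\tilde\varphi_0$, with $\tilde f_0$ monic, such that $f=\tilde f_0h$, $\psi=\tilde\psi_0 h$, $\varphi=\tilde\varphi_0 h$; it is called $n$-gap if moreover $\deg\tilde f_0=n+1$. *)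

(* Defs.v *)
From Stdlib Require Import Reals List.
From Coquelicot Require Import Coquelicot.
Open Scope R_scope.

Definition periodic (l : R) (f : R -> C) : Prop := forall x, f (x + l) = f x.

Definition C2_fun (f : R -> C) : Prop :=
  exists f1 f2 : R -> C,
    (forall x, is_derive f x (f1 x)) /\
    (forall x, is_derive f1 x (f2 x)) /\
    (forall x, continuous f2 x).

(** (y1,y2) solves the Dirac-type system  J y' + Q(x) y = z y, with
    J = diag(i,-i), Q = [[0, i v],[i conj v, 0]], i.e.
      i y1' + i v y2      = z y1
     -i y2' + i conj(v) y1 = z y2. *)
Definition dirac_solution (v : R -> C) (z : C) (y1 y2 : R -> C) : Prop :=
  exists d1 d2 : R -> C,
    (forall x, is_derive y1 x (d1 x)) /\
    (forall x, is_derive y2 x (d2 x)) /\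
    (forall x, (Ci * d1 x + Ci * v x * y2 x = z * y1 x)%C) /\
    (forall x, (- Ci * d2 x + Ci * Cconj (v x) * y1 x = z * y2 x)%C).

Definition fundamental_matrix (v : R -> C) (P11 P12 P21 P22 : R -> C -> C) : Prop :=
  forall z : C,
    dirac_solution v z (fun x => P11 x z) (fun x => P21 x z) /\
    dirac_solution v z (fun x => P12 x z) (fun x => P22 x z) /\
    P11 0 z = 1%C /\ P12 0 z = 0%C /\ P21 0 z = 0%C /\ P22 0 z = 1%C.

Definition entire (h : C -> C) : Prop := forall z : C, ex_derive h z.

Fixpoint peval (p : list C) (z : C) : C :=
  match p with
  | nil => 0%C
  | a :: p' => (a + z * peval p' z)%C
  end.

Definition monic_deg (p : list C) (d : nat) : Prop :=
  exists a : list C, length a = d /\ p = a ++ ((RtoC 1) :: nil).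

(** v is an l-periodic, C^2, n-gap potential: with f = (Phi11 - Phi22)/(2i),
    psi = Phi12, phi = Phi21 (monodromy matrix Phi(l,z)), there are an entire h
    and polynomials f0 (monic, degree n+1), psi0, phi0 with
    f = f0 h, psi = psi0 h, phi = phi0 h. *)
Definition n_gap_potential (l : R) (n : nat) (v : R -> C) : Prop :=
  periodic l v /\ C2_fun v /\
  exists P11 P12 P21 P22 : R -> C -> C,
    fundamental_matrix v P11 P12 P21 P22 /\
    exists (h : C -> C) (f0 psi0 phi0 : list C),
      entire h /\ monic_deg f0 (S n) /\
      forall z : C,
        ((P11 l z - P22 l z) / (2 * Ci))%C = (peval f0 z * h z)%C /\
        P12 l z = (peval psi0 z * h z)%C /\
        P21 l z = (peval phi0 z * h z)%C.

Definition nls_solution (l : R) (u : R -> C) (v : R -> R -> C) : Prop :=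
  (forall x t, v (x + l) t = v x t) /\
  (exists vx vxx vt : R -> R -> C,
    (forall x t, is_derive (fun y => v y t) x (vx x t)) /\
    (forall x t, is_derive (fun y => vx y t) x (vxx x t)) /\
    (forall x t, is_derive (fun s => v x s) t (vt x t)) /\
    (forall x t, continuous (fun p : R * R => v (fst p) (snd p)) (x, t)) /\
    (forall x t, continuous (fun p : R * R => vx (fst p) (snd p)) (x, t)) /\
    (forall x t, continuous (fun p : R * R => vxx (fst p) (snd p)) (x, t)) /\
    (forall x t, continuous (fun p : R * R => vt (fst p) (snd p)) (x, t)) /\
    (forall x t,
       (Ci * vt x t + vxx x t + 2 * RtoC (Cmod (v x t) ^ 2) * v x t = 0)%C)) /\
  (forall x, v x 0 = u x).

(* Main.v *)
(** Write f, psi, phi as entries of the traceless part of the monodromy matrix. After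
    division by a common factor, the finite-gap condition says that the monodromy
    commutes with a polynomial matrix P = [[i f, b], [- b^*, - i f]], where
    b^*(z) = conj (b (conj z)), f is monic of degree d and real on the real line.
    Conjugating P by the fundamental matrix gives an entire matrix function P(x, z) with
    P_x = [U, P]. It grows polynomially in z: in a strip by an energy estimate, in the
    half planes because there the monodromy of each base point x is asymptotically
    explicit, so that P(x, z) is compared with P(0, z). By Liouville's theorem
    P(x, .) is polynomial, u is its leading off-diagonal coefficient, and P_x = [U, P]
    becomes a polynomial vector field on coefficients.

    The NLS flow is P_t = [V, P], with V a polynomial in z whose coefficients are
    polynomials in those of P. It commutes with the x-flow, and it preserves
    f^2 + |b|^2 = - det P for real z, which bounds all coefficients and gives global
    solutions; x-periodicity is inherited from t = 0. Solutions of y_t = V y, started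
    at the fundamental matrix, provide the fundamental matrix for later t and show
    that the monodromy evolves by the same conjugation as P; hence the factor
    h does not depend on t. Uniqueness is an L^2 energy estimate over a period. *)
Require Import Defs.
From Stdlib Require Import Reals List.
From Stdlib Require Import Lra Lia Psatz Arith Classical ClassicalEpsilon FunctionalExtensionality.
From Coquelicot Require Import Coquelicot.
Open Scope R_scope.
Set Bullet Behavior "Strict Subproofs".

(** The state at a point is a finite list of coefficients. For each x the t-flow is an ODE for that
    state alone, because v_x, which enters V, is itself a polynomial in the coefficients. The
    x-equations are known at t = 0 and have to be transported to later times.

    Two obstacles shape the reduction. The conservation law bounds the coefficients only if - det P
    is a sum of squares on the real line, and the given polynomials have no such symmetry: h is
    arbitrary and f need not be real. Removing the full common factor q makes f real, but lowers its
    degree to some m <= n + 1. So q is merged with h into one factor H = q h, carried along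
    unchanged, and multiplied back at the end to recover degree n + 1.

    Nor is any lower bound on h available when the conjugated matrix is to be shown polynomial. But
    the traceless part of the monodromy at base point x is H P(x, z), with the same H as at x = 0;
    dividing the asymptotics at x by those at 0 eliminates H.

    In Liouville's theorem the role of being entire is taken by locally uniform approximation by
    polynomials, which Picard iterates supply. *)

Notation RxR := (prod_NormedModule R_AbsRing R_NormedModule R_NormedModule).

(* The structure [RxR] on [C] is the one that [is_derive] infers in the definitions
   for functions from [R] to [C]. *)
Notation is_cderive f x l := (@is_derive R_AbsRing RxR (f : R -> C) x (l : C)).

(** * Calculus of complex-valued functions of a real variable *)

Lemma Cminus_eq_0 (a b : C) : (a - b)%C = 0%C -> a = b.
Proof. intros E. transitivity (a - b + b)%C; [ring|]. rewrite E. apply Cplus_0_l. Qed.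

Lemma Cmod_le_0 (w : C) : Cmod w <= 0 -> w = 0%C.
Proof. intros H. apply Cmod_eq_0. pose proof (Cmod_ge_0 w). lra. Qed.

Lemma exp_le_compat (a b : R) : a <= b -> exp a <= exp b.
Proof. intros [H| ->]; [left; now apply exp_increasing|lra]. Qed.

Lemma Ci2_nz : (2 * Ci)%C <> 0%C.
Proof. apply Cmult_neq_0; [intros E; apply RtoC_inj in E; lra|exact Ci_nz]. Qed.

Lemma is_cderive_iff (f : R -> C) (x : R) (l : C) :
  is_cderive f x l <->
  is_derive (fun t => fst (f t)) x (fst l) /\ is_derive (fun t => snd (f t)) x (snd l).
Proof.
  split.
  - intros H; split.
    + apply (filterdiff_comp' f (fun u : RxR => fst u) x (fun y => scal y l) (fun u => fst u)); auto.
      apply filterdiff_linear, is_linear_fst.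
    + apply (filterdiff_comp' f (fun u : RxR => snd u) x (fun y => scal y l) (fun u => snd u)); auto.
      apply filterdiff_linear, is_linear_snd.
  - intros [H1 H2].
    apply is_derive_ext with (fun t => (fst (f t), snd (f t)) : RxR).
    { intros t; now destruct (f t). }
    destruct l as [l1 l2]; simpl in *.
    assert (K : is_derive (fun t => plus (scal (fst (f t)) ((1, 0) : RxR)) (scal (snd (f t)) ((0, 1): RxR))) x (plus (scal l1 ((1, 0) : RxR)) (scal l2 ((0, 1): RxR)))).
    { apply @is_derive_plus.
      - apply (filterdiff_comp' (fun t => fst (f t)) (fun u => scal u ((1, 0) : RxR)) x (fun y => scal y l1) (fun u => scal u ((1, 0) : RxR))) in H1.
        + eapply filterdiff_ext_lin. exact H1. intros y. simpl.  apply injective_projections; simpl; unfold scal; simpl; unfold mult; simpl; ring.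
        + apply filterdiff_linear. exact (is_linear_scal_l (K := R_AbsRing) (V := RxR) (1, 0)).
      - apply (filterdiff_comp' (fun t => snd (f t)) (fun u => scal u ((0, 1) : RxR)) x (fun y => scal y l2) (fun u => scal u ((0, 1) : RxR))) in H2.
        + eapply filterdiff_ext_lin. exact H2. intros y. simpl.  apply injective_projections; simpl; unfold scal; simpl; unfold mult; simpl; ring.
        + apply filterdiff_linear. exact (is_linear_scal_l (K := R_AbsRing) (V := RxR) (0, 1)). }
    match goal with |- is_derive _ _ ?z => 
    replace z with (plus (scal l1 ((1, 0) : RxR)) (scal l2 ((0, 1): RxR))) end.
    2:{ apply injective_projections; simpl; unfold scal, plus; simpl; unfold mult; simpl; ring. }
    eapply is_derive_ext. 2: exact K.
    intros t. apply injective_projections; simpl; unfold scal, plus; simpl; unfold mult; simpl; ring.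
Qed.

Lemma is_cderive_eq (f : R -> C) (x : R) (l l' : C) :
  is_cderive f x l -> l = l' -> is_cderive f x l'.
Proof. now intros H <-. Qed.

Lemma is_cderive_ext (f g : R -> C) (x : R) (l : C) :
  (forall t, f t = g t) -> is_cderive f x l -> is_cderive g x l.
Proof. intros H; apply is_derive_ext; exact H. Qed.

Lemma is_cderive_const (c : C) (x : R) : is_cderive (fun _ => c) x 0%C.
Proof. exact (is_derive_const (K := R_AbsRing) (V := RxR) c x). Qed.

Lemma is_cderive_plus (f g : R -> C) (x : R) (l m : C) :
  is_cderive f x l -> is_cderive g x m -> is_cderive (fun t => f t + g t)%C x (l + m)%C.
Proof. intros H1 H2; exact (is_derive_plus (K := R_AbsRing) (V := RxR) f g x l m H1 H2). Qed.

Lemma is_derive_eq (f : R -> R) (x l l' : R) : is_derive f x l -> l = l' -> is_derive f x l'.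
Proof. now intros H <-. Qed.

Lemma is_rderive_plus (f g : R -> R) (x l m : R) :
  is_derive f x l -> is_derive g x m -> is_derive (fun t => f t + g t) x (l + m).
Proof. exact (is_derive_plus (V := R_NormedModule) f g x l m). Qed.

Lemma is_rderive_minus (f g : R -> R) (x l m : R) :
  is_derive f x l -> is_derive g x m -> is_derive (fun t => f t - g t) x (l - m).
Proof. exact (is_derive_minus (V := R_NormedModule) f g x l m). Qed.

Lemma is_rderive_mult (f g : R -> R) (x l m : R) :
  is_derive f x l -> is_derive g x m -> is_derive (fun t => f t * g t) x (l * g x + f x * m).
Proof. intros H1 H2; exact (is_derive_mult (K := R_AbsRing) f g x l m H1 H2 Rmult_comm). Qed.

Lemma is_cderive_mult (f g : R -> C) (x : R) (l m : C) :
  is_cderive f x l -> is_cderive g x m ->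
  is_cderive (fun t => f t * g t)%C x (l * g x + f x * m)%C.
Proof.
  rewrite !is_cderive_iff; intros [H1 H2] [H3 H4]; simpl.
  split.
  - eapply is_derive_eq. apply is_rderive_minus; apply is_rderive_mult; eassumption. simpl; ring.
  - eapply is_derive_eq. apply is_rderive_plus; apply is_rderive_mult; eassumption. simpl; ring.
Qed.

Lemma is_cderive_conj (f : R -> C) (x : R) (l : C) :
  is_cderive f x l -> is_cderive (fun t => Cconj (f t)) x (Cconj l).
Proof.
  rewrite !is_cderive_iff; intros [H1 H2]; simpl; split; auto.
  apply (is_derive_opp (fun t => snd (f t))); auto.
Qed.

Lemma is_cderive_mult_const (c : C) (f : R -> C) (x : R) (l : C) :
  is_cderive f x l -> is_cderive (fun t => c * f t)%C x (c * l)%C.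
Proof.
  intros H; eapply is_cderive_eq.
  - apply is_cderive_mult. apply is_cderive_const. exact H.
  - cbv beta; ring.
Qed.

Lemma is_cderive_opp (f : R -> C) (x : R) (l : C) :
  is_cderive f x l -> is_cderive (fun t => - f t)%C x (- l)%C.
Proof.
  intros H; apply is_cderive_ext with (fun t => - (1) * f t)%C.
  - intros; ring.
  - eapply is_cderive_eq. apply is_cderive_mult_const; eauto. ring.
Qed.

Lemma is_cderive_minus (f g : R -> C) (x : R) (l m : C) :
  is_cderive f x l -> is_cderive g x m -> is_cderive (fun t => f t - g t)%C x (l - m)%C.
Proof. intros H1 H2; apply (is_cderive_plus f (fun t => - g t)%C); auto. now apply is_cderive_opp. Qed.

Lemma is_cderive_comp_shift (f : R -> C) (a x : R) (l : C) :
  is_cderive f (x + a) l -> is_cderive (fun t => f (t + a)) x l.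
Proof.
  rewrite !is_cderive_iff; intros [H1 H2].
  split; eapply is_derive_eq.
  1: apply (is_derive_comp (fun t => fst (f t)) (fun t => t + a)); [exact H1|auto_derive; auto].
  2: apply (is_derive_comp (fun t => snd (f t)) (fun t => t + a)); [exact H2|auto_derive; auto].
  all: unfold scal; simpl; unfold mult; simpl; ring.
Qed.

Lemma is_cderive_comp_opp (f : R -> C) (x : R) (l : C) :
  is_cderive f (- x) l -> is_cderive (fun t => f (- t)) x (- l)%C.
Proof.
  rewrite !is_cderive_iff; intros [H1 H2].
  split; eapply is_derive_eq.
  1: apply (is_derive_comp (fun t => fst (f t)) (fun t => - t)); [exact H1|auto_derive; auto].
  2: apply (is_derive_comp (fun t => snd (f t)) (fun t => - t)); [exact H2|auto_derive; auto].
  all: unfold scal; simpl; unfold mult; simpl; ring.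
Qed.

Lemma is_cderive_unique (f : R -> C) (x : R) (l m : C) : is_cderive f x l -> is_cderive f x m -> l = m.
Proof.
  rewrite !is_cderive_iff; intros [H1 H2] [H3 H4].
  apply injective_projections.
  - rewrite <- (is_derive_unique _ _ _ H1). now apply is_derive_unique.
  - rewrite <- (is_derive_unique _ _ _ H2). now apply is_derive_unique.
Qed.

Lemma continuous_C_iff {U : UniformSpace} (f : U -> C) (x : U) :
  continuous f x <-> continuous (fun t => fst (f t)) x /\ continuous (fun t => snd (f t)) x.
Proof.
  split.
  - intros H; split; apply (continuous_comp f); auto.
    + apply continuous_fst.
    + apply continuous_snd.
  - intros [H1 H2].
    apply (continuous_ext (fun t => (fst (f t), snd (f t)))).
    { intros t; now destruct (f t). }
    intros P [eps HP].
    generalize (H1 _ (locally_ball _ eps)) (H2 _ (locally_ball _ eps)).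
    unfold filtermap. intros K1 K2. pose proof (filter_and _ _ K1 K2) as K3. revert K3. apply filter_imp.
    intros y [B1 B2]. apply HP. split; assumption.
Qed.

Lemma is_cderive_continuous (f : R -> C) (x : R) (l : C) : is_cderive f x l -> continuous f x.
Proof.
  intros H. apply (ex_derive_continuous (V := RxR) f x). now exists l.
Qed.

Lemma continuous_Cplus {U : UniformSpace} (f g : U -> C) (x : U) :
  continuous f x -> continuous g x -> continuous (fun t => f t + g t)%C x.
Proof.
  rewrite !continuous_C_iff; intros [H1 H2] [H3 H4]; simpl; split.
  - now apply (continuous_plus (fun t => fst (f t)) (fun t => fst (g t))).
  - now apply (continuous_plus (fun t => snd (f t)) (fun t => snd (g t))).
Qed.

Lemma continuous_Cmult {U : UniformSpace} (f g : U -> C) (x : U) :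
  continuous f x -> continuous g x -> continuous (fun t => f t * g t)%C x.
Proof.
  rewrite !continuous_C_iff; intros [H1 H2] [H3 H4]; simpl; split.
  - apply (continuous_minus (fun t => fst (f t) * fst (g t)) (fun t => snd (f t) * snd (g t)));
      now apply (continuous_mult (K := R_AbsRing)).
  - apply (continuous_plus (fun t => fst (f t) * snd (g t)) (fun t => snd (f t) * fst (g t)));
      now apply (continuous_mult (K := R_AbsRing)).
Qed.

Lemma continuous_Cconj {U : UniformSpace} (f : U -> C) (x : U) : continuous f x -> continuous (fun t => Cconj (f t)) x.
Proof.
  rewrite !continuous_C_iff; intros [H1 H2]; simpl; split; auto.
  now apply (continuous_opp (fun t => snd (f t))).
Qed.

Lemma continuous_Cminus {U : UniformSpace} (f g : U -> C) (x : U) :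
  continuous f x -> continuous g x -> continuous (fun t => f t - g t)%C x.
Proof.
  intros Hf Hg. apply (continuous_Cplus f (fun t => - g t)%C); auto.
  rewrite continuous_C_iff in *. destruct Hg as [H1 H2]. split; simpl.
  - now apply (continuous_opp (fun t => fst (g t))).
  - now apply (continuous_opp (fun t => snd (g t))).
Qed.

Definition Cprim (g : R -> C) (x : R) : C :=
  (RInt (fun t => fst (g t)) 0 x, RInt (fun t => snd (g t)) 0 x).

Lemma Cprim_0 (g : R -> C) : Cprim g 0 = 0%C.
Proof. unfold Cprim; now rewrite !RInt_point. Qed.

Lemma is_cderive_Cprim (g : R -> C) :
  (forall x, continuous g x) -> forall x, is_cderive (Cprim g) x (g x).
Proof.
  intros Hg.
  assert (H1 : forall x, continuous (fun t => fst (g t)) x) by (intros; now apply continuous_C_iff).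
  assert (H2 : forall x, continuous (fun t => snd (g t)) x) by (intros; now apply continuous_C_iff).
  intros x; apply is_cderive_iff; simpl; split.
  - apply (is_derive_RInt (fun t => fst (g t)) _ 0); auto.
    exists (mkposreal 1 Rlt_0_1); intros y _. apply (@RInt_correct R_CompleteNormedModule).
    apply (@ex_RInt_continuous R_CompleteNormedModule); auto.
  - apply (is_derive_RInt (fun t => snd (g t)) _ 0); auto.
    exists (mkposreal 1 Rlt_0_1); intros y _. apply (@RInt_correct R_CompleteNormedModule).
    apply (@ex_RInt_continuous R_CompleteNormedModule); auto.
Qed.

(** * Mean value and Gronwall inequalities *)

Lemma is_derive_continuity_pt (f : R -> R) x l : is_derive f x l -> continuity_pt f x.
Proof. intros H; apply continuity_pt_filterlim. apply (ex_derive_continuous (K := R_AbsRing) (V := R_NormedModule) f x). now exists l. Qed.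

Lemma derive_nonpos_decr (f df : R -> R) (a b : R) :
  a <= b -> (forall x, a <= x <= b -> is_derive f x (df x)) ->
  (forall x, a <= x <= b -> df x <= 0) -> f b <= f a.
Proof.
  intros Hab Hd Hn.
  destruct (MVT_gen f a b df) as [c [Hc Heq]].
  - intros x; rewrite Rmin_left, Rmax_right by lra; intros; apply Hd; lra.
  - intros x; rewrite Rmin_left, Rmax_right by lra; intros.
    eapply is_derive_continuity_pt, Hd; lra.
  - rewrite Rmin_left, Rmax_right in Hc by lra.
    specialize (Hn c Hc). nra.
Qed.

(* Project [w] on the direction of [w b - w a]. *)
Lemma mean_value_ineq (w dw : R -> C) (g dg : R -> R) (a b : R) :
  a <= b ->
  (forall s, a <= s <= b -> is_cderive w s (dw s)) ->
  (forall s, a <= s <= b -> is_derive g s (dg s)) ->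
  (forall s, a <= s <= b -> Cmod (dw s) <= dg s) ->
  Cmod (w b - w a)%C <= g b - g a.
Proof.
  intros Hab Hw Hg Hle.
  set (D := (w b - w a)%C).
  assert (Hm : fst D * fst (w b) + snd D * snd (w b) - Cmod D * g b
               <= fst D * fst (w a) + snd D * snd (w a) - Cmod D * g a).
  { apply (derive_nonpos_decr (fun s => fst D * fst (w s) + snd D * snd (w s) - Cmod D * g s)
      (fun s => fst D * fst (dw s) + snd D * snd (dw s) - Cmod D * dg s)); auto.
    - intros s Hs. generalize (Hw s Hs); rewrite is_cderive_iff; intros [K1 K2].
      apply is_rderive_minus; [apply is_rderive_plus|].
      all: apply is_derive_scal; first [exact K1 | exact K2 | exact (Hg s Hs)].
    - intros s Hs.
      assert (K : fst D * fst (dw s) + snd D * snd (dw s) <= Cmod D * Cmod (dw s)).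
      { replace (fst D * fst (dw s) + snd D * snd (dw s)) with (Re (Cconj D * dw s)%C) by (unfold Re; simpl; ring).
        rewrite <- (Cmod_conj D), <- Cmod_mult.
        eapply Rle_trans; [apply Rle_abs|]. apply re_le_Cmod. }
      specialize (Hle s Hs). pose proof (Cmod_ge_0 D). nra. }
  assert (HD : Cmod D ^ 2 = fst D * (fst (w b) - fst (w a)) + snd D * (snd (w b) - snd (w a))).
  { rewrite Cmod2_alt. unfold Re, Im, D. simpl. ring. }
  assert (Hg2 : 0 <= g b - g a).
  { assert (g a <= g b); [|lra].
    assert (- g b <= - g a); [|lra].
    apply (derive_nonpos_decr (fun s => - g s) (fun s => - dg s)); auto.
    - intros; apply (is_derive_opp g); auto.
    - intros s Hs; specialize (Hle s Hs); pose proof (Cmod_ge_0 (dw s)); lra. }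
  destruct (Rle_lt_dec (Cmod D) 0) as [HD0|HD0]; [lra|].
  apply Rmult_le_reg_l with (Cmod D); auto. nra.
Qed.

Lemma is_derive_comp_opp (f : R -> R) x l :
  is_derive f (- x) l -> is_derive (fun t => f (- t)) x (- l).
Proof.
  intros H; eapply is_derive_eq.
  - apply (is_derive_comp f (fun t => - t)); [exact H|auto_derive; auto].
  - unfold scal; simpl; unfold mult; simpl; ring.
Qed.

(** Integrating an exponential bound divides its constant by [k]. This gain makes Picard iteration
    contract on the whole line at once, in the sup norm weighted by exp (- k |s|). *)
Lemma mean_value_ineq_exp (w dw : R -> C) (A k s : R) :
  0 < k -> (forall r, Rabs r <= Rabs s -> is_cderive w r (dw r)) ->
  (forall r, Rabs r <= Rabs s -> Cmod (dw r) <= A * exp (k * Rabs r)) ->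
  Cmod (w s - w 0)%C <= A / k * (exp (k * Rabs s) - 1).
Proof.
  intros Hk Hw Hle.
  assert (Hg : forall r, is_derive (fun r => A / k * exp (k * r)) r (A * exp (k * r))).
  { intros r; auto_derive; auto. field; lra. }
  destruct (Rle_lt_dec 0 s) as [Hs|Hs].
  - rewrite Rabs_right by lra.
    eapply Rle_trans.
    + apply (mean_value_ineq w dw (fun r => A / k * exp (k * r)) (fun r => A * exp (k * r))); auto.
      * intros r Hr; apply Hw. rewrite !Rabs_right; lra.
      * intros r Hr. eapply Rle_trans. apply Hle; rewrite !Rabs_right; lra. rewrite Rabs_right by lra; lra.
    + rewrite Rmult_0_r, exp_0; lra.
  - rewrite Rabs_left by lra.
    replace (w s - w 0)%C with ((fun t : R => w (- t)%R) (- s)%R - (fun t : R => w (- t)%R) 0%R)%C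
      by (simpl; rewrite Ropp_involutive, Ropp_0; reflexivity).
    eapply Rle_trans.
    + apply (mean_value_ineq (fun t => w (- t)) (fun t : R => - dw (- t)%R)%C (fun r => A / k * exp (k * r)) (fun r => A * exp (k * r))); auto; [lra| |].
      * intros r Hr. apply is_cderive_comp_opp, Hw. rewrite Rabs_Ropp, Rabs_right, Rabs_left; lra.
      * intros r Hr. rewrite Cmod_opp. eapply Rle_trans. apply Hle; rewrite Rabs_Ropp, Rabs_right, Rabs_left; lra.
        rewrite Rabs_Ropp, Rabs_right by lra; lra.
    + rewrite Rmult_0_r, exp_0; lra.
Qed.

Lemma zero_derive_const (w : R -> C) :
  (forall r, is_cderive w r 0%C) -> forall s, w s = w 0.
Proof.
  intros H s.
  assert (K : Cmod (w s - w 0)%C <= 0 / 1 * (exp (1 * Rabs s) - 1)).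
  { apply (mean_value_ineq_exp w (fun _ => 0%C)); auto; [lra|]. intros; rewrite Cmod_0; lra. }
  replace (0 / 1 * (exp (1 * Rabs s) - 1)) with 0 in K by field.
  apply Cminus_eq_0, Cmod_le_0. lra.
Qed.

(** Bounding the absolute value of the derivative lets the same estimate run backwards: Z exp (- k
    r) is nonincreasing, and so is its analogue for the reflected function. *)
Lemma gronwall (Z dZ : R -> R) (k s : R) :
  (forall r, Rabs r <= Rabs s -> is_derive Z r (dZ r)) ->
  (forall r, Rabs r <= Rabs s -> Rabs (dZ r) <= k * Z r) ->
  Z s <= Z 0 * exp (k * Rabs s).
Proof.
  intros HZ Hle.
  destruct (Rle_lt_dec 0 s) as [Hs|Hs].
  - rewrite (Rabs_right s) in * by lra.
    assert (K : Z s * exp (- k * s) <= Z 0 * exp (- k * 0)).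
    { apply (derive_nonpos_decr (fun r => Z r * exp (- k * r)) (fun r => (dZ r - k * Z r) * exp (- k * r))); auto.
      - intros r Hr. eapply is_derive_eq. apply is_rderive_mult. apply HZ. rewrite Rabs_right; lra.
        auto_derive; auto. cbv beta; ring.
      - intros r Hr. assert (K : Rabs (dZ r) <= k * Z r) by (apply Hle; rewrite Rabs_right; lra).
        pose proof (Rle_abs (dZ r)). pose proof (exp_pos (-k * r)). nra. }
    rewrite Rmult_0_r, exp_0, Rmult_1_r in K.
    apply Rmult_le_compat_r with (r := exp (k * s)) in K; [|left; apply exp_pos].
    rewrite Rmult_assoc, <- exp_plus in K. replace (- k * s + k * s) with 0 in K by ring. rewrite exp_0 in K. lra.
  - rewrite (Rabs_left s) in * by lra.
    assert (K : Z (- (- s)) * exp (- k * (- s)) <= Z (- 0) * exp (- k * 0)).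
    { apply (derive_nonpos_decr (fun r => Z (- r) * exp (- k * r)) (fun r => (- dZ (- r) - k * Z (- r)) * exp (- k * r))); [lra| |].
      - intros r Hr. eapply is_derive_eq. apply is_rderive_mult. apply is_derive_comp_opp, HZ. rewrite Rabs_Ropp, Rabs_right; lra.
        auto_derive; auto. cbv beta; ring.
      - intros r Hr. assert (K : Rabs (dZ (- r)) <= k * Z (- r)) by (apply Hle; rewrite Rabs_Ropp, Rabs_right; lra).
        pose proof (Rle_abs (- dZ (- r))) as K2. rewrite Rabs_Ropp in K2. pose proof (exp_pos (-k * r)). nra. }
    rewrite Rmult_0_r, exp_0, Rmult_1_r, Ropp_involutive, Ropp_0 in K.
    apply Rmult_le_compat_r with (r := exp (k * - s)) in K; [|left; apply exp_pos].
    rewrite Rmult_assoc, <- exp_plus in K. replace (- k * - s + k * - s) with 0 in K by ring. rewrite exp_0 in K. lra.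
Qed.

Lemma is_derive_Cmod2 (w : R -> C) (s : R) (dw : C) :
  is_cderive w s dw ->
  is_derive (fun r => Cmod (w r) ^ 2) s (2 * Re (Cconj (w s) * dw)).
Proof.
  rewrite is_cderive_iff; intros [H1 H2].
  apply is_derive_ext with (fun r => fst (w r) * fst (w r) + snd (w r) * snd (w r)).
  { intros t. change (fst (w t) * fst (w t) + snd (w t) * snd (w t) = Cmod (w t) ^ 2). rewrite Cmod2_alt; unfold Re, Im; ring. }
  eapply is_derive_eq.
  - apply is_rderive_plus; apply is_rderive_mult; eassumption.
  - unfold Re; simpl. ring.
Qed.

(** Lets a derivative be established from an estimate of difference quotients, as is done when the
    x-flow is transported in time. *)
Lemma is_cderive_epsdelta (f : R -> C) (x : R) (l : C) :
  is_cderive f x l <->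
  forall eta, 0 < eta -> exists delta, 0 < delta /\
    forall e, Rabs e < delta -> Cmod (f (x + e)%R - f x - RtoC e * l)%C <= eta * Rabs e.
Proof.
  split.
  - intros H eta Heta.
    destruct H as [_ H].
    assert (Hl : is_filter_lim (locally x) x) by (intros P HP; exact HP).
    specialize (H x Hl (mkposreal eta Heta)).
    destruct H as [delta H]. exists delta; split; [apply cond_pos|].
    intros e He.
    assert (B : ball x delta (x + e)).
    { unfold ball; simpl; unfold AbsRing_ball, abs, minus, plus, opp; simpl. replace (x + e + - x) with e by ring; auto. }
    specialize (H (x + e) B). simpl in H.
    replace (Cmod (f (x + e)%R - f x - RtoC e * l)%C) with
      (@norm R_AbsRing (RxR) (minus (minus (f (x + e)) (f x)) (scal (minus (x + e) x) l))).
    + eapply Rle_trans; [exact H|]. unfold norm; simpl. unfold abs, minus, plus, opp; simpl.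
      replace (x + e + - x) with e by ring; lra.
    + rewrite Cmod_norm. f_equal. apply injective_projections; simpl; unfold minus, plus, opp, scal; simpl; unfold mult, plus, opp; simpl; ring.
  - intros H; split.
    + apply is_linear_scal_l.
    + intros y Hy. apply (is_filter_lim_locally_unique x y) in Hy. subst y.
      intros [eps Heps]. destruct (H eps Heps) as [delta [Hd K]].
      exists (mkposreal delta Hd). intros y1 Hy; simpl.
      assert (Hy' : exists y : R, y = y1) by now exists y1. destruct Hy' as [y Hy']. rewrite <- Hy' in *. clear Hy' y1.
      unfold ball in Hy; simpl in Hy; unfold AbsRing_ball, abs, minus, plus, opp in Hy; simpl in Hy.
      specialize (K (y + - x) Hy).
      replace (x + (y + - x)) with y in K by ring.
      replace (Cmod _) with
      (@norm R_AbsRing (RxR) (minus (minus (f y) (f x)) (scal (minus y x) l))) in K; [exact K|].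
      rewrite Cmod_norm. f_equal. apply injective_projections; simpl; unfold minus, plus, opp, scal; simpl; unfold mult, plus, opp; simpl; ring.
Qed.

Lemma epsdelta_continuous_C (f : R -> C) x :
  (forall eta, 0 < eta -> exists delta, 0 < delta /\
    forall y, Rabs (y - x) < delta -> Cmod (f y - f x)%C <= eta) -> continuous f x.
Proof.
  intros H P [eps HP].
  destruct (H (eps / 2)) as [delta [Hd K]]. { pose proof (cond_pos eps); lra. }
  exists (mkposreal delta Hd). intros y Hy. apply HP.
  apply C_NormedModule_mixin_compat1. eapply Rle_lt_trans; [apply K; exact Hy|].
  pose proof (cond_pos eps); lra.
Qed.

Lemma continuous_C_epsdelta (f : R -> C) x :
  continuous f x -> forall eta, 0 < eta -> exists delta, 0 < delta /\
    forall y, Rabs (y - x) < delta -> Cmod (f y - f x)%C < eta.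
Proof.
  intros H eta Heta.
  (* Balls of the product structure are sup-norm balls; passing to [Cmod] costs a factor sqrt 2,
     absorbed by halving. *)
  assert (Hs : 0 < eta / 2) by lra.
  destruct (H _ (locally_ball _ (mkposreal _ Hs))) as [delta Hd].
  exists delta; split; [apply cond_pos|].
  intros y Hy. specialize (Hd y Hy).
  apply C_NormedModule_mixin_compat2 in Hd. simpl in Hd.
  eapply Rlt_le_trans; [exact Hd|].
  assert (sqrt 2 <= 2); [|nra].
  rewrite <- (sqrt_square 2) at 2 by lra. apply sqrt_le_1; lra.
Qed.

(** * Finite sums and Gronwall for systems *)

Definition lsum {I : Type} (ix : list I) (f : I -> R) : R := fold_right (fun i s => f i + s) 0 ix.

Section Sums.
Context {I : Type}.
Implicit Types (ix : list I) (f g : I -> R).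

Lemma lsum_cons a ix f : lsum (a :: ix) f = f a + lsum ix f.
Proof. reflexivity. Qed.

Lemma lsum_le ix f g : (forall i, In i ix -> f i <= g i) -> lsum ix f <= lsum ix g.
Proof.
  induction ix as [|a ix IH]; intros H; simpl; [lra|].
  apply Rplus_le_compat; [apply H; now left|apply IH; intros; apply H; now right].
Qed.

Lemma lsum_ext ix f g : (forall i, In i ix -> f i = g i) -> lsum ix f = lsum ix g.
Proof. intros H; apply Rle_antisym; apply lsum_le; intros i Hi; rewrite (H i Hi); lra. Qed.

Lemma lsum_plus ix f g : lsum ix (fun i => f i + g i) = lsum ix f + lsum ix g.
Proof. induction ix as [|a ix IH]; simpl; [ring|rewrite IH; ring]. Qed.

Lemma lsum_scal ix k f : lsum ix (fun i => k * f i) = k * lsum ix f.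
Proof. induction ix as [|a ix IH]; simpl; [ring|rewrite IH; ring]. Qed.

Lemma lsum_const ix k : lsum ix (fun _ => k) = INR (length ix) * k.
Proof. induction ix as [|a ix IH]; [simpl; ring|]. rewrite lsum_cons, IH. simpl length. rewrite S_INR. ring. Qed.

Lemma lsum_ge0 ix f : (forall i, 0 <= f i) -> 0 <= lsum ix f.
Proof. intros H; induction ix as [|a ix IH]; simpl; [lra|]. specialize (H a); lra. Qed.

Lemma lsum_In ix f i : (forall i, 0 <= f i) -> In i ix -> f i <= lsum ix f.
Proof.
  intros H; induction ix as [|a ix IH]; simpl; [tauto|].
  pose proof (lsum_ge0 ix f H). intros [<-|K]; [lra|]. specialize (IH K). specialize (H a). lra.
Qed.

(** Cauchy-Schwarz against the constant family; the auxiliary inequality sums (x - f i)^2 >= 0. *)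
Lemma lsum_sq ix f : lsum ix f * lsum ix f <= INR (length ix) * lsum ix (fun i => f i ^ 2).
Proof.
  assert (Aux : forall x ix, 2 * x * lsum ix f <= lsum ix (fun i => f i ^ 2) + INR (length ix) * x ^ 2).
  { intros x jx. induction jx as [|a jx IH]; [simpl; lra|].
    rewrite !lsum_cons; simpl length; rewrite S_INR. pose proof (pow2_ge_0 (x - f a)). nra. }
  induction ix as [|a ix IH]; [simpl; lra|].
  specialize (Aux (f a) ix). rewrite !lsum_cons; simpl length; rewrite S_INR. nra.
Qed.

Lemma is_derive_lsum ix (f : R -> I -> R) (df : I -> R) (s : R) :
  (forall i, In i ix -> is_derive (fun r => f r i) s (df i)) ->
  is_derive (fun r => lsum ix (f r)) s (lsum ix df).
Proof.
  induction ix as [|a ix IH]; intros H; simpl.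
  - exact (is_derive_const (K := R_AbsRing) (V := R_NormedModule) 0 s).
  - apply is_rderive_plus. apply H; now left. apply IH; intros; apply H; now right.
Qed.

Lemma Rabs_lsum ix f : Rabs (lsum ix f) <= lsum ix (fun i => Rabs (f i)).
Proof.
  induction ix as [|a ix IH]; simpl; [rewrite Rabs_R0; lra|].
  eapply Rle_trans; [apply Rabs_triang|]. lra.
Qed.
End Sums.

Definition nrm {I : Type} (ix : list I) (y : I -> C) : R := lsum ix (fun i => Cmod (y i)).
Definition nrm2 {I : Type} (ix : list I) (y : I -> C) : R := lsum ix (fun i => Cmod (y i) ^ 2).

Lemma nrm_ge0 {I : Type} (ix : list I) y : 0 <= nrm ix y.
Proof. apply lsum_ge0; intros; apply Cmod_ge_0. Qed.

Lemma nrm2_ge0 {I : Type} (ix : list I) y : 0 <= nrm2 ix y.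
Proof. apply lsum_ge0; intros; apply pow2_ge_0. Qed.

Lemma nrm_sq_le {I : Type} (ix : list I) y : nrm ix y * nrm ix y <= INR (length ix) * nrm2 ix y.
Proof. apply lsum_sq. Qed.

(** Adding eta^2 to the sum of squares absorbs the inhomogeneity. With N the length, 2 eta nrm <=
    eta^2 + nrm^2 and nrm^2 <= N nrm2 give the rate 2 K N + N + 1. *)
Lemma gronwall_system {I : Type} (ix : list I) (y dy : R -> I -> C) (K eta s : R) :
  0 <= K -> 0 <= eta ->
  (forall r i, Rabs r <= Rabs s -> In i ix -> is_cderive (fun t => y t i) r (dy r i)) ->
  (forall r i, Rabs r <= Rabs s -> In i ix -> Cmod (dy r i) <= K * nrm ix (y r) + eta) ->
  nrm2 ix (y s) <= (nrm2 ix (y 0) + eta ^ 2) * exp ((2 * K * INR (length ix) + INR (length ix) + 1) * Rabs s).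
Proof.
  intros HK Heta Hd Hle.
  set (N := INR (length ix)). assert (HN : 0 <= N) by apply pos_INR.
  set (k := 2 * K * N + N + 1).
  assert (G : nrm2 ix (y s) + eta ^ 2 <= (nrm2 ix (y 0) + eta ^ 2) * exp (k * Rabs s)).
  { apply (gronwall (fun r => nrm2 ix (y r) + eta ^ 2)
      (fun r => lsum ix (fun i => 2 * Re (Cconj (y r i) * dy r i)) + 0)).
    - intros r Hr. apply is_rderive_plus.
      + apply is_derive_lsum. intros i Hi. apply (is_derive_Cmod2 (fun t => y t i)). auto.
      + exact (is_derive_const (K := R_AbsRing) (V := R_NormedModule) _ r).
    - intros r Hr. rewrite Rplus_0_r.
      eapply Rle_trans; [apply Rabs_lsum|].
      eapply Rle_trans.
      { apply (lsum_le ix _ (fun i => (2 * (K * nrm ix (y r) + eta)) * Cmod (y r i))).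
        intros i Hi. rewrite Rabs_mult, (Rabs_right 2) by lra.
        eapply Rle_trans. apply Rmult_le_compat_l; [lra|apply re_le_Cmod].
        rewrite Cmod_mult, Cmod_conj. specialize (Hle r i Hr Hi).
        pose proof (Cmod_ge_0 (y r i)). nra. }
      rewrite lsum_scal. fold (nrm ix (y r)).
      pose proof (nrm_sq_le ix (y r)) as H1. fold N in H1.
      pose proof (nrm_ge0 ix (y r)) as H2. pose proof (nrm2_ge0 ix (y r)) as H3.
      pose proof (pow2_ge_0 (eta - nrm ix (y r))) as H4.
      assert (K * (nrm ix (y r) * nrm ix (y r)) <= K * (N * nrm2 ix (y r))) by nra.
      assert (0 <= K * N) by nra.
      assert (0 <= K * N * eta ^ 2) by (apply Rmult_le_pos; [auto|apply pow2_ge_0]).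
      assert (0 <= N * eta ^ 2) by (apply Rmult_le_pos; [auto|apply pow2_ge_0]).
      unfold k. nra. }
  pose proof (pow2_ge_0 eta). lra.
Qed.

(** * Geometric convergence and Picard iteration *)

Lemma half_pow_small (A eta : R) : 0 < eta -> exists m, A * (/ 2) ^ m < eta.
Proof.
  intros Heta.
  assert (H : 0 < eta / (Rabs A + 1)).
  { apply Rdiv_lt_0_compat; auto. pose proof (Rabs_pos A); lra. }
  destruct (pow_lt_1_zero (/ 2)) with (y := eta / (Rabs A + 1)) as [m Hm]; auto.
  { rewrite Rabs_right; lra. }
  exists m. specialize (Hm m (Nat.le_refl _)).
  assert (Hp : 0 < (/ 2) ^ m) by (apply pow_lt; lra).
  rewrite Rabs_right in Hm by lra.
  pose proof (Rle_abs A). pose proof (Rabs_pos A).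
  apply Rlt_div_r in Hm; [|lra]. nra.
Qed.

(** [Lim_seq] is total, so the limit can be named before convergence is known; the factor 2 is the
    sum of the geometric series. *)
Lemma geometric_limit (r : nat -> R) (A : R) :
  (forall m, Rabs (r (S m) - r m) <= A * (/ 2) ^ m) ->
  forall m, Rabs (real (Lim_seq r) - r m) <= 2 * A * (/ 2) ^ m.
Proof.
  intros H.
  assert (HA : 0 <= A). { specialize (H 0%nat). simpl in H. pose proof (Rabs_pos (r 1%nat - r 0%nat)). lra. }
  assert (K : forall k m, Rabs (r (m + k)%nat - r m) <= 2 * A * (/ 2) ^ m * (1 - (/ 2) ^ k)).
  { induction k as [|k IH]; intros m.
    - rewrite Nat.add_0_r, Rminus_diag, Rabs_R0. simpl. lra.
    - replace (r (m + S k)%nat - r m) with ((r (S (m + k)) - r (m + k)%nat) + (r (m + k)%nat - r m))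
        by (rewrite Nat.add_succ_r; ring).
      eapply Rle_trans; [apply Rabs_triang|].
      specialize (H (m + k)%nat). specialize (IH m). rewrite pow_add in H. simpl. nra. }
  assert (K2 : forall k m, Rabs (r (m + k)%nat - r m) <= 2 * A * (/ 2) ^ m).
  { intros k m. eapply Rle_trans; [apply K|].
    assert (0 < (/ 2) ^ k) by (apply pow_lt; lra). assert (0 < (/ 2) ^ m) by (apply pow_lt; lra).
    assert (0 <= 2 * A * (/ 2) ^ m) by nra. nra. }
  assert (E : ex_finite_lim_seq r).
  { apply ex_lim_seq_cauchy_corr. intros eps.
    destruct (half_pow_small (4 * A) (eps / 2)) as [N HN]. { pose proof (cond_pos eps); lra. }
    exists N. intros n m Hn Hm.
    replace n with (N + (n - N))%nat by lia. replace m with (N + (m - N))%nat by lia.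
    pose proof (K2 (n - N)%nat N) as E1. pose proof (K2 (m - N)%nat N) as E2.
    replace (r (N + (n - N))%nat - r (N + (m - N))%nat) with
      ((r (N + (n - N))%nat - r N) - (r (N + (m - N))%nat - r N)) by ring.
    eapply Rle_lt_trans; [apply Rabs_triang|]. rewrite Rabs_Ropp.
    pose proof (cond_pos eps). nra. }
  apply Lim_seq_correct' in E.
  intros m.
  assert (E1 : is_lim_seq (fun k => Rabs (r (m + k)%nat - r m)) (Rabs (real (Lim_seq r) - r m))).
  { apply (is_lim_seq_abs _ (real (Lim_seq r) - r m)).
    apply is_lim_seq_minus'; [|apply is_lim_seq_const].
    apply (is_lim_seq_ext (fun k => r (k + m)%nat)).
    - intros; now rewrite Nat.add_comm.
    - now apply (is_lim_seq_incr_n r m). }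
  assert (E2 := is_lim_seq_le _ (fun _ => 2 * A * (/ 2) ^ m) _ _ (fun k => K2 k m) E1 (is_lim_seq_const _)).
  exact E2.
Qed.

Definition Clim (w : nat -> C) : C :=
  (real (Lim_seq (fun m => fst (w m))), real (Lim_seq (fun m => snd (w m)))).

Lemma Rabs_fst_le (w : C) : Rabs (fst w) <= Cmod w.
Proof. eapply Rle_trans; [apply Rmax_l|apply Rmax_Cmod]. Qed.
Lemma Rabs_snd_le (w : C) : Rabs (snd w) <= Cmod w.
Proof. eapply Rle_trans; [apply Rmax_r|apply Rmax_Cmod]. Qed.
Lemma Cmod_le_sum (w : C) : Cmod w <= Rabs (fst w) + Rabs (snd w).
Proof.
  pose proof (Rabs_pos (fst w)) as H1; pose proof (Rabs_pos (snd w)) as H2.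
  apply Rsqr_incr_0; [|apply Cmod_ge_0|lra].
  unfold Rsqr. replace (Cmod w * Cmod w) with (Cmod w ^ 2) by ring. rewrite Cmod2_alt. unfold Re, Im.
  rewrite <- (pow2_abs (fst w)), <- (pow2_abs (snd w)). nra.
Qed.

Lemma Clim_geometric (w : nat -> C) (A : R) :
  (forall m, Cmod (w (S m) - w m)%C <= A * (/ 2) ^ m) ->
  forall m, Cmod (Clim w - w m)%C <= 4 * A * (/ 2) ^ m.
Proof.
  intros H m.
  assert (H1 : Rabs (fst (Clim w) - fst (w m)) <= 2 * A * (/ 2) ^ m).
  { apply (geometric_limit (fun m => fst (w m))). intros k. eapply Rle_trans; [|apply H].
    apply (Rabs_fst_le (w (S k) - w k)%C). }
  assert (H2 : Rabs (snd (Clim w) - snd (w m)) <= 2 * A * (/ 2) ^ m).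
  { apply (geometric_limit (fun m => snd (w m))). intros k. eapply Rle_trans; [|apply H].
    apply (Rabs_snd_le (w (S k) - w k)%C). }
  eapply Rle_trans; [apply Cmod_le_sum|]. simpl in *. unfold Rminus in *. lra.
Qed.

Lemma Rdiv_le_self (a k : R) : 0 <= a -> 1 <= k -> a / k <= a.
Proof.
  intros Ha Hk. apply Rmult_le_reg_r with k; [lra|].
  replace (a / k * k) with a by (field; lra). nra.
Qed.

Lemma Rdiv_le_mult (a b k : R) : 0 < k -> a <= b * k -> a / k <= b.
Proof.
  intros Hk H. apply Rmult_le_reg_r with k; [lra|].
  replace (a / k * k) with a by (field; lra). exact H.
Qed.

Section Picard.
Context {I : Type} (ix : list I) (F : R -> (I -> C) -> I -> C) (y0 : I -> C) (L B : R).

Fixpoint picard (m : nat) (s : R) (i : I) : C :=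
  match m with
  | O => y0 i
  | S m => (y0 i + Cprim (fun r => F r (picard m r) i) s)%C
  end.

Hypothesis HL : forall s y y' i, Cmod (F s y i - F s y' i)%C <= L * nrm ix (fun j => y j - y' j)%C.
Hypothesis HL0 : 0 <= L.
Hypothesis HB : forall s i, Cmod (F s y0 i) <= B.
Hypothesis HC : forall y : R -> I -> C, (forall i s, continuous (fun t => y t i) s) ->
  forall i s, continuous (fun t => F t (y t) i) s.

Lemma picard_continuous m i s : continuous (fun t => picard m t i) s.
Proof.
  revert i s; induction m as [|m IH]; intros i s; simpl.
  - apply continuous_const.
  - apply continuous_Cplus; [apply continuous_const|].
    eapply is_cderive_continuous, is_cderive_Cprim. intros x. now apply HC.
Qed.

Lemma picard_derive m i s : is_cderive (fun t => picard (S m) t i) s (F s (picard m s) i).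
Proof.
  simpl. eapply is_cderive_eq. apply is_cderive_plus. apply is_cderive_const.
  apply is_cderive_Cprim. intros x. apply (HC (picard m)). intros; apply picard_continuous.
  ring.
Qed.

(** The exponent of the weight is chosen so that L N / k <= 1 / 2 with N the length of [ix]: each
    iteration then halves the weighted distance. *)
Let k := 2 * INR (length ix) * L + 1.

Lemma picard_step m s i : Cmod (picard (S m) s i - picard m s i)%C <= B * (/ 2) ^ m * exp (k * Rabs s).
Proof.
  assert (HN : 0 <= INR (length ix)) by apply pos_INR.
  assert (Hk : 1 <= k) by (unfold k; nra).
  revert s i; induction m as [|m IH]; intros s i.
  - assert (HB0 : 0 <= B). { eapply Rle_trans; [|apply (HB 0 i)]. apply Cmod_ge_0. }
    pose proof (exp_pos (k * Rabs s)).
    replace (picard 0 s i) with (picard 1 0 i) by (simpl; rewrite Cprim_0; ring).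
    eapply Rle_trans.
    + apply (mean_value_ineq_exp (fun t => picard 1 t i) (fun r => F r (picard 0 r) i) B k); [lra| |].
      * intros; apply picard_derive.
      * intros r _. eapply Rle_trans; [apply HB|].
        assert (Hkr : 0 <= k * Rabs r) by (apply Rmult_le_pos; [lra|apply Rabs_pos]).
        pose proof (exp_ineq1_le (k * Rabs r)).
        rewrite <- (Rmult_1_r B) at 1. apply Rmult_le_compat_l; lra.
    + assert (B / k <= B) by (apply Rdiv_le_self; lra).
      assert (0 <= B / k). { apply Rdiv_le_0_compat; lra. }
      simpl pow. nra.
  - assert (HB0 : 0 <= B). { eapply Rle_trans; [|apply (HB 0 i)]. apply Cmod_ge_0. }
    pose proof (exp_pos (k * Rabs s)).
    assert (Hp : 0 < (/ 2) ^ m) by (apply pow_lt; lra).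
    set (w := fun t => (picard (S (S m)) t i - picard (S m) t i)%C).
    replace (picard (S (S m)) s i - picard (S m) s i)%C with (w s - w 0)%C.
    2:{ unfold w. simpl. rewrite !Cprim_0. ring. }
    set (A := L * INR (length ix) * (B * (/ 2) ^ m)).
    assert (0 <= A). { unfold A. apply Rmult_le_pos; nra. }
    eapply Rle_trans.
    + apply (mean_value_ineq_exp w (fun r => F r (picard (S m) r) i - F r (picard m r) i)%C A k); [lra| |].
      * intros; apply is_cderive_minus; apply picard_derive.
      * intros r _. eapply Rle_trans; [apply HL|].
        unfold nrm. eapply Rle_trans.
        { apply Rmult_le_compat_l; [exact HL0|]. apply lsum_le. intros j _. apply IH. }
        rewrite lsum_const. unfold A. right; ring.
    + assert (A / k <= B * (/ 2) ^ S m).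
      { apply Rdiv_le_mult; [lra|]. simpl. unfold A, k. assert (0 <= B * (/ 2) ^ m) by (apply Rmult_le_pos; lra). nra. }
      assert (0 <= A / k). { apply Rdiv_le_0_compat; lra. }
      nra.
Qed.

(** A global Lipschitz bound gives a solution on the whole line. [I] may be infinite: only
    components in the finite list [ix] enter the bound. *)
Theorem picard_lindelof :
  exists y : R -> I -> C, (forall i, y 0 i = y0 i) /\
    forall i s, is_cderive (fun t => y t i) s (F s (y s) i).
Proof.
  set (y := fun s i => Clim (fun m => picard m s i)).
  assert (HN : 0 <= INR (length ix)) by apply pos_INR.
  assert (Hk : 1 <= k) by (unfold k; nra).
  assert (Hy : forall m s i, Cmod (y s i - picard m s i)%C <= 4 * (B * exp (k * Rabs s)) * (/ 2) ^ m).
  { intros m s i. apply (Clim_geometric (fun m => picard m s i)). intros j.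
    eapply Rle_trans; [apply picard_step|]. right; ring. }
  assert (Hc : forall i s, continuous (fun t => y t i) s).
  { intros i s. apply epsdelta_continuous_C. intros eta Heta.
    assert (HB0 : 0 <= B). { eapply Rle_trans; [|apply (HB 0 i)]. apply Cmod_ge_0. }
    destruct (half_pow_small (4 * (B * exp (k * (Rabs s + 1)))) (eta / 3)) as [m Hm]; [lra|].
    destruct (continuous_C_epsdelta _ _ (picard_continuous m i s) (eta / 3)) as [delta [Hd Hdd]]; [lra|].
    exists (Rmin delta 1). split; [apply Rmin_pos; lra|].
    intros t Ht.
    assert (Ht1 : Rabs (t - s) < delta) by (eapply Rlt_le_trans; [exact Ht|apply Rmin_l]).
    assert (Ht2 : Rabs (t - s) < 1) by (eapply Rlt_le_trans; [exact Ht|apply Rmin_r]).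
    assert (Hb : forall r, Rabs r <= Rabs s + 1 -> Cmod (y r i - picard m r i)%C < eta / 3).
    { intros r Hr. eapply Rle_lt_trans; [apply Hy|]. eapply Rle_lt_trans; [|exact Hm].
      apply Rmult_le_compat_r; [apply pow_le; lra|].
      assert (exp (k * Rabs r) <= exp (k * (Rabs s + 1))) by (apply exp_le_compat, Rmult_le_compat_l; lra).
      nra. }
    assert (Hts : Rabs t <= Rabs s + 1).
    { replace t with ((t - s) + s) by ring. eapply Rle_trans; [apply Rabs_triang|]. lra. }
    pose proof (Hb t Hts) as E1. pose proof (Hb s ltac:(lra)) as E2. specialize (Hdd t Ht1).
    replace (y t i - y s i)%C with ((y t i - picard m t i) + (picard m t i - picard m s i) + - (y s i - picard m s i))%C by ring.
    eapply Rle_trans; [apply Cmod_triangle|]. rewrite Cmod_opp.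
    pose proof (Cmod_triangle (y t i - picard m t i) (picard m t i - picard m s i)). lra. }
  assert (Heq : forall i s, y s i = (y0 i + Cprim (fun r => F r (y r) i) s)%C).
  { intros i s.
    assert (HB0 : 0 <= B). { eapply Rle_trans; [|apply (HB 0 i)]. apply Cmod_ge_0. }
    (* The integral equation is reached through the iterates: [w m] and y minus the iterate of order
       m + 1 are both of size (1 / 2)^m. *)
    set (w := fun m t => (picard (S m) t i - (y0 i + Cprim (fun r => F r (y r) i) t))%C).
    assert (Hw : forall m, Cmod (w m s) <= 4 * (L * INR (length ix) * B) * exp (k * Rabs s) * (/ 2) ^ m).
    { intros m.
      assert (Hp : 0 < (/ 2) ^ m) by (apply pow_lt; lra).
      replace (w m s) with (w m s - w m 0)%C.
      2:{ replace (w m 0) with (RtoC 0); [ring|]. unfold w. simpl. rewrite !Cprim_0. ring. }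
      set (A := L * INR (length ix) * (4 * B * (/ 2) ^ m)).
      assert (0 <= A).
      { unfold A. apply Rmult_le_pos; [nra|]. apply Rmult_le_pos; lra. }
      eapply Rle_trans.
      - apply (mean_value_ineq_exp (w m) (fun r => F r (picard m r) i - F r (y r) i)%C A k); [lra| |].
        + intros r _. apply is_cderive_minus; [apply picard_derive|].
          eapply is_cderive_eq. apply is_cderive_plus. apply is_cderive_const.
          apply is_cderive_Cprim. intros x. now apply HC. ring.
        + intros r _. eapply Rle_trans; [apply HL|]. unfold nrm. eapply Rle_trans.
          { apply Rmult_le_compat_l; [exact HL0|]. apply lsum_le. intros j _.
            rewrite <- Cmod_opp. replace (- (picard m r j - y r j))%C with (y r j - picard m r j)%C by ring. apply Hy. }
          rewrite lsum_const. unfold A. right; ring.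
      - assert (A / k <= A) by (apply Rdiv_le_self; lra).
        assert (0 <= A / k). { apply Rdiv_le_0_compat; lra. }
        pose proof (exp_pos (k * Rabs s)).
        replace (4 * (L * INR (length ix) * B) * exp (k * Rabs s) * (/ 2) ^ m) with (A * exp (k * Rabs s)) by (unfold A; ring).
        nra. }
    assert (Hz : Cmod (y s i - (y0 i + Cprim (fun r => F r (y r) i) s))%C <= 0).
    { apply Rnot_lt_le. intros Hpos.
      set (eps := Cmod (y s i - (y0 i + Cprim (fun r => F r (y r) i) s))%C) in *.
      destruct (half_pow_small (4 * (L * INR (length ix) * B) * exp (k * Rabs s) + 4 * (B * exp (k * Rabs s))) eps Hpos) as [m Hm].
      assert (eps <= Cmod (y s i - picard (S m) s i)%C + Cmod (w m s)).
      { unfold eps. eapply Rle_trans; [|apply Cmod_triangle]. right; f_equal. unfold w. ring. }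
      specialize (Hw m). specialize (Hy (S m) s i). simpl pow in Hy.
      assert (Hp : 0 < (/ 2) ^ m) by (apply pow_lt; lra).
      assert (0 <= B * exp (k * Rabs s)) by (apply Rmult_le_pos; [auto|left; apply exp_pos]).
      assert (0 <= B * exp (k * Rabs s) * (/ 2) ^ m) by (apply Rmult_le_pos; lra).
      nra. }
    now apply Cminus_eq_0, Cmod_le_0. }
  exists y. split.
  - intros i. rewrite Heq, Cprim_0. ring.
  - intros i s. apply is_cderive_ext with (fun s => (y0 i + Cprim (fun r => F r (y r) i) s)%C).
    { intros t; symmetry; apply Heq. }
    eapply is_cderive_eq. apply is_cderive_plus. apply is_cderive_const.
    apply is_cderive_Cprim. intros x. now apply HC. ring.
Qed.
End Picard.

(** * Polynomial functions of a complex variable *)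

(* Coefficients are indexed from the top: [hpoly d c z] is the sum of [c k * z ^ (d - 1 - k)] over [k < d]. *)
Fixpoint hpoly (d : nat) (c : nat -> C) (z : C) : C :=
  match d with
  | O => 0%C
  | S m => (z * hpoly m c z + c m)%C
  end.

(** Mind the offset: [ple d] allows degree at most d - 1, while [mon d] has degree exactly d. *)
Definition ple (d : nat) (g : C -> C) : Prop := exists c, forall z, g z = hpoly d c z.
Definition mon (d : nat) (g : C -> C) : Prop := exists h, ple d h /\ forall z, g z = (z ^ d + h z)%C.

Lemma Ci_sq : (Ci * Ci)%C = (- (1))%C.
Proof. apply injective_projections; simpl; ring. Qed.

Lemma hpoly_ext d c c' z : (forall k, (k < d)%nat -> c k = c' k) -> hpoly d c z = hpoly d c' z.
Proof.
  induction d as [|d IH]; intros H; simpl; auto.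
  rewrite IH by (intros; apply H; lia). now rewrite H by lia.
Qed.

Lemma hpoly_plus d c c' z : hpoly d (fun k => c k + c' k)%C z = (hpoly d c z + hpoly d c' z)%C.
Proof. induction d as [|d IH]; simpl; [ring|rewrite IH; ring]. Qed.

Lemma hpoly_scal d a c z : hpoly d (fun k => a * c k)%C z = (a * hpoly d c z)%C.
Proof. induction d as [|d IH]; simpl; [ring|rewrite IH; ring]. Qed.

Lemma hpoly_minus d c c' z : hpoly d (fun k => c k - c' k)%C z = (hpoly d c z - hpoly d c' z)%C.
Proof. induction d as [|d IH]; simpl; [ring|rewrite IH; ring]. Qed.

Lemma hpoly_zero d c z : (forall k, (k < d)%nat -> c k = 0%C) -> hpoly d c z = 0%C.
Proof.
  induction d as [|d IH]; intros H; simpl; auto.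
  rewrite IH by (intros; apply H; lia). rewrite H by lia. ring.
Qed.

Lemma hpoly_shift d c z : hpoly d (fun k => c (S k)) z = (z * hpoly d c z - c O * z ^ d + c d)%C.
Proof. induction d as [|d IH]; simpl; [ring|rewrite IH; ring]. Qed.

Lemma hpoly_top d c z : hpoly (S d) c z = (c O * z ^ d + hpoly d (fun k => c (S k)) z)%C.
Proof. rewrite hpoly_shift. simpl. ring. Qed.

Lemma hpoly_conj d c z : Cconj (hpoly d c (Cconj z)) = hpoly d (fun k => Cconj (c k)) z.
Proof.
  induction d as [|d IH]; simpl.
  - apply injective_projections; simpl; ring.
  - now rewrite Cplus_conj, Cmult_conj, IH, Cconj_conj.
Qed.

Lemma is_cderive_hpoly d (c : R -> nat -> C) (dc : nat -> C) z x :
  (forall k, (k < d)%nat -> is_cderive (fun t => c t k) x (dc k)) ->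
  is_cderive (fun t => hpoly d (c t) z) x (hpoly d dc z).
Proof.
  induction d as [|d IH]; intros H; simpl.
  - apply is_cderive_const.
  - apply is_cderive_plus; [|apply H; lia].
    apply is_cderive_mult_const, IH. intros; apply H; lia.
Qed.

(** * Recovering coefficients from values at the points 2^j s *)

Lemma hpoly_scale d c z :
  hpoly d c (2 * z)%C = hpoly d (fun k => RtoC (2 ^ (d - 1 - k)) * c k)%C z.
Proof.
  induction d as [|d IH]; auto.
  simpl hpoly. rewrite IH.
  replace (d - 0 - d)%nat with O by lia.
  rewrite (hpoly_ext d (fun k => RtoC (2 ^ (d - 0 - k)) * c k)%C (fun k => 2 * (RtoC (2 ^ (d - 1 - k)) * c k))%C).
  - rewrite hpoly_scal. change (2 ^ 0) with 1. ring.
  - intros k Hk. replace (d - 0 - k)%nat with (S (d - 1 - k)) by lia.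
    simpl pow. rewrite RtoC_mult. ring.
Qed.

(* The functionals on coefficient sequences which only see the values of the
   polynomial at finitely many of the points [2 ^ j * s]. *)
Inductive sampled (s : C) (d : nat) : ((nat -> C) -> C) -> Prop :=
| sampled_eval j : sampled s d (fun c => hpoly d c (RtoC (2 ^ j) * s)%C)
| sampled_plus f g : sampled s d f -> sampled s d g -> sampled s d (fun c => f c + g c)%C
| sampled_scal a f : sampled s d f -> sampled s d (fun c => a * f c)%C
| sampled_ext f g : (forall c, f c = g c) -> sampled s d f -> sampled s d g.

(** The difference quotient (g(2 p) - g(p)) / p kills the constant coefficient and multiplies the
    coefficient of z^(d - k) by 2^(d - k) - 1. *)
Lemma sampled_dilate (s : C) d f :
  s <> 0%C -> sampled s d f ->
  sampled s (S d) (fun c => f (fun k => RtoC (2 ^ (d - k) - 1) * c k)%C).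
Proof.
  intros Hs H. induction H as [j|f g _ IHf _ IHg|a f _ IH|f g Hfg _ IH].
  - set (p := (RtoC (2 ^ j) * s)%C).
    assert (Hp : p <> 0%C).
    { apply Cmult_neq_0; [|exact Hs]. intros E. apply RtoC_inj in E.
      pose proof (pow_lt 2 j ltac:(lra)). lra. }
    apply sampled_ext with (fun c => (/ p) * (hpoly (S d) c (RtoC (2 ^ S j) * s) + - (1) * hpoly (S d) c p))%C.
    + intros c. replace (RtoC (2 ^ S j) * s)%C with (2 * p)%C
        by (unfold p; simpl pow; rewrite RtoC_mult; ring).
      simpl hpoly. rewrite hpoly_scale.
      rewrite (hpoly_ext d (fun k => RtoC (2 ^ (d - k) - 1) * c k)%C
        (fun k => 2 * (RtoC (2 ^ (d - 1 - k)) * c k) - c k)%C).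
      * rewrite hpoly_minus, hpoly_scal. field. exact Hp.
      * intros k Hk. replace (d - k)%nat with (S (d - 1 - k)) by lia.
        simpl pow. rewrite RtoC_minus, RtoC_mult. ring.
    + apply sampled_scal, sampled_plus; [|apply sampled_scal]; apply sampled_eval.
  - now apply sampled_plus.
  - now apply sampled_scal.
  - eapply sampled_ext; [|exact IH]. intros c; simpl. apply Hfg.
Qed.

(** Vandermonde inversion without determinants. By dilation and induction every coefficient but the
    last is sampled, as 2^(d - k) - 1 is nonzero for k < d; the last one is the value at [s] minus
    the rest. *)
Lemma sampled_coef (s : C) d k : s <> 0%C -> (k < d)%nat -> sampled s d (fun c => c k).
Proof.
  intros Hs. revert k. induction d as [|d IH]; [lia|].
  assert (Low : forall k, (k < d)%nat -> sampled s (S d) (fun c => c k)).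
  { intros k Hk.
    assert (Hw : RtoC (2 ^ (d - k) - 1) <> 0%C).
    { intros E. apply RtoC_inj in E.
      assert (2 <= 2 ^ (d - k)); [|lra].
      replace (d - k)%nat with (S (d - 1 - k)) by lia. simpl.
      pose proof (pow_R1_Rle 2 (d - 1 - k) ltac:(lra)). lra. }
    apply sampled_ext with (fun c => / RtoC (2 ^ (d - k) - 1) * (RtoC (2 ^ (d - k) - 1) * c k))%C.
    - intros c. field. exact Hw.
    - apply sampled_scal. apply (sampled_dilate s d (fun c => c k) Hs). auto. }
  assert (Partial : forall j, (j <= d)%nat -> sampled s (S d) (fun c => hpoly j c s)).
  { induction j as [|j IHj]; intros Hj; simpl.
    - apply sampled_ext with (fun c => 0 * hpoly (S d) c (RtoC (2 ^ 0) * s))%C.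
      + intros; ring.
      + apply sampled_scal, sampled_eval.
    - apply sampled_plus; [apply sampled_scal, IHj; lia|apply Low; lia]. }
  intros k Hk. destruct (Nat.eq_dec k d) as [->|Hne]; [|apply Low; lia].
  apply sampled_ext with (fun c => hpoly (S d) c (RtoC (2 ^ 0) * s) + - (1) * (s * hpoly d c s))%C.
  - intros c. replace (RtoC (2 ^ 0) * s)%C with s by (simpl; ring). simpl. ring.
  - apply sampled_plus; [apply sampled_eval|]. apply sampled_scal, sampled_scal, Partial. lia.
Qed.

Lemma sampled_derive s d f (c : R -> nat -> C) x :
  (forall z, exists l, is_cderive (fun t => hpoly d (c t) z) x l) ->
  sampled s d f -> exists l, is_cderive (fun t => f (c t)) x l.
Proof.
  intros Hc H. induction H as [j|f g _ [l1 IHf] _ [l2 IHg]|a f _ [l IH]|f g Hfg _ [l IH]].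
  - apply Hc.
  - eexists. apply is_cderive_plus; eassumption.
  - eexists. apply is_cderive_mult_const; eassumption.
  - exists l. eapply is_cderive_ext; [|exact IH]. intros; apply Hfg.
Qed.

Lemma sampled_bound s d f :
  sampled s d f -> exists K J, 0 <= K /\ forall c B,
    (forall j, (j <= J)%nat -> Cmod (hpoly d c (RtoC (2 ^ j) * s)%C) <= B) -> Cmod (f c) <= K * B.
Proof.
  induction 1 as [j|f g _ (K1 & J1 & HK1 & IHf) _ (K2 & J2 & HK2 & IHg)|a f _ (K & J & HK & IH)|f g Hfg _ (K & J & HK & IH)].
  - exists 1, j. split; [lra|]. intros c B H. rewrite Rmult_1_l. apply H; lia.
  - exists (K1 + K2), (max J1 J2). split; [lra|]. intros c B H.
    eapply Rle_trans; [apply Cmod_triangle|].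
    rewrite Rmult_plus_distr_r. apply Rplus_le_compat; [apply IHf|apply IHg]; intros; apply H; lia.
  - exists (Cmod a * K), J. split; [apply Rmult_le_pos; [apply Cmod_ge_0|auto]|]. intros c B H.
    rewrite Cmod_mult, Rmult_assoc. apply Rmult_le_compat_l; [apply Cmod_ge_0|auto].
  - exists K, J. split; auto. intros c B H. rewrite <- Hfg. auto.
Qed.

(** Equivalence of norms on the finite-dimensional space of polynomials: [K] and [J] depend on [s]
    and [d] only. It serves both the closure argument and the bound on the flow. *)
Lemma hpoly_coef_bound (s : C) (d : nat) : s <> 0%C ->
  exists K J, 0 <= K /\ forall c B,
    (forall j, (j <= J)%nat -> Cmod (hpoly d c (RtoC (2 ^ j) * s)%C) <= B) ->
    forall k, (k < d)%nat -> Cmod (c k) <= K * B.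
Proof.
  intros Hs.
  assert (H : forall m, (m <= d)%nat -> exists K J, 0 <= K /\ forall c B,
    (forall j, (j <= J)%nat -> Cmod (hpoly d c (RtoC (2 ^ j) * s)%C) <= B) ->
    forall k, (k < m)%nat -> Cmod (c k) <= K * B).
  { induction m as [|m IH]; intros Hm.
    - exists 0, O. split; [lra|]. intros; lia.
    - destruct (IH ltac:(lia)) as (K1 & J1 & HK1 & H1).
      destruct (sampled_bound s d _ (sampled_coef s d m Hs ltac:(lia))) as (K2 & J2 & HK2 & H2).
      exists (K1 + K2), (max J1 J2). split; [lra|]. intros c B H k Hk.
      assert (HB : 0 <= B). { eapply Rle_trans; [apply Cmod_ge_0|apply (H O); lia]. }
      destruct (Nat.eq_dec k m) as [->|Hne].
      + assert (Cmod (c m) <= K2 * B) by (apply H2; intros; apply H; lia). nra.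
      + assert (Cmod (c k) <= K1 * B) by (apply H1; [intros; apply H; lia|lia]). nra. }
  apply H; lia.
Qed.

Lemma hpoly_zero_coef (s : C) d c :
  s <> 0%C -> (forall j, hpoly d c (RtoC (2 ^ j) * s)%C = 0%C) -> forall k, (k < d)%nat -> c k = 0%C.
Proof.
  intros Hs H k Hk. apply Cmod_eq_0.
  destruct (hpoly_coef_bound s d Hs) as (K & J & HK & HH).
  assert (Cmod (c k) <= K * 0).
  { apply HH; auto. intros. rewrite H, Cmod_0. lra. }
  pose proof (Cmod_ge_0 (c k)). lra.
Qed.

Lemma hpoly_inj d c c' : (forall z, hpoly d c z = hpoly d c' z) -> forall k, (k < d)%nat -> c k = c' k.
Proof.
  intros H k Hk.
  apply Cminus_eq_0, (hpoly_zero_coef 1 d (fun k => c k - c' k)%C); auto; [exact C1_nz|].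
  intros j. rewrite hpoly_minus, H. ring.
Qed.

Lemma hpoly_bound d c B z : 0 <= B ->
  (forall k, (k < d)%nat -> Cmod (c k) <= B) -> Cmod (hpoly d c z) <= B * INR d * (1 + Cmod z) ^ d.
Proof.
  intros HB. pose proof (Cmod_ge_0 z) as Hz.
  induction d as [|d IH]; intros H.
  - simpl. rewrite Cmod_0. lra.
  - simpl hpoly. eapply Rle_trans; [apply Cmod_triangle|]. rewrite Cmod_mult.
    specialize (IH ltac:(intros; apply H; lia)). specialize (H d ltac:(lia)).
    rewrite S_INR. simpl pow.
    assert (HP : 1 <= (1 + Cmod z) ^ d) by (apply pow_R1_Rle; lra).
    pose proof (pos_INR d).
    assert (0 <= B * INR d) by (apply Rmult_le_pos; lra).
    assert (Cmod z * Cmod (hpoly d c z) <= (1 + Cmod z) * (B * INR d * (1 + Cmod z) ^ d)).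
    { apply Rmult_le_compat; try lra. apply Cmod_ge_0. }
    assert (HQ : 1 * 1 <= (1 + Cmod z) * (1 + Cmod z) ^ d) by (apply Rmult_le_compat; lra).
    assert (B * 1 <= B * ((1 + Cmod z) * (1 + Cmod z) ^ d)) by (apply Rmult_le_compat_l; lra).
    lra.
Qed.

Lemma coef_sup d (c : nat -> C) : exists B, 0 <= B /\ forall k, (k < d)%nat -> Cmod (c k) <= B.
Proof.
  induction d as [|d (B & HB & IH)].
  - exists 0; split; [lra|intros; lia].
  - exists (B + Cmod (c d)). pose proof (Cmod_ge_0 (c d)). split; [lra|].
    intros k Hk. destruct (Nat.eq_dec k d) as [->|]; [lra|].
    assert (Cmod (c k) <= B) by (apply IH; lia). lra.
Qed.

Lemma ple_bound d g : ple d g -> exists K, 0 <= K /\ forall z, Cmod (g z) <= K * (1 + Cmod z) ^ d.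
Proof.
  intros [c Hc]. destruct (coef_sup d c) as (B & HB & H).
  exists (B * INR d). split; [pose proof (pos_INR d); nra|].
  intros z. rewrite Hc. now apply hpoly_bound.
Qed.

Lemma ple_bound_top d g : ple d g -> exists K, 0 <= K /\
  forall z, 1 <= Cmod z -> Cmod z * Cmod (g z) <= K * Cmod z ^ d.
Proof.
  intros [c Hc].
  assert (H : exists K, 0 <= K /\
    forall z, 1 <= Cmod z -> Cmod z * Cmod (hpoly d c z) <= K * Cmod z ^ d).
  { clear Hc. induction d as [|d (K & HK & IH)].
    - exists 0; split; [lra|]. intros z Hz; simpl. rewrite Cmod_0; lra.
    - exists (K + Cmod (c d)). pose proof (Cmod_ge_0 (c d)). split; [lra|].
      intros z Hz. simpl hpoly. specialize (IH z Hz).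
      pose proof (Cmod_triangle (z * hpoly d c z) (c d)) as T. rewrite Cmod_mult in T.
      simpl pow. assert (1 <= Cmod z ^ d) by (apply pow_R1_Rle; lra).
      apply Rle_trans with (Cmod z * (Cmod z * Cmod (hpoly d c z) + Cmod (c d))).
      { apply Rmult_le_compat_l; lra. }
      assert (Cmod z * (Cmod z * Cmod (hpoly d c z)) <= Cmod z * (K * Cmod z ^ d)) by (apply Rmult_le_compat_l; lra).
      assert (Cmod z * Cmod (c d) <= Cmod z * (Cmod (c d) * Cmod z ^ d)) by (apply Rmult_le_compat_l; [lra|nra]).
      nra. }
  destruct H as (K & HK & H). exists K; split; auto. intros z Hz. rewrite Hc. auto.
Qed.

(** * Degree bounds, monic polynomials and division *)

Lemma ple_ext d f g : (forall z, f z = g z) -> ple d f -> ple d g.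
Proof. intros H [c Hc]; exists c; intros z; now rewrite <- H. Qed.

Lemma ple_plus d f g : ple d f -> ple d g -> ple d (fun z => f z + g z)%C.
Proof. intros [c Hc] [c' Hc']; exists (fun k => c k + c' k)%C; intros z; now rewrite hpoly_plus, Hc, Hc'. Qed.

Lemma ple_scal d a f : ple d f -> ple d (fun z => a * f z)%C.
Proof. intros [c Hc]; exists (fun k => a * c k)%C; intros z; now rewrite hpoly_scal, Hc. Qed.

Lemma ple_minus d f g : ple d f -> ple d g -> ple d (fun z => f z - g z)%C.
Proof. intros [c Hc] [c' Hc']; exists (fun k => c k - c' k)%C; intros z; now rewrite hpoly_minus, Hc, Hc'. Qed.

Lemma ple_zero d : ple d (fun _ => 0%C).
Proof. exists (fun _ => 0%C); intros z; now rewrite hpoly_zero. Qed.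

Lemma hpoly_cons a d c z : hpoly (S d) (fun k => match k with O => a | S j => c j end) z = (a * z ^ d + hpoly d c z)%C.
Proof. now rewrite hpoly_top. Qed.

Lemma ple_S_intro d a f : ple d f -> ple (S d) (fun z => a * z ^ d + f z)%C.
Proof.
  intros [c Hc]. exists (fun k => match k with O => a | S j => c j end).
  intros z. now rewrite hpoly_cons, Hc.
Qed.

Lemma ple_S_elim d f : ple (S d) f -> exists a g, ple d g /\ forall z, f z = (a * z ^ d + g z)%C.
Proof.
  intros [c Hc]. exists (c O), (hpoly d (fun k => c (S k))). split.
  - eexists; reflexivity.
  - intros z. now rewrite Hc, hpoly_top.
Qed.

Lemma ple_S d f : ple d f -> ple (S d) f.
Proof. intros H. apply (ple_ext _ (fun z => 0 * z ^ d + f z)%C); [intros; ring|]. now apply ple_S_intro. Qed.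

Lemma ple_le d d' f : (d <= d')%nat -> ple d f -> ple d' f.
Proof. induction 1; auto. intros; apply ple_S; auto. Qed.

Lemma ple_mulz d f : ple d f -> ple (S d) (fun z => z * f z)%C.
Proof.
  intros [c Hc]. exists (fun k => if Nat.eq_dec k d then RtoC 0 else c k).
  intros z; simpl. destruct (Nat.eq_dec d d) as [_|]; [|tauto].
  rewrite (hpoly_ext d _ c), Hc; [ring|].
  intros k Hk. destruct (Nat.eq_dec k d); [lia|auto].
Qed.

Lemma ple_const a : ple 1 (fun _ => a).
Proof. exists (fun _ => a). intros z; simpl. ring. Qed.

Lemma ple_mult m k f g : ple m f -> ple k g -> ple (m + k) (fun z => f z * g z)%C.
Proof.
  intros [c Hc] Hg.
  assert (H : ple (m + k) (fun z => hpoly m c z * g z)%C).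
  { clear Hc. induction m as [|m IH]; simpl.
    - apply (ple_ext _ (fun _ => 0%C)); [intros; ring|apply ple_zero].
    - apply (ple_ext _ (fun z => z * (hpoly m c z * g z) + c m * g z)%C); [intros; ring|].
      apply ple_plus; [now apply ple_mulz|]. apply ple_scal. apply (ple_le k); [lia|auto]. }
  eapply ple_ext; [|exact H]. intros z; simpl; now rewrite Hc.
Qed.

Lemma ple_mulpow d j f : ple d f -> ple (j + d) (fun z => z ^ j * f z)%C.
Proof.
  intros H; induction j as [|j IH]; simpl.
  - eapply ple_ext; [|exact H]. intros; ring.
  - eapply ple_ext; [|apply ple_mulz; exact IH]. intros; simpl; ring.
Qed.

Lemma ple_star d f : ple d f -> ple d (fun z => Cconj (f (Cconj z))).
Proof. intros [c Hc]. exists (fun k => Cconj (c k)). intros z. now rewrite Hc, hpoly_conj. Qed.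

Lemma mon_ple d f : mon d f -> ple (S d) f.
Proof.
  intros (h & Hh & H). eapply ple_ext; [|apply (ple_S_intro d 1 h Hh)].
  intros z; simpl. rewrite H. ring.
Qed.

Lemma mon_star d f : mon d f -> mon d (fun z => Cconj (f (Cconj z))).
Proof.
  intros (h & Hh & H). exists (fun z => Cconj (h (Cconj z))). split; [now apply ple_star|].
  intros z. now rewrite H, Cplus_conj, Cpow_conj, Cconj_conj.
Qed.

Lemma mon_mult m k f g : mon m f -> mon k g -> mon (m + k) (fun z => f z * g z)%C.
Proof.
  intros (f' & Hf & Ef) (g' & Hg & Eg).
  exists (fun z => z ^ m * g' z + f' z * g z)%C. split.
  - apply ple_plus; [now apply ple_mulpow|].
    apply (ple_ext _ (fun z => z ^ k * f' z + f' z * g' z)%C); [intros; rewrite Eg; ring|].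
    apply ple_plus; [rewrite Nat.add_comm; now apply ple_mulpow|now apply ple_mult].
  - intros z. rewrite Ef, Eg, Cpow_add_r. ring.
Qed.

Lemma mon_lower_bound d f : mon d f ->
  exists T, 1 <= T /\ forall z, T <= Cmod z -> Cmod z ^ d / 2 <= Cmod (f z).
Proof.
  intros (h & Hh & H). destruct (ple_bound_top d h Hh) as (K & HK & Hb).
  exists (2 * K + 1). split; [lra|]. intros z Hz.
  specialize (Hb z ltac:(lra)).
  assert (HP : 0 <= Cmod z ^ d) by (apply pow_le, Cmod_ge_0).
  assert (Cmod (h z) <= Cmod z ^ d / 2).
  { apply Rmult_le_reg_l with (Cmod z); [lra|]. nra. }
  assert (Cmod z ^ d <= Cmod (f z) + Cmod (h z)); [|lra].
  rewrite <- Cmod_pow. replace (z ^ d)%C with (f z + - h z)%C by (rewrite H; ring).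
  eapply Rle_trans; [apply Cmod_triangle|]. rewrite Cmod_opp. lra.
Qed.

Lemma mon_upper_bound d f : mon d f ->
  exists K, 0 <= K /\ forall z, Cmod (f z) <= K * (1 + Cmod z) ^ d.
Proof.
  intros (h & Hh & H). destruct (ple_bound d h Hh) as (K & HK & Hb).
  exists (1 + K). split; [lra|]. intros z. rewrite H.
  eapply Rle_trans; [apply Cmod_triangle|]. rewrite Cmod_pow.
  assert (Cmod z ^ d <= (1 + Cmod z) ^ d).
  { apply pow_incr. pose proof (Cmod_ge_0 z); lra. }
  specialize (Hb z). lra.
Qed.

Lemma Cmod_imag t : 0 <= t -> Cmod (RtoC t * Ci)%C = t.
Proof. intros H. rewrite Cmod_mult, Cmod_R, Cmod_Ci, Rabs_right; lra. Qed.

(** Degree is read off from growth along the positive imaginary axis, the ray on which the spectral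
    asymptotics are available. For a nonzero top coefficient [a], taking eta = |a| / 2 and t >= 4 K
    / |a| contradicts the bound on the remainder. *)
Lemma ple_drop_top d f : ple (S d) f ->
  (forall eta, 0 < eta -> exists T, forall t, T <= t -> Cmod (f (RtoC t * Ci)%C) <= eta * t ^ d) -> ple d f.
Proof.
  intros Hf H. destruct (ple_S_elim d f Hf) as (a & g & Hg & E).
  assert (Ha : a = 0%C).
  { apply Cmod_eq_0. destruct (Req_dec (Cmod a) 0) as [|Hne]; auto. exfalso.
    assert (Hpos : 0 < Cmod a) by (pose proof (Cmod_ge_0 a); lra).
    destruct (H (Cmod a / 2) ltac:(lra)) as [T HT].
    destruct (ple_bound_top d g Hg) as (K & HK & Hb).
    set (t := Rmax 1 (Rmax T (4 * K / Cmod a))).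
    assert (Ht1 : 1 <= t) by apply Rmax_l.
    assert (Ht2 : T <= t) by (eapply Rle_trans; [apply Rmax_l|apply Rmax_r]).
    assert (Ht3 : 4 * K / Cmod a <= t) by (eapply Rle_trans; [apply Rmax_r|apply Rmax_r]).
    specialize (HT t Ht2). specialize (Hb (RtoC t * Ci)%C). rewrite Cmod_imag in Hb by lra.
    specialize (Hb Ht1). rewrite E in HT.
    assert (Hp : 0 < t ^ d) by (apply pow_lt; lra).
    set (z := (RtoC t * Ci)%C) in *.
    assert (E2 : Cmod a * t ^ d <= Cmod (a * z ^ d + g z) + Cmod (g z)).
    { rewrite <- (Cmod_imag t) at 1 by lra. fold z. rewrite <- Cmod_pow, <- Cmod_mult.
      replace (a * z ^ d)%C with (a * z ^ d + g z + - g z)%C at 1 by ring.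
      eapply Rle_trans; [apply Cmod_triangle|]. rewrite Cmod_opp; lra. }
    assert (E3 : Cmod a / 2 * t ^ d <= Cmod (g z)) by lra.
    assert (E4 : t * (Cmod a / 2 * t ^ d) <= K * t ^ d).
    { eapply Rle_trans; [|exact Hb]. apply Rmult_le_compat_l; lra. }
    assert (E5 : t * Cmod a / 2 <= K) by (apply Rmult_le_reg_r with (t ^ d); [auto|nra]).
    assert (E6 : 4 * K <= t * Cmod a).
    { apply Rmult_le_compat_r with (r := Cmod a) in Ht3; [|lra].
      replace (4 * K / Cmod a * Cmod a) with (4 * K) in Ht3 by (field; lra). lra. }
    assert (K = 0) by lra. subst K. nra. }
  eapply ple_ext; [|exact Hg]. intros z. rewrite E, Ha. ring.
Qed.

Lemma ple_drop d D f : ple D f -> (d <= D)%nat ->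
  (forall eta, 0 < eta -> exists T, forall t, T <= t -> Cmod (f (RtoC t * Ci)%C) <= eta * t ^ d) -> ple d f.
Proof.
  intros HD Hle H. induction Hle as [|D Hle IH]; auto.
  apply IH. apply ple_drop_top; auto.
  intros eta Heta. destruct (H eta Heta) as [T HT].
  exists (Rmax 1 T). intros t Ht.
  assert (1 <= t) by (eapply Rle_trans; [apply Rmax_l|exact Ht]).
  eapply Rle_trans; [apply HT; eapply Rle_trans; [apply Rmax_r|exact Ht]|].
  apply Rmult_le_compat_l; [lra|]. now apply Rle_pow.
Qed.

Lemma ple_vanish d f : ple d f -> (exists T, forall t, T <= t -> f (RtoC t * Ci)%C = 0%C) -> forall z, f z = 0%C.
Proof.
  intros Hf [T HT].
  assert (H0 : ple 0 f).
  { apply (ple_drop 0 d); auto; [lia|]. intros eta Heta. exists T. intros t Ht.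
    rewrite HT by auto. rewrite Cmod_0. simpl. lra. }
  destruct H0 as [c Hc]. intros z. apply Hc.
Qed.

Lemma ple_eq_large d f g : ple d f -> ple d g ->
  (exists T, forall t, T <= t -> f (RtoC t * Ci)%C = g (RtoC t * Ci)%C) -> forall z, f z = g z.
Proof.
  intros Hf Hg [T HT] z.
  apply Cminus_eq_0, (ple_vanish d (fun z => f z - g z)%C); [now apply ple_minus|].
  exists T. intros t Ht. rewrite HT by auto. ring.
Qed.

Lemma mon_nonzero_large d e : mon d e -> exists T, forall t, T <= t -> e (RtoC t * Ci)%C <> 0%C.
Proof.
  intros He. destruct (mon_lower_bound d e He) as (T & HT & H).
  exists T. intros t Ht E. specialize (H (RtoC t * Ci)%C). rewrite Cmod_imag, E, Cmod_0 in H by lra.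
  specialize (H Ht). pose proof (pow_lt t d ltac:(lra)). lra.
Qed.

Lemma Cmult_reg_l' (a b c : C) : a <> 0%C -> (a * b = a * c)%C -> b = c.
Proof.
  intros Ha E. transitivity (/ a * (a * b))%C; [field; auto|]. rewrite E. field; auto.
Qed.

(** A monic factor has no zeros far up the imaginary axis, so it cancels there, and the values there
    determine a polynomial. *)
Lemma mon_cancel m d e f g : mon m e -> ple d f -> ple d g ->
  (forall z, e z * f z = e z * g z)%C -> forall z, f z = g z.
Proof.
  intros He Hf Hg E. apply (ple_eq_large d); auto.
  destruct (mon_nonzero_large m e He) as [T HT]. exists T. intros t Ht.
  apply (Cmult_reg_l' (e (RtoC t * Ci)%C)); auto.
Qed.

Lemma ple_division m j e g : mon m e -> ple (m + j) g ->
  exists q r, ple j q /\ ple m r /\ forall z, g z = (q z * e z + r z)%C.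
Proof.
  intros (h & Hh & He). revert g; induction j as [|j IH]; intros g Hg.
  - exists (fun _ => 0%C), g. rewrite Nat.add_0_r in Hg. repeat split; [apply ple_zero|auto|intros; ring].
  - rewrite Nat.add_succ_r in Hg. destruct (ple_S_elim _ _ Hg) as (a & g1 & Hg1 & E).
    destruct (IH (fun z => g1 z - a * (z ^ j * h z))%C) as (q & r & Hq & Hr & E2).
    { apply ple_minus; auto. apply ple_scal. rewrite Nat.add_comm. now apply ple_mulpow. }
    exists (fun z => a * z ^ j + q z)%C, r. repeat split; auto.
    + now apply ple_S_intro.
    + intros z. specialize (E2 z). rewrite E.
      transitivity (a * z ^ (m + j) + (a * (z ^ j * h z)) + (g1 z - a * (z ^ j * h z)))%C; [ring|].
      rewrite E2, He, Cpow_add_r. ring.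
Qed.

Lemma mon_division m j e g : mon m e -> mon (m + j) g ->
  exists q r, mon j q /\ ple m r /\ forall z, g z = (q z * e z + r z)%C.
Proof.
  intros He (g1 & Hg1 & E).
  pose proof He as (h & Hh & Ee).
  (* The product z^j e is split off beforehand, which makes the quotient monic. *)
  destruct (ple_division m j e (fun z => g1 z - z ^ j * h z)%C He) as (q & r & Hq & Hr & E2).
  { apply ple_minus; auto. rewrite Nat.add_comm. now apply ple_mulpow. }
  exists (fun z => z ^ j + q z)%C, r. repeat split; auto.
  - exists q; auto.
  - intros z. specialize (E2 z). rewrite E.
    transitivity (z ^ (m + j) + z ^ j * h z + (g1 z - z ^ j * h z))%C; [ring|].
    rewrite E2, Ee, Cpow_add_r. ring.
Qed.

Lemma ple_normalise m f : ple m f -> (exists z, f z <> 0%C) ->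
  exists j (a : C), (j < m)%nat /\ a <> 0%C /\ mon j (fun z => a * f z)%C.
Proof.
  revert f; induction m as [|m IH]; intros f Hf [z0 Hz0].
  - destruct Hf as [c Hc]. exfalso; apply Hz0, Hc.
  - destruct (ple_S_elim m f Hf) as (a & g & Hg & E).
    destruct (Ceq_dec a 0%C) as [->|Ha].
    + destruct (IH f) as (j & b & Hj & Hb & Hm).
      * eapply ple_ext; [|exact Hg]. intros z; rewrite E; ring.
      * now exists z0.
      * exists j, b. repeat split; auto.
    + exists m, (/ a)%C. repeat split; auto.
      * intros E2. assert (E3 : (/ a * a)%C = RtoC 1) by (field; auto).
        rewrite E2, Cmult_0_l in E3. apply RtoC_inj in E3. lra.
      * exists (fun z => / a * g z)%C. split; [now apply ple_scal|]. intros z; rewrite E. field; auto.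
Qed.

Lemma peval_ple (p : list C) : ple (length p) (peval p).
Proof.
  induction p as [|a p IH]; simpl.
  - apply ple_zero.
  - apply (ple_ext _ (fun z => z * peval p z + a)%C); [intros; ring|].
    apply ple_plus; [now apply ple_mulz|]. apply (ple_le 1); [lia|apply ple_const].
Qed.

Lemma peval_app (a b : list C) z : peval (a ++ b) z = (peval a z + z ^ length a * peval b z)%C.
Proof. induction a as [|c a IH]; simpl; [ring|rewrite IH; ring]. Qed.

Lemma ple_peval d g : ple d g -> exists p, length p = d /\ forall z, g z = peval p z.
Proof.
  revert g; induction d as [|d IH]; intros g Hg.
  - destruct Hg as [c Hc]. exists nil; split; auto.
  - destruct (ple_S_elim d g Hg) as (a & g1 & Hg1 & E).
    destruct (IH g1 Hg1) as (p & Hp & Ep).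
    exists (p ++ a :: nil). split; [rewrite length_app; simpl; lia|].
    intros z. rewrite peval_app, E, Ep, Hp. simpl. ring.
Qed.

Lemma monic_deg_mon p d : monic_deg p d -> mon d (peval p).
Proof.
  intros (a & Ha & ->). exists (peval a). split; [rewrite <- Ha; apply peval_ple|].
  intros z. rewrite peval_app, Ha. simpl. ring.
Qed.

Lemma mon_monic_deg d g : mon d g -> exists p, monic_deg p d /\ forall z, g z = peval p z.
Proof.
  intros (h & Hh & E). destruct (ple_peval d h Hh) as (a & Ha & Ea).
  exists (a ++ RtoC 1 :: nil). split; [now exists a|].
  intros z. rewrite peval_app, Ha, E, Ea. simpl. ring.
Qed.

(** * Discrete Cauchy estimates and Liouville's theorem *)

Fixpoint csum (n : nat) (f : nat -> C) : C :=
  match n with O => 0%C | S m => (csum m f + f m)%C end.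

(** Coefficients ascend here, in contrast to [hpoly], so that truncating a power series only lowers
    [D]. *)
Definition apoly (D : nat) (c : nat -> C) (z : C) : C := csum D (fun k => c k * z ^ k)%C.

Lemma csum_ext n f g : (forall j, (j < n)%nat -> f j = g j) -> csum n f = csum n g.
Proof.
  induction n as [|n IH]; intros H; simpl; auto.
  rewrite IH by (intros; apply H; lia). now rewrite H by lia.
Qed.

Lemma csum_plus n f g : csum n (fun j => f j + g j)%C = (csum n f + csum n g)%C.
Proof. induction n as [|n IH]; simpl; [ring|rewrite IH; ring]. Qed.

Lemma csum_scal n a f : csum n (fun j => a * f j)%C = (a * csum n f)%C.
Proof. induction n as [|n IH]; simpl; [ring|rewrite IH; ring]. Qed.

Lemma csum_bound n f B : (forall j, (j < n)%nat -> Cmod (f j) <= B) -> Cmod (csum n f) <= INR n * B.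
Proof.
  induction n as [|n IH]; intros H.
  - simpl. rewrite Cmod_0. lra.
  - simpl csum. rewrite S_INR. eapply Rle_trans; [apply Cmod_triangle|].
    specialize (IH ltac:(intros; apply H; lia)). specialize (H n ltac:(lia)). lra.
Qed.

Lemma geometric_csum w n : ((w - 1) * csum n (fun j => w ^ j) = w ^ n - 1)%C.
Proof.
  induction n as [|n IH]; simpl; [ring|].
  transitivity ((w - 1) * csum n (fun j => w ^ j) + (w - 1) * w ^ n)%C; [ring|]. rewrite IH. ring.
Qed.

Definition cis (t : R) : C := (cos t, sin t).

Lemma cis_pow t n : (cis t ^ n)%C = cis (INR n * t).
Proof.
  induction n as [|n IH].
  - simpl. rewrite Rmult_0_l. unfold cis. now rewrite cos_0, sin_0.
  - rewrite Cpow_S, IH, S_INR. replace ((INR n + 1) * t) with (t + INR n * t) by ring.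
    unfold cis. rewrite cos_plus, sin_plus. apply injective_projections; simpl; ring.
Qed.

Lemma Cmod_cis t : Cmod (cis t) = 1.
Proof.
  assert (H : Cmod (cis t) ^ 2 = 1).
  { rewrite Cmod2_alt. unfold Re, Im, cis; simpl. pose proof (sin2_cos2 t) as E. unfold Rsqr in E. lra. }
  pose proof (Cmod_ge_0 (cis t)). nra.
Qed.

Lemma cis_neq_1 t : sin (t / 2) <> 0 -> cis t <> 1%C.
Proof.
  intros Hs E. apply (f_equal fst) in E. simpl in E.
  replace t with (2 * (t / 2)) in E by field. rewrite cos_2a_sin in E. nra.
Qed.

Definition unity_root (q : nat) : C := cis (2 * PI / INR q).

Lemma unity_root_pow_q q : (0 < q)%nat -> (unity_root q ^ q)%C = 1%C.
Proof.
  intros Hq. unfold unity_root. rewrite cis_pow.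
  replace (INR q * (2 * PI / INR q)) with (2 * PI) by (field; apply not_0_INR; lia).
  unfold cis. now rewrite cos_2PI, sin_2PI.
Qed.

Lemma unity_root_pow_neq q m : (0 < m < 2 * q)%nat -> m <> q -> (unity_root q ^ m)%C <> 1%C.
Proof.
  intros Hm Hne. unfold unity_root. rewrite cis_pow. apply cis_neq_1.
  assert (Hq : 0 < INR q) by (apply lt_0_INR; lia).
  assert (Hm0 : 0 < INR m) by (apply lt_0_INR; lia).
  assert (Hm2 : INR m < 2 * INR q).
  { change 2 with (INR 2). rewrite <- mult_INR. apply lt_INR; lia. }
  pose proof PI_RGT_0.
  replace (INR m * (2 * PI / INR q) / 2) with (INR m / INR q * PI) by (field; lra).
  assert (E : INR m / INR q * INR q = INR m) by (field; lra).
  destruct (Nat.lt_gt_cases m q) as [Hc _]. destruct (Hc Hne) as [Hlt|Hgt].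
  - assert (INR m < INR q) by (apply lt_INR; lia).
    apply Rgt_not_eq, sin_gt_0.
    + apply Rmult_lt_0_compat; auto. apply Rdiv_lt_0_compat; auto.
    + assert (INR m / INR q < 1) by (apply Rmult_lt_reg_r with (INR q); lra). nra.
  - assert (INR q < INR m) by (apply lt_INR; lia).
    apply Rlt_not_eq, sin_lt_0.
    + assert (1 < INR m / INR q) by (apply Rmult_lt_reg_r with (INR q); lra). nra.
    + assert (INR m / INR q < 2) by (apply Rmult_lt_reg_r with (INR q); lra). nra.
Qed.

Lemma unity_root_sum q m : (0 < q)%nat -> (0 < m < 2 * q)%nat ->
  csum q (fun j => (unity_root q ^ m) ^ j)%C = if Nat.eq_dec m q then RtoC (INR q) else RtoC 0.
Proof.
  intros Hq Hm. destruct (Nat.eq_dec m q) as [->|Hne].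
  - rewrite unity_root_pow_q by auto. clear Hm Hq.
    induction q as [|q IH]; [reflexivity|].
    simpl csum. rewrite IH, S_INR, RtoC_plus. now rewrite Cpow_1_l.
  - apply (Cmult_reg_l' (unity_root q ^ m - 1)%C).
    + intros E. apply (unity_root_pow_neq q m Hm Hne).
      transitivity (unity_root q ^ m - 1 + 1)%C; [ring|]. rewrite E. ring.
    + rewrite geometric_csum, <- Cpow_mult_r, Nat.mul_comm, Cpow_mult_r, unity_root_pow_q, Cpow_1_l by auto. ring.
Qed.

(* Discrete Cauchy integral formula on the circle of radius [r]. *)
Lemma apoly_coef_average D q c (r : R) k : (D <= q)%nat -> (k < q)%nat ->
  csum q (fun j => apoly D c (RtoC r * unity_root q ^ j) * unity_root q ^ (j * (q - k)))%C
  = if lt_dec k D then (RtoC (INR q) * (c k * RtoC r ^ k))%C else RtoC 0.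
Proof.
  intros HD Hk. induction D as [|D IH].
  - destruct (lt_dec k 0); [lia|].
    rewrite (csum_ext q _ (fun j => 0 * 1)%C) by (intros; unfold apoly; simpl; ring).
    rewrite (csum_scal q 0 (fun _ => RtoC 1)). ring.
  - rewrite (csum_ext q _ (fun j =>
      apoly D c (RtoC r * unity_root q ^ j) * unity_root q ^ (j * (q - k))
      + (c D * RtoC r ^ D) * (unity_root q ^ (D + (q - k))) ^ j)%C).
    2:{ intros j Hj. unfold apoly; simpl csum. rewrite Cpow_mult_l, <- !Cpow_mult_r.
        replace ((D + (q - k)) * j)%nat with (j * D + j * (q - k))%nat by lia.
        rewrite Cpow_add_r. ring. }
    rewrite csum_plus, IH, csum_scal by lia.
    rewrite unity_root_sum by lia.
    destruct (lt_dec k D), (lt_dec k (S D)), (Nat.eq_dec (D + (q - k)) q); try lia; try ring.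
    replace k with D by lia. ring.
Qed.

(** Averaging over [D] equally spaced points isolates each of [D] coefficients exactly, so a finite
    sum replaces the contour integral. *)
Lemma cauchy_estimate D c (r B : R) : 0 <= r ->
  (forall z, Cmod z = r -> Cmod (apoly D c z) <= B) ->
  forall k, (k < D)%nat -> Cmod (c k) * r ^ k <= B.
Proof.
  intros Hr HB k Hk.
  pose proof (apoly_coef_average D D c r k (Nat.le_refl _) Hk) as E.
  destruct (lt_dec k D) as [_|]; [|lia].
  assert (HD : 0 < INR D) by (apply lt_0_INR; lia).
  apply Rmult_le_reg_l with (INR D); auto.
  replace (INR D * (Cmod (c k) * r ^ k)) with (Cmod (RtoC (INR D) * (c k * RtoC r ^ k))%C).
  2:{ rewrite !Cmod_mult, Cmod_pow, !Cmod_R, !Rabs_right; lra. }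
  rewrite <- E. apply csum_bound. intros j Hj.
  assert (Hu : forall i, Cmod (unity_root D ^ i)%C = 1).
  { intros i. rewrite Cmod_pow. unfold unity_root. rewrite Cmod_cis. apply pow1. }
  rewrite Cmod_mult, Hu, Rmult_1_r. apply HB.
  rewrite Cmod_mult, Hu, Cmod_R, Rabs_right; lra.
Qed.

Lemma apoly_pad D j c : exists c', forall z, apoly (D + j) c' z = apoly D c z.
Proof.
  exists (fun k => if lt_dec k D then c k else RtoC 0). intros z.
  induction j as [|j IH].
  - rewrite Nat.add_0_r. apply csum_ext. intros k Hk. destruct (lt_dec k D); [auto|lia].
  - rewrite Nat.add_succ_r. unfold apoly in *; simpl. rewrite IH.
    destruct (lt_dec (D + j) D); [lia|]. ring.
Qed.

Lemma apoly_ple D c : ple D (apoly D c).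
Proof.
  induction D as [|D IH].
  - apply ple_zero.
  - apply (ple_ext _ (fun z => c D * z ^ D + apoly D c z)%C).
    + intros z; unfold apoly; simpl. ring.
    + now apply ple_S_intro.
Qed.

(** Stands in for holomorphy: it is what Picard iterates provide, and enough for Cauchy
    estimates. *)
Definition locpoly (g : C -> C) : Prop :=
  forall r eps, 0 < r -> 0 < eps -> exists D c,
    forall z, Cmod z <= r -> Cmod (g z - apoly D c z)%C <= eps.

(** A polynomial close to [g] on |z| <= r has, by Cauchy's estimate, coefficients of size at most B
    / r^k. On |z| <= R0 its terms beyond degree d therefore add up to O(1 / r) plus the
    approximation error. *)
Lemma liouville_truncation g d K : locpoly g -> 0 <= K ->
  (forall z, Cmod (g z) <= K * (1 + Cmod z) ^ d) ->
  forall R0 eta, 1 <= R0 -> 0 < eta ->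
  exists p, ple (S d) p /\ forall z, Cmod z <= R0 -> Cmod (g z - p z)%C <= eta.
Proof.
  intros Hg HK Hb R0 eta HR Heta.
  (* [M / r] bounds K (2 r)^d (R0 / r)^(d + 1). The radius [r] makes it at most eta / 4, and the
     total error is eta / 6 + 2 (eta / 4 + eta / 6) = eta. *)
  set (M := K * 2 ^ d * R0 ^ S d).
  assert (HM : 0 <= M).
  { unfold M. apply Rmult_le_pos; [apply Rmult_le_pos; [auto|]|]; apply pow_le; lra. }
  set (r := 2 * R0 + 4 * M / eta).
  assert (HMe : 0 <= 4 * M / eta) by (apply Rdiv_le_0_compat; lra).
  assert (Hr : 2 * R0 <= r) by (unfold r; lra).
  assert (HMr : 2 * M <= eta / 2 * r).
  { unfold r. replace (2 * M) with (eta / 2 * (4 * M / eta)) by (field; lra). nra. }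
  destruct (Hg r (eta / 6)) as (D0 & c0 & Hc0); [lra|lra|].
  destruct (apoly_pad D0 (S d) c0) as (c & Hpad).
  assert (Hc : forall z, Cmod z <= r -> Cmod (g z - apoly (S d + D0) c z)%C <= eta / 6).
  { intros z Hz. rewrite Nat.add_comm, Hpad. auto. }
  set (B := K * (1 + r) ^ d + eta / 6).
  assert (HB0 : 0 <= B).
  { unfold B. assert (0 <= K * (1 + r) ^ d); [|lra]. apply Rmult_le_pos; auto. apply pow_le; lra. }
  assert (Hce : forall k, (k < S d + D0)%nat -> Cmod (c k) * r ^ k <= B).
  { apply cauchy_estimate; [lra|]. intros z Hz.
    replace (apoly (S d + D0) c z) with (g z + - (g z - apoly (S d + D0) c z))%C by ring.
    eapply Rle_trans; [apply Cmod_triangle|]. rewrite Cmod_opp. unfold B.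
    apply Rplus_le_compat; [rewrite <- Hz; apply Hb|apply Hc; lra]. }
  set (rho := R0 / r).
  assert (Hrho : 0 <= rho <= / 2).
  { unfold rho. split; [apply Rdiv_le_0_compat; lra|]. apply Rdiv_le_mult; lra. }
  exists (apoly (S d) c). split; [apply apoly_ple|].
  intros z Hz.
  assert (Htail : forall j, (j <= D0)%nat ->
    Cmod (apoly (S d + j) c z - apoly (S d) c z)%C <= 2 * B * rho ^ S d * (1 - (/ 2) ^ j)).
  { induction j as [|j IH]; intros Hj.
    - rewrite Nat.add_0_r. replace (apoly (S d) c z - apoly (S d) c z)%C with (RtoC 0) by ring.
      rewrite Cmod_0. simpl. lra.
    - rewrite Nat.add_succ_r.
      replace (apoly (S (S d + j)) c z - apoly (S d) c z)%C with
        ((apoly (S d + j) c z - apoly (S d) c z) + c (S d + j)%nat * z ^ (S d + j))%C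
        by (unfold apoly; simpl; ring).
      eapply Rle_trans; [apply Cmod_triangle|].
      specialize (IH ltac:(lia)).
      assert (Cmod (c (S d + j)%nat * z ^ (S d + j))%C <= B * rho ^ S d * (/ 2) ^ j).
      { rewrite Cmod_mult, Cmod_pow.
        apply Rle_trans with (Cmod (c (S d + j)%nat) * R0 ^ (S d + j)).
        { apply Rmult_le_compat_l; [apply Cmod_ge_0|]. apply pow_incr. split; [apply Cmod_ge_0|auto]. }
        replace R0 with (r * rho) by (unfold rho; field; lra).
        rewrite Rpow_mult_distr, <- Rmult_assoc.
        apply Rle_trans with (B * rho ^ (S d + j)).
        { apply Rmult_le_compat_r; [apply pow_le; lra|]. apply Hce; lia. }
        rewrite pow_add, <- Rmult_assoc. apply Rmult_le_compat_l.
        - apply Rmult_le_pos; [auto|apply pow_le; lra].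
        - apply pow_incr; lra. }
      change ((/ 2) ^ S j) with (/ 2 * (/ 2) ^ j). lra. }
  specialize (Htail D0 (Nat.le_refl _)).
  assert (HBr : B * rho ^ S d <= M / r + eta / 6).
  { assert (H1 : rho ^ S d <= 1).
    { rewrite <- (pow1 (S d)). apply pow_incr; lra. }
    assert (H0 : 0 <= rho ^ S d) by (apply pow_le; lra).
    assert (H2 : K * (1 + r) ^ d * rho ^ S d <= M / r).
    { apply Rle_trans with (K * (2 * r) ^ d * rho ^ S d).
      - apply Rmult_le_compat_r; auto. apply Rmult_le_compat_l; auto. apply pow_incr; lra.
      - right. unfold M, rho. rewrite !Rpow_mult_distr. simpl.
        unfold Rdiv. rewrite Rpow_mult_distr, pow_inv. field. split; [lra|apply pow_nonzero; lra]. }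
    unfold B. nra. }
  assert (HMr2 : M / r <= eta / 4). { apply Rdiv_le_mult; lra. }
  assert (Hp : 0 < (/ 2) ^ D0) by (apply pow_lt; lra).
  assert (HBr0 : 0 <= B * rho ^ S d) by (apply Rmult_le_pos; [auto|apply pow_le; lra]).
  replace (g z - apoly (S d) c z)%C with
    ((g z - apoly (S d + D0) c z) + (apoly (S d + D0) c z - apoly (S d) c z))%C by ring.
  eapply Rle_trans; [apply Cmod_triangle|].
  specialize (Hc z ltac:(lra)). nra.
Qed.

(** By [hpoly_coef_bound], closeness of polynomials of bounded degree at finitely many points is
    closeness of coefficients, so the coefficients converge geometrically. *)
Lemma ple_closed n g :
  (forall R0 eta, 1 <= R0 -> 0 < eta ->
    exists p, ple n p /\ forall z, Cmod z <= R0 -> Cmod (g z - p z)%C <= eta) -> ple n g.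
Proof.
  intros H.
  destruct (hpoly_coef_bound 1 n C1_nz) as (K & J & HK & HKJ).
  assert (HJ : 1 <= 2 ^ J) by (apply pow_R1_Rle; lra).
  (* The m-th disc contains the sample points 2^j with j <= J, and the discs exhaust the plane. *)
  assert (Hc : forall m, exists c : nat -> C,
    forall z, Cmod z <= INR m + 2 ^ J -> Cmod (g z - hpoly n c z)%C <= (/ 2) ^ m).
  { intros m. destruct (H (INR m + 2 ^ J) ((/ 2) ^ m)) as (p & [c Hc] & Hp).
    - pose proof (pos_INR m); lra.
    - apply pow_lt; lra.
    - exists c. intros z Hz. rewrite <- Hc. auto. }
  set (c := fun m => proj1_sig (constructive_indefinite_description _ (Hc m))).
  assert (Hcc : forall m z, Cmod z <= INR m + 2 ^ J -> Cmod (g z - hpoly n (c m) z)%C <= (/ 2) ^ m).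
  { intros m. unfold c. destruct (constructive_indefinite_description _ (Hc m)); auto. }
  clearbody c. clear Hc H.
  assert (Hstep : forall k, (k < n)%nat -> forall m, Cmod (c (S m) k - c m k)%C <= (K * 2) * (/ 2) ^ m).
  { intros k Hk m. rewrite Rmult_assoc.
    apply (HKJ (fun k => c (S m) k - c m k)%C); auto.
    intros j Hj. rewrite Cmult_1_r. set (z := RtoC (2 ^ j)).
    assert (Hz : Cmod z <= 2 ^ J).
    { unfold z. rewrite Cmod_R, Rabs_right by (apply Rle_ge, pow_le; lra). apply Rle_pow; [lra|auto]. }
    rewrite hpoly_minus.
    replace (hpoly n (c (S m)) z - hpoly n (c m) z)%C with
      (- (g z - hpoly n (c (S m)) z) + (g z - hpoly n (c m) z))%C by ring.
    eapply Rle_trans; [apply Cmod_triangle|]. rewrite Cmod_opp.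
    pose proof (pos_INR m). pose proof (Hcc m z ltac:(lra)) as H1.
    pose proof (Hcc (S m) z) as H2. rewrite S_INR in H2. specialize (H2 ltac:(lra)).
    simpl in H2. assert (0 < (/ 2) ^ m) by (apply pow_lt; lra). lra. }
  exists (fun k => Clim (fun m => c m k)). intros z.
  set (c' := fun k => Clim (fun m => c m k)).
  assert (Hlim : forall m k, (k < n)%nat -> Cmod (c' k - c m k)%C <= 4 * (K * 2) * (/ 2) ^ m).
  { intros m k Hk. apply (Clim_geometric (fun m => c m k)). auto. }
  apply Cminus_eq_0, Cmod_le_0, Rnot_lt_le.
  intros Hpos.
    set (A := 1 + 4 * (K * 2) * INR n * (1 + Cmod z) ^ n).
    assert (HA : 0 <= A).
    { unfold A. assert (0 <= 4 * (K * 2) * INR n * (1 + Cmod z) ^ n); [|lra].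
      apply Rmult_le_pos; [apply Rmult_le_pos; [lra|apply pos_INR]|]. apply pow_le. pose proof (Cmod_ge_0 z); lra. }
    destruct (half_pow_small A _ Hpos) as [m0 Hm0].
    destruct (INR_unbounded (Cmod z)) as [m1 Hm1].
    set (m := (m0 + m1)%nat).
    assert (Hm : (/ 2) ^ m <= (/ 2) ^ m0).
    { unfold m. rewrite pow_add. assert (0 < (/ 2) ^ m0) by (apply pow_lt; lra).
      assert ((/ 2) ^ m1 <= 1). { rewrite <- (pow1 m1). apply pow_incr; lra. }
      nra. }
    assert (Hzm : Cmod z <= INR m + 2 ^ J).
    { unfold m. rewrite plus_INR. pose proof (pos_INR m0). lra. }
    assert (Hp : 0 < (/ 2) ^ m) by (apply pow_lt; lra).
    assert (T : Cmod (g z - hpoly n c' z)%C <= A * (/ 2) ^ m).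
    { replace (g z - hpoly n c' z)%C with ((g z - hpoly n (c m) z) + - hpoly n (fun k => c' k - c m k)%C z)%C
        by (rewrite hpoly_minus; ring).
      eapply Rle_trans; [apply Cmod_triangle|]. rewrite Cmod_opp.
      pose proof (Hcc m z Hzm) as H1.
      pose proof (hpoly_bound n (fun k => c' k - c m k)%C (4 * (K * 2) * (/ 2) ^ m) z) as H2.
      specialize (H2 ltac:(nra) (fun k Hk => Hlim m k Hk)). unfold A. nra. }
    nra.
Qed.

Lemma liouville g d K : locpoly g -> 0 <= K ->
  (forall z, Cmod (g z) <= K * (1 + Cmod z) ^ d) -> ple (S d) g.
Proof.
  intros Hg HK Hb. apply ple_closed. intros R0 eta HR Heta.
  apply (liouville_truncation g d K); auto.
Qed.

(** * The common factor and the reflection symmetry *)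

Definition cpoly (f : C -> C) : Prop := exists d, ple d f.

Lemma cpoly_minus f g : cpoly f -> cpoly g -> cpoly (fun z => f z - g z)%C.
Proof.
  intros [d Hd] [d' Hd']. exists (max d d'). apply ple_minus; eapply ple_le; try eassumption; lia.
Qed.

Lemma cpoly_scal a f : cpoly f -> cpoly (fun z => a * f z)%C.
Proof. intros [d Hd]. exists d. now apply ple_scal. Qed.

Lemma cpoly_mult f g : cpoly f -> cpoly g -> cpoly (fun z => f z * g z)%C.
Proof. intros [d Hd] [d' Hd']. exists (d + d')%nat. now apply ple_mult. Qed.

Lemma cpoly_star f : cpoly f -> cpoly (fun z => Cconj (f (Cconj z))).
Proof. intros [d Hd]. exists d. now apply ple_star. Qed.

Lemma mon_cpoly d f : mon d f -> cpoly f.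
Proof. intros H. exists (S d). now apply mon_ple. Qed.

Lemma cpoly_cancel m e f g : mon m e -> cpoly f -> cpoly g ->
  (forall z, e z * f z = e z * g z)%C -> forall z, f z = g z.
Proof.
  intros He [d Hd] [d' Hd']. apply (mon_cancel m (max d d')); auto; eapply ple_le; try eassumption; lia.
Qed.

Lemma cpoly_eq_large f g : cpoly f -> cpoly g ->
  (exists T, forall t, T <= t -> f (RtoC t * Ci)%C = g (RtoC t * Ci)%C) -> forall z, f z = g z.
Proof.
  intros [d Hd] [d' Hd']. apply (ple_eq_large (max d d')); eapply ple_le; try eassumption; lia.
Qed.

Lemma nat_least (P : nat -> Prop) : (exists n, P n) -> exists m, P m /\ forall k, (k < m)%nat -> ~ P k.
Proof.
  intros [n Hn]. revert Hn. induction n as [n IH] using (well_founded_induction Wf_nat.lt_wf). intros Hn.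
  destruct (classic (exists k, (k < n)%nat /\ P k)) as [(k & Hk & HP)|Hno].
  - now apply (IH k).
  - exists n; split; auto. intros k Hk HP. apply Hno. now exists k.
Qed.

(* The monic generator [e] of the ideal of all [e] with [e * (psi, phi)] divisible
   by [f] is its own reflection, because the reflection of [e] is again in the ideal. *)
Lemma real_reduction (N : nat) (f psi phi : C -> C) :
  mon N f -> cpoly psi -> cpoly phi ->
  (forall z, Cconj (f (Cconj z)) * psi z = - (f z * Cconj (phi (Cconj z))))%C ->
  exists m q e b,
    (m <= N)%nat /\ mon (N - m) q /\ mon m e /\ cpoly b /\
    (forall z, f z = q z * e z)%C /\
    (forall z, psi z = q z * b z)%C /\
    (forall z, phi z = - (q z * Cconj (b (Cconj z))))%C /\
    (forall z, Cconj (e (Cconj z)) = e z).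
Proof.
  intros Hf Hpsi Hphi HA.
  assert (HB : forall z, (Cconj (f (Cconj z)) * phi z = - (f z * Cconj (psi (Cconj z))))%C).
  { intros z. specialize (HA (Cconj z)). apply (f_equal Cconj) in HA.
    rewrite Copp_conj, !Cmult_conj, !Cconj_conj in HA.
    transitivity (- - (Cconj (f (Cconj z)) * phi z))%C; [ring|]. rewrite <- HA. reflexivity. }
  set (P := fun m => exists e b c, mon m e /\ cpoly b /\ cpoly c /\
    (forall z, e z * psi z = f z * b z)%C /\ (forall z, e z * phi z = f z * c z)%C).
  destruct (nat_least P) as (m & (e & b & c & He & Hb & Hc & Eb & Ec) & Hmin).
  { exists N, f, psi, phi. repeat split; auto. }
  (* By minimality a member of the ideal of degree below [m] is zero: otherwise its normalisation
     would be a smaller monic member. This is applied to a remainder and to the difference of [e]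
     and its reflection. *)
  assert (Hzero : forall r b' c', ple m r -> cpoly b' -> cpoly c' ->
    (forall z, r z * psi z = f z * b' z)%C -> (forall z, r z * phi z = f z * c' z)%C -> forall z, r z = 0%C).
  { intros r b' c' Hr Hb' Hc' E1 E2 z. apply NNPP. intros Hz.
    destruct (ple_normalise m r Hr) as (j & a & Hj & Ha & Hm); [now exists z|].
    apply (Hmin j Hj). exists (fun z => a * r z)%C, (fun z => a * b' z)%C, (fun z => a * c' z)%C.
    repeat split; auto using cpoly_scal.
    - intros w. rewrite <- Cmult_assoc, E1. ring.
    - intros w. rewrite <- Cmult_assoc, E2. ring. }
  assert (HmN : (m <= N)%nat).
  { destruct (Nat.le_gt_cases m N) as [|Hlt]; auto. exfalso.
    apply (Hmin N Hlt). exists f, psi, phi. repeat split; auto. }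
  destruct (mon_division m (N - m) e f He) as (q & r & Hq & Hr & Ef).
  { now replace (m + (N - m))%nat with N by lia. }
  assert (Hr0 : forall z, r z = 0%C).
  { apply (Hzero r (fun z => psi z - q z * b z)%C (fun z => phi z - q z * c z)%C); auto.
    - apply cpoly_minus; auto. apply cpoly_mult; auto. eapply mon_cpoly; eauto.
    - apply cpoly_minus; auto. apply cpoly_mult; auto. eapply mon_cpoly; eauto.
    - intros z. transitivity ((q z * e z + r z) * psi z - q z * (e z * psi z))%C; [ring|].
      rewrite <- Ef, Eb. ring.
    - intros z. transitivity ((q z * e z + r z) * phi z - q z * (e z * phi z))%C; [ring|].
      rewrite <- Ef, Ec. ring. }
  assert (Efq : forall z, f z = (q z * e z)%C) by (intros; rewrite Ef, Hr0; ring).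
  assert (Hqp : cpoly q) by (eapply mon_cpoly; eauto).
  assert (Epsi : forall z, psi z = (q z * b z)%C).
  { apply (cpoly_cancel m e); auto using cpoly_mult. intros z. rewrite Eb, Efq. ring. }
  assert (Ephi : forall z, phi z = (q z * c z)%C).
  { apply (cpoly_cancel m e); auto using cpoly_mult. intros z. rewrite Ec, Efq. ring. }
  assert (Hfp : cpoly f) by (eapply mon_cpoly; eauto).
  assert (Hep : cpoly e) by (eapply mon_cpoly; eauto).
  (* With f = q e and phi = q c, and a star for reflection, the hypothesis reads q* e* psi = - f q*
     c*; the monic q* is cancelled. *)
  assert (E1 : forall z, (Cconj (e (Cconj z)) * psi z = f z * (- (1) * Cconj (c (Cconj z))))%C).
  { apply (cpoly_cancel (N - m) (fun z => Cconj (q (Cconj z)))).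
    - now apply mon_star.
    - apply cpoly_mult; auto. now apply cpoly_star.
    - apply cpoly_mult; auto. apply cpoly_scal. now apply cpoly_star.
    - intros z. specialize (HA z). rewrite Efq, Ephi, !Cmult_conj in HA.
      transitivity (Cconj (q (Cconj z)) * Cconj (e (Cconj z)) * psi z)%C; [ring|].
      rewrite HA. ring. }
  assert (E2 : forall z, (Cconj (e (Cconj z)) * phi z = f z * (- (1) * Cconj (b (Cconj z))))%C).
  { apply (cpoly_cancel (N - m) (fun z => Cconj (q (Cconj z)))).
    - now apply mon_star.
    - apply cpoly_mult; auto. now apply cpoly_star.
    - apply cpoly_mult; auto. apply cpoly_scal. now apply cpoly_star.
    - intros z. specialize (HB z). rewrite Efq, Epsi, !Cmult_conj in HB.
      transitivity (Cconj (q (Cconj z)) * Cconj (e (Cconj z)) * phi z)%C; [ring|].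
      rewrite HB. ring. }
  assert (Ee : forall z, Cconj (e (Cconj z)) = e z).
  { intros z. apply Cminus_eq_0. apply (Hzero (fun z => Cconj (e (Cconj z)) - e z)%C
        (fun z => - (1) * Cconj (c (Cconj z)) - b z)%C (fun z => - (1) * Cconj (b (Cconj z)) - c z)%C).
      - destruct (mon_star m e He) as (h & Hh & Eh). destruct He as (h' & Hh' & Eh').
        apply (ple_ext _ (fun z => h z - h' z)%C); [|now apply ple_minus].
        intros w. rewrite Eh, Eh'. ring.
      - apply cpoly_minus; auto. apply cpoly_scal. now apply cpoly_star.
      - apply cpoly_minus; auto. apply cpoly_scal. now apply cpoly_star.
      - intros w. transitivity (Cconj (e (Cconj w)) * psi w - e w * psi w)%C; [ring|]. rewrite E1, Eb. ring.
      - intros w. transitivity (Cconj (e (Cconj w)) * phi w - e w * phi w)%C; [ring|]. rewrite E2, Ec. ring. }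
  assert (Ecb : forall z, c z = (- (1) * Cconj (b (Cconj z)))%C).
  { apply (cpoly_cancel N f); auto.
    - apply cpoly_scal. now apply cpoly_star.
    - intros z. rewrite <- E2, <- Ec, Ee. reflexivity. }
  exists m, q, e, b. repeat split; auto.
  intros z. rewrite Ephi, Ecb. ring.
Qed.

(** * The Dirac system *)

Definition dirac_ode (v : R -> C) (z : C) (y1 y2 : R -> C) : Prop :=
  (forall x, is_cderive y1 x (- (Ci * z * y1 x) - v x * y2 x)%C) /\
  (forall x, is_cderive y2 x (Cconj (v x) * y1 x + Ci * z * y2 x)%C).

Lemma dirac_solution_ode v z y1 y2 : dirac_solution v z y1 y2 <-> dirac_ode v z y1 y2.
Proof.
  split.
  - intros (d1 & d2 & H1 & H2 & E1 & E2). split; intros x.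
    + eapply is_cderive_eq; [apply H1|].
      (* The middle summand carries the factor -1 - i^2 = 0; it makes the given equation appear as a
         subterm. *)
      transitivity (- Ci * (Ci * d1 x + Ci * v x * y2 x) + (- (1) - Ci * Ci) * (- d1 x - v x * y2 x) - v x * y2 x)%C; [ring|].
      rewrite E1, Ci_sq. ring.
    + eapply is_cderive_eq; [apply H2|].
      transitivity (Ci * (- Ci * d2 x + Ci * Cconj (v x) * y1 x) + (1 + Ci * Ci) * (d2 x - Cconj (v x) * y1 x) + Cconj (v x) * y1 x)%C; [ring|].
      rewrite E2, Ci_sq. ring.
  - intros [H1 H2].
    exists (fun x => - (Ci * z * y1 x) - v x * y2 x)%C, (fun x => Cconj (v x) * y1 x + Ci * z * y2 x)%C.
    split; [exact H1|split; [exact H2|split]].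
    + intros x. transitivity (- (Ci * Ci) * z * y1 x)%C; [ring|]. rewrite Ci_sq; ring.
    + intros x. transitivity (- (Ci * Ci) * z * y2 x)%C; [ring|]. rewrite Ci_sq; ring.
Qed.

Lemma dirac_ode_lin v z y1 y2 w1 w2 a b :
  dirac_ode v z y1 y2 -> dirac_ode v z w1 w2 ->
  dirac_ode v z (fun x => a * y1 x + b * w1 x)%C (fun x => a * y2 x + b * w2 x)%C.
Proof.
  intros [H1 H2] [H3 H4]; split; intros x.
  - eapply is_cderive_eq. apply is_cderive_plus; apply is_cderive_mult_const; [apply H1|apply H3]. ring.
  - eapply is_cderive_eq. apply is_cderive_plus; apply is_cderive_mult_const; [apply H2|apply H4]. ring.
Qed.

Lemma dirac_ode_shift v z y1 y2 a :
  dirac_ode v z y1 y2 -> dirac_ode (fun x => v (x + a)) z (fun x => y1 (x + a)) (fun x => y2 (x + a)).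
Proof. intros [H1 H2]; split; intros x; [apply (is_cderive_comp_shift y1)|apply (is_cderive_comp_shift y2)]; auto. Qed.

Lemma dirac_ode_potential_ext v v' z y1 y2 :
  (forall x, v x = v' x) -> dirac_ode v z y1 y2 -> dirac_ode v' z y1 y2.
Proof. intros E [H1 H2]; split; intros x; rewrite <- E; auto. Qed.

(** For real z the coefficient matrix U lies in su(2); this is the corresponding quaternionic
    symmetry, which exchanges z and conj z. *)
Lemma dirac_ode_conj v z y1 y2 :
  dirac_ode v (Cconj z) y1 y2 -> dirac_ode v z (fun x => - Cconj (y2 x))%C (fun x => Cconj (y1 x)).
Proof.
  assert (Hi : Cconj Ci = (- Ci)%C) by (apply injective_projections; simpl; ring).
  intros [H1 H2]; split; intros x.
  - eapply is_cderive_eq. apply is_cderive_opp, is_cderive_conj, H2.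
    rewrite Cplus_conj, !Cmult_conj, !Cconj_conj, Hi. ring.
  - eapply is_cderive_eq. apply is_cderive_conj, H1.
    rewrite Cminus_conj, Copp_conj, !Cmult_conj, !Cconj_conj, Hi. ring.
Qed.

(** The off-diagonal part of U is anti-Hermitian and drops out: the derivative of |y1|^2 + |y2|^2 is
    2 Im z (|y1|^2 - |y2|^2). The bound is therefore uniform in the potential. *)
Lemma dirac_energy v z y1 y2 x : dirac_ode v z y1 y2 ->
  Cmod (y1 x) ^ 2 + Cmod (y2 x) ^ 2 <=
  (Cmod (y1 0) ^ 2 + Cmod (y2 0) ^ 2) * exp (2 * Rabs (Im z) * Rabs x).
Proof.
  intros [H1 H2].
  apply (gronwall (fun r => Cmod (y1 r) ^ 2 + Cmod (y2 r) ^ 2)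
    (fun r => 2 * Re (Cconj (y1 r) * (- (Ci * z * y1 r) - v r * y2 r)) +
              2 * Re (Cconj (y2 r) * (Cconj (v r) * y1 r + Ci * z * y2 r)))).
  - intros r _. apply is_rderive_plus; apply is_derive_Cmod2; auto.
  - intros r _.
    replace (2 * Re (Cconj (y1 r) * (- (Ci * z * y1 r) - v r * y2 r)) +
              2 * Re (Cconj (y2 r) * (Cconj (v r) * y1 r + Ci * z * y2 r)))
      with (2 * Im z * (Cmod (y1 r) ^ 2 - Cmod (y2 r) ^ 2)).
    2:{ rewrite !Cmod2_alt. unfold Re, Im. destruct (y1 r), (y2 r), (v r), z. simpl. ring. }
    rewrite !Rabs_mult, (Rabs_right 2) by lra.
    pose proof (pow2_ge_0 (Cmod (y1 r))). pose proof (pow2_ge_0 (Cmod (y2 r))).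
    apply Rmult_le_compat_l. { pose proof (Rabs_pos (Im z)). lra. }
    apply Rabs_le. lra.
Qed.

Lemma sum_sq_zero (a b : C) : Cmod a ^ 2 + Cmod b ^ 2 <= 0 -> a = 0%C /\ b = 0%C.
Proof. intros H. split; apply Cmod_eq_0; nra. Qed.

Lemma dirac_unique v z y1 y2 w1 w2 :
  dirac_ode v z y1 y2 -> dirac_ode v z w1 w2 -> y1 0 = w1 0 -> y2 0 = w2 0 ->
  forall x, y1 x = w1 x /\ y2 x = w2 x.
Proof.
  intros H H' E1 E2 x.
  pose proof (dirac_energy v z _ _ x (dirac_ode_lin v z _ _ _ _ 1 (- (1)) H H')) as K. simpl in K.
  rewrite E1, E2 in K.
  replace (1 * w1 0 + - (1) * w1 0)%C with (RtoC 0) in K by ring.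
  replace (1 * w2 0 + - (1) * w2 0)%C with (RtoC 0) in K by ring.
  rewrite Cmod_0 in K.
  destruct (sum_sq_zero (1 * y1 x + - (1) * w1 x)%C (1 * y2 x + - (1) * w2 x)%C) as [K1 K2].
  { simpl. eapply Rle_trans; [exact K|]. right; ring. }
  split; apply Cminus_eq_0; [rewrite <- K1|rewrite <- K2]; ring.
Qed.

Lemma continuous_bounded (u : R -> C) (A : R) :
  (forall x, continuous u x) -> exists V, 0 <= V /\ forall s, Rabs s <= A -> Cmod (u s) <= V.
Proof.
  intros Hu.
  destruct (Rle_lt_dec 0 A) as [HA|HA].
  2:{ exists 0; split; [lra|]. intros s Hs. pose proof (Rabs_pos s); lra. }
  assert (B : forall g : R -> R, (forall x, continuous g x) -> exists M, forall s, Rabs s <= A -> Rabs (g s) <= M).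
  { intros g Hg.
    destruct (continuity_ab_maj (fun s => Rabs (g s)) (- A) A) as (x & Hx & _); [lra| |].
    - intros c _. apply continuity_pt_filterlim. apply continuous_Rabs_comp. apply Hg.
    - exists (Rabs (g x)). intros s Hs. apply Hx. now apply Rabs_le_between. }
  destruct (B (fun s => fst (u s))) as [M1 H1]. { intros x. now apply continuous_C_iff. }
  destruct (B (fun s => snd (u s))) as [M2 H2]. { intros x. now apply continuous_C_iff. }
  assert (0 <= M1 + M2).
  { assert (H0 : Rabs 0 <= A) by (rewrite Rabs_R0; auto).
    pose proof (H1 0 H0). pose proof (H2 0 H0). pose proof (Rabs_pos (fst (u 0))). pose proof (Rabs_pos (snd (u 0))). lra. }
  exists (M1 + M2); split; auto. intros s Hs. eapply Rle_trans; [apply Cmod_le_sum|].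
  specialize (H1 s Hs). specialize (H2 s Hs). simpl in *. lra.
Qed.

(** * Asymptotics of solutions in the upper half plane *)

(** This is exp (i z s) in real terms. *)
Definition cexp (z : C) (s : R) : C := (RtoC (exp (- (Im z * s))) * cis (Re z * s))%C.

Lemma cexp_0 z : cexp z 0 = 1%C.
Proof.
  unfold cexp, cis. rewrite !Rmult_0_r, Ropp_0, exp_0, cos_0, sin_0.
  apply injective_projections; simpl; ring.
Qed.

Lemma is_cderive_cexp z s : is_cderive (cexp z) s (Ci * z * cexp z s)%C.
Proof.
  apply is_cderive_iff. unfold cexp, cis, Re, Im. simpl. split; auto_derive; auto; ring.
Qed.

Lemma Cmod_Re_bound (a b c : C) : Rabs (Re (Cconj a * (b * c))) <= Cmod a * (Cmod b * Cmod c).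
Proof. eapply Rle_trans; [apply re_le_Cmod|]. rewrite !Cmod_mult, Cmod_conj. lra. Qed.

(* After the gauge [p = e^{izs} y1], [q = e^{izs} y2] the component [q] is damped at
   rate [2 * Im z] and driven by [p], while [p] is driven by [q] only. *)
Lemma dirac_half_plane (l V eta : R) : 0 < l -> 0 <= V -> 0 < eta ->
  exists C0, 0 < C0 /\ forall (z : C) w y1 y2,
    C0 <= Im z -> dirac_ode w z y1 y2 -> (forall s, 0 <= s <= l -> Cmod (w s) <= V) ->
    Cmod (y1 0) ^ 2 + Cmod (y2 0) ^ 2 <= 1 ->
    Cmod (cexp z l * y1 l - y1 0)%C <= eta /\ Cmod (cexp z l * y2 l)%C <= eta.
Proof.
  intros Hl HV Heta.
  (* [S / tau] collects the error terms below, with k = V / (2 tau) and exp (- tau l) <= 1 / (l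
     tau). *)
  set (S := V * V * l / 2 + V + V / 2 + / l).
  assert (Hil : 0 < / l) by (apply Rinv_0_lt_compat; auto).
  assert (HS : 0 < S) by (unfold S; nra).
  exists (S / eta). split; [apply Rdiv_lt_0_compat; auto|].
  intros z w y1 y2 Hz [H1 H2] Hw H0.
  set (tau := Im z) in *.
  assert (Htau : 0 < tau). { eapply Rlt_le_trans; [|exact Hz]. apply Rdiv_lt_0_compat; auto. }
  assert (HSt : S / tau <= eta).
  { apply Rdiv_le_mult; auto. apply Rmult_le_reg_r with (/ eta); [apply Rinv_0_lt_compat; auto|].
    replace (eta * tau * / eta) with tau by (field; lra). exact Hz. }
  set (p := fun s => (cexp z s * y1 s)%C). set (q := fun s => (cexp z s * y2 s)%C).
  assert (Hp : forall s, is_cderive p s (- (w s * q s))%C).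
  { intros s. eapply is_cderive_eq. apply is_cderive_mult. apply is_cderive_cexp. apply H1. unfold q. ring. }
  assert (Hq : forall s, is_cderive q s (2 * Ci * z * q s + Cconj (w s) * p s)%C).
  { intros s. eapply is_cderive_eq. apply is_cderive_mult. apply is_cderive_cexp. apply H2. unfold p, q. ring. }
  assert (Hp0 : p 0 = y1 0) by (unfold p; rewrite cexp_0; ring).
  assert (Hq0 : q 0 = y2 0) by (unfold q; rewrite cexp_0; ring).
  (* After the gauge the diagonal rates are 0 and 2 i z, so the energy decreases, with derivative -
     4 tau |q|^2. *)
  assert (Hen : forall s, 0 <= s -> Cmod (p s) ^ 2 + Cmod (q s) ^ 2 <= 1).
  { intros s Hs. eapply Rle_trans; [|exact H0]. rewrite <- Hp0, <- Hq0.
    apply (derive_nonpos_decr (fun s => Cmod (p s) ^ 2 + Cmod (q s) ^ 2)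
      (fun s => 2 * Re (Cconj (p s) * (- (w s * q s))) + 2 * Re (Cconj (q s) * (2 * Ci * z * q s + Cconj (w s) * p s)))); auto.
    - intros r _. apply is_rderive_plus; apply is_derive_Cmod2; auto.
    - intros r _.
      replace (2 * Re (Cconj (p r) * (- (w r * q r))) + 2 * Re (Cconj (q r) * (2 * Ci * z * q r + Cconj (w r) * p r)))
        with (- 4 * tau * Cmod (q r) ^ 2).
      2:{ rewrite !Cmod2_alt. unfold tau, Re, Im. destruct (p r), (q r), (w r), z. simpl. ring. }
      pose proof (pow2_ge_0 (Cmod (q r))). nra. }
  assert (Hp1 : forall s, 0 <= s -> Cmod (p s) <= 1).
  { intros s Hs. specialize (Hen s Hs). pose proof (Cmod_ge_0 (p s)). nra. }
  set (k := V / (2 * tau)).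
  assert (Hk : 0 <= k) by (apply Rdiv_le_0_compat; lra).
  assert (Hkt : 2 * tau * k = V) by (unfold k; field; lra).
  (* At the level [k] damping balances forcing: exp (2 tau s) (|q|^2 - k^2) is nonincreasing, and
     the initial value of [q] is forgotten at rate exp (- tau s). *)
  assert (Hqb : forall s, 0 <= s <= l -> Cmod (q s) <= k + exp (- (tau * s))).
  { intros s Hs.
    assert (D : exp (2 * tau * s) * (Cmod (q s) ^ 2 - k ^ 2) <= exp (2 * tau * 0) * (Cmod (q 0) ^ 2 - k ^ 2)).
    { apply (derive_nonpos_decr (fun s => exp (2 * tau * s) * (Cmod (q s) ^ 2 - k ^ 2))
       (fun s => (2 * tau * exp (2 * tau * s)) * (Cmod (q s) ^ 2 - k ^ 2) +
          exp (2 * tau * s) * (2 * Re (Cconj (q s) * (2 * Ci * z * q s + Cconj (w s) * p s)) - 0))); [lra| |].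
      - intros r _. apply (is_rderive_mult (fun s => exp (2 * tau * s)) (fun s => Cmod (q s) ^ 2 - k ^ 2)).
        + auto_derive; auto. ring.
        + apply is_rderive_minus. apply is_derive_Cmod2; auto.
          exact (is_derive_const (K := R_AbsRing) (V := R_NormedModule) (k ^ 2) r).
      - intros r Hr.
        replace (Re (Cconj (q r) * (2 * Ci * z * q r + Cconj (w r) * p r))) with
          (- 2 * tau * Cmod (q r) ^ 2 + Re (Cconj (q r) * (Cconj (w r) * p r))).
        2:{ rewrite !Cmod2_alt. unfold tau, Re, Im. destruct (p r), (q r), (w r), z. simpl. ring. }
        pose proof (Cmod_Re_bound (q r) (Cconj (w r)) (p r)) as K. rewrite Cmod_conj in K.
        pose proof (Rle_abs (Re (Cconj (q r) * (Cconj (w r) * p r)))) as K2.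
        specialize (Hw r ltac:(lra)). specialize (Hp1 r ltac:(lra)).
        pose proof (Cmod_ge_0 (q r)) as Q0. pose proof (Cmod_ge_0 (w r)). pose proof (Cmod_ge_0 (p r)).
        assert (K3 : Cmod (w r) * Cmod (p r) <= V * 1) by (apply Rmult_le_compat; auto).
        assert (K4 : Cmod (q r) * (Cmod (w r) * Cmod (p r)) <= Cmod (q r) * (V * 1)) by (apply Rmult_le_compat_l; auto).
        pose proof (exp_pos (2 * tau * r)) as X.
        pose proof (pow2_ge_0 (Cmod (q r) - k)) as Sq.
        set (ReT := Re (Cconj (q r) * (Cconj (w r) * p r))) in *.
        replace (2 * tau * exp (2 * tau * r) * (Cmod (q r) ^ 2 - k ^ 2) +
          exp (2 * tau * r) * (2 * (-2 * tau * Cmod (q r) ^ 2 + ReT) - 0))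
          with (exp (2 * tau * r) * (2 * (ReT - Cmod (q r) * V) - 2 * tau * (Cmod (q r) - k) ^ 2)) by (rewrite <- Hkt; ring).
        assert (0 <= tau * (Cmod (q r) - k) ^ 2) by (apply Rmult_le_pos; lra).
        rewrite <- (Rmult_0_r (exp (2 * tau * r))). apply Rmult_le_compat_l; lra. }
    rewrite Rmult_0_r, exp_0, Rmult_1_l in D.
    assert (Hq01 : Cmod (q 0) ^ 2 <= 1).
    { rewrite Hq0. pose proof (pow2_ge_0 (Cmod (y1 0))). lra. }
    assert (Ex : exp (2 * tau * s) * (exp (- (tau * s)) * exp (- (tau * s))) = 1).
    { rewrite <- !exp_plus. replace (2 * tau * s + (- (tau * s) + - (tau * s))) with 0 by ring. apply exp_0. }
    pose proof (exp_pos (2 * tau * s)) as X1. pose proof (exp_pos (- (tau * s))) as X2.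
    assert (Hsq : Cmod (q s) ^ 2 <= k ^ 2 + exp (- (tau * s)) * exp (- (tau * s))).
    { apply Rmult_le_reg_l with (exp (2 * tau * s)); auto. nra. }
    apply Rsqr_incr_0_var; [|lra]. unfold Rsqr. nra. }
  assert (Hpl : Cmod (p l - p 0)%C <= V * (k * l - exp (- (tau * l)) / tau) - V * (k * 0 - exp (- (tau * 0)) / tau)).
  { apply (mean_value_ineq p (fun s => - (w s * q s))%C (fun s => V * (k * s - exp (- (tau * s)) / tau))
      (fun s => V * (k + exp (- (tau * s))))); [lra|intros; apply Hp| |].
    - intros s _. auto_derive; [lra|]. field. lra.
    - intros s Hs. rewrite Cmod_opp, Cmod_mult. apply Rmult_le_compat; auto; apply Cmod_ge_0. }
  rewrite Rmult_0_r, Rmult_0_r, Ropp_0, exp_0 in Hpl.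
  assert (Hel : exp (- (tau * l)) <= / l / tau).
  { rewrite exp_Ropp. replace (/ l / tau) with (/ (tau * l)) by (field; lra).
    apply Rinv_le_contravar; [nra|]. pose proof (exp_ineq1_le (tau * l)). lra. }
  pose proof (exp_pos (- (tau * l))) as Xl.
  assert (Hexl : 0 <= exp (- (tau * l)) / tau) by (apply Rdiv_le_0_compat; lra).
  assert (HSe : S / tau = V * k * l + V / tau + k + / l / tau).
  { unfold S, k. field. lra. }
  assert (HVt : 0 <= V / tau) by (apply Rdiv_le_0_compat; lra).
  assert (HVkl : 0 <= V * k * l) by (apply Rmult_le_pos; nra).
  assert (Hlt : 0 < / l / tau) by (apply Rdiv_lt_0_compat; auto).
  split.
  - rewrite <- Hp0. eapply Rle_trans; [exact Hpl|].
    replace (V * (k * l - exp (- (tau * l)) / tau) - V * (0 - 1 / tau)) with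
      (V * k * l + V / tau - V * (exp (- (tau * l)) / tau)) by (field; lra).
    assert (0 <= V * (exp (- (tau * l)) / tau)) by (apply Rmult_le_pos; auto). lra.
  - specialize (Hqb l ltac:(lra)). unfold q in Hqb. lra.
Qed.

(* [N_x = [U, N]] for [N = [[a, b], [c, -a]]] and [U = [[-iz, -v], [conj v, iz]]]. *)
Definition lax_ode (v : R -> C) (z : C) (a b c : R -> C) : Prop :=
  (forall x, is_cderive a x (- (v x * c x) - Cconj (v x) * b x)%C) /\
  (forall x, is_cderive b x (- (2 * Ci * z * b x) + 2 * v x * a x)%C) /\
  (forall x, is_cderive c x (2 * Ci * z * c x + 2 * Cconj (v x) * a x)%C).

(** The weight 2 makes this the squared Hilbert-Schmidt norm of the trace-free matrix, preserved by
    commutators with anti-Hermitian matrices; only Im z contributes. *)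
Lemma lax_energy v z a b c x : lax_ode v z a b c ->
  2 * Cmod (a x) ^ 2 + Cmod (b x) ^ 2 + Cmod (c x) ^ 2 <=
  (2 * Cmod (a 0) ^ 2 + Cmod (b 0) ^ 2 + Cmod (c 0) ^ 2) * exp (4 * Rabs (Im z) * Rabs x).
Proof.
  intros (Ha & Hb & Hc).
  apply (gronwall (fun r => 2 * Cmod (a r) ^ 2 + Cmod (b r) ^ 2 + Cmod (c r) ^ 2)
    (fun r => 2 * (2 * Re (Cconj (a r) * (- (v r * c r) - Cconj (v r) * b r))) +
              2 * Re (Cconj (b r) * (- (2 * Ci * z * b r) + 2 * v r * a r)) +
              2 * Re (Cconj (c r) * (2 * Ci * z * c r + 2 * Cconj (v r) * a r)))).
  - intros r _. apply is_rderive_plus; [apply is_rderive_plus|]; [apply is_derive_scal| |]; apply is_derive_Cmod2; auto.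
  - intros r _.
    replace (2 * (2 * Re (Cconj (a r) * (- (v r * c r) - Cconj (v r) * b r))) +
              2 * Re (Cconj (b r) * (- (2 * Ci * z * b r) + 2 * v r * a r)) +
              2 * Re (Cconj (c r) * (2 * Ci * z * c r + 2 * Cconj (v r) * a r)))
      with (4 * Im z * (Cmod (b r) ^ 2 - Cmod (c r) ^ 2)).
    2:{ rewrite !Cmod2_alt. unfold Re, Im. destruct (a r), (b r), (c r), (v r), z. simpl. ring. }
    rewrite !Rabs_mult, (Rabs_right 4) by lra.
    pose proof (pow2_ge_0 (Cmod (a r))). pose proof (pow2_ge_0 (Cmod (b r))). pose proof (pow2_ge_0 (Cmod (c r))).
    apply Rmult_le_compat_l. { pose proof (Rabs_pos (Im z)). lra. }
    apply Rabs_le. lra.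
Qed.

(** * Polynomials in [z] with coefficients depending on [x] *)

(** The degree is uniform in x and the coefficients are continuous in x, so the class is closed
    under each operation of a Picard step, integration in x included. *)
Definition pfun (Q : R -> C -> C) : Prop :=
  exists D (q : R -> nat -> C), (forall k x, continuous (fun t => q t k) x) /\
    forall x z, Q x z = apoly D (q x) z.

Lemma pfun_pad D (q : R -> nat -> C) j :
  (forall k x, continuous (fun t => q t k) x) ->
  exists q' : R -> nat -> C, (forall k x, continuous (fun t => q' t k) x) /\
    forall x z, apoly D (q x) z = apoly (D + j) (q' x) z.
Proof.
  intros Hq. exists (fun t k => if lt_dec k D then q t k else RtoC 0). split.
  - intros k x. destruct (lt_dec k D); auto. apply continuous_const.
  - intros x z. induction j as [|j IH].
    + rewrite Nat.add_0_r. apply csum_ext. intros k Hk. destruct (lt_dec k D); [auto|lia].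
    + rewrite Nat.add_succ_r. unfold apoly in *; simpl. rewrite IH.
      destruct (lt_dec (D + j) D); [lia|]. ring.
Qed.

Lemma pfun_plus P Q : pfun P -> pfun Q -> pfun (fun x z => P x z + Q x z)%C.
Proof.
  intros (D1 & p & Hp & Ep) (D2 & q & Hq & Eq).
  destruct (pfun_pad D1 p D2 Hp) as (p' & Hp' & Ep').
  destruct (pfun_pad D2 q D1 Hq) as (q' & Hq' & Eq').
  exists (D1 + D2)%nat, (fun t k => p' t k + q' t k)%C. split.
  - intros k x. apply (continuous_Cplus (fun t => p' t k) (fun t => q' t k)); auto.
  - intros x z. rewrite Ep, Eq, Ep', Eq', (Nat.add_comm D2 D1). unfold apoly.
    rewrite <- csum_plus. apply csum_ext. intros; ring.
Qed.

Lemma pfun_cmul g P : (forall x, continuous g x) -> pfun P -> pfun (fun x z => g x * P x z)%C.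
Proof.
  intros Hg (D & p & Hp & Ep). exists D, (fun t k => g t * p t k)%C. split.
  - intros k x. apply (continuous_Cmult g (fun t => p t k)); auto.
  - intros x z. rewrite Ep. unfold apoly. rewrite <- csum_scal. apply csum_ext. intros; ring.
Qed.

Lemma pfun_scal a P : pfun P -> pfun (fun x z => a * P x z)%C.
Proof. apply (pfun_cmul (fun _ => a)). intros; apply continuous_const. Qed.

Lemma pfun_zmul P : pfun P -> pfun (fun x z => z * P x z)%C.
Proof.
  intros (D & p & Hp & Ep). exists (S D), (fun t k => match k with O => RtoC 0 | S j => p t j end). split.
  - intros [|k] x; [apply continuous_const|auto].
  - intros x z. rewrite Ep. clear Ep. unfold apoly. induction D as [|D IH].
    + simpl. ring.
    + simpl csum in *. transitivity (z * csum D (fun k => p x k * z ^ k) + z * (p x D * z ^ D))%C; [ring|].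
      rewrite IH. simpl. ring.
Qed.

Lemma pfun_ext P Q : (forall x z, P x z = Q x z) -> pfun P -> pfun Q.
Proof. intros E (D & p & Hp & Ep). exists D, p. split; auto. intros; now rewrite <- E. Qed.

Lemma pfun_const p : cpoly p -> pfun (fun _ z => p z).
Proof.
  intros [d [c Hc]]. apply (pfun_ext (fun _ z => hpoly d c z)); [intros; now rewrite Hc|]. clear Hc.
  induction d as [|d IH]; simpl.
  - exists O, (fun _ _ => RtoC 0). split; [intros; apply continuous_const|]. reflexivity.
  - apply (pfun_plus (fun _ z => z * hpoly d c z)%C (fun _ _ => c d)).
    + now apply pfun_zmul.
    + exists 1%nat, (fun _ _ => c d). split; [intros; apply continuous_const|].
      intros; unfold apoly; simpl; ring.
Qed.

Lemma pfun_primitive Q : pfun Q -> exists P, pfun P /\ (forall z, P 0 z = 0%C) /\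
  forall x z, is_cderive (fun t => P t z) x (Q x z).
Proof.
  intros (D & q & Hq & Eq).
  exists (fun x z => apoly D (fun k => Cprim (fun t => q t k) x) z). split; [|split].
  - exists D, (fun x k => Cprim (fun t => q t k) x). split; auto.
    intros k x. eapply is_cderive_continuous, is_cderive_Cprim. auto.
  - intros z. unfold apoly. rewrite (csum_ext D _ (fun _ => 0 * 0)%C).
    + rewrite (csum_scal D 0 (fun _ => RtoC 0)). ring.
    + intros j _. rewrite Cprim_0. ring.
  - intros x z. rewrite Eq. unfold apoly. clear Eq. induction D as [|D IH]; cbn [csum].
    + apply is_cderive_const.
    + apply is_cderive_plus; auto.
      eapply is_cderive_eq.
      * apply (is_cderive_mult (fun t => Cprim (fun s => q s D) t) (fun _ => z ^ D)%C).
        -- apply (is_cderive_Cprim (fun s => q s D)); auto.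
        -- apply is_cderive_const.
      * cbv beta; ring.
Qed.

Lemma pfun_locpoly_slice (g : C -> C) x :
  (forall r eps, 0 < r -> 0 < eps -> exists Q, pfun Q /\ forall z, Cmod z <= r -> Cmod (g z - Q x z)%C <= eps) ->
  locpoly g.
Proof.
  intros H r eps Hr Heps. destruct (H r eps Hr Heps) as (Q & (D & q & _ & Eq) & HQ).
  exists D, (q x). intros z Hz. rewrite <- Eq. auto.
Qed.

Lemma cpoly_bounded_disc p r : cpoly p -> exists K, 0 <= K /\ forall z, Cmod z <= r -> Cmod (p z) <= K.
Proof.
  intros [d Hd]. destruct (ple_bound d p Hd) as (K & HK & H).
  exists (K * (1 + Rabs r) ^ d). split.
  - apply Rmult_le_pos; auto. apply pow_le. pose proof (Rabs_pos r); lra.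
  - intros z Hz. eapply Rle_trans; [apply H|]. apply Rmult_le_compat_l; auto.
    apply pow_incr. pose proof (Cmod_ge_0 z). pose proof (Rle_abs r). lra.
Qed.

(* Picard iteration, started at the polynomial initial value, stays polynomial in [z]. *)
Lemma lax_locpoly v (a b c : R -> C -> C) :
  (forall x, continuous v x) ->
  (forall z, lax_ode v z (fun x => a x z) (fun x => b x z) (fun x => c x z)) ->
  cpoly (a 0) -> cpoly (b 0) -> cpoly (c 0) ->
  forall x, locpoly (a x) /\ locpoly (b x) /\ locpoly (c x).
Proof.
  intros Hv Hode Ha0 Hb0 Hc0 X.
  assert (Main : forall r, 0 < r -> exists M k, 0 < k /\ 0 <= M /\ forall n, exists A B E,
    pfun A /\ pfun B /\ pfun E /\
    forall x z, Rabs x <= Rabs X -> Cmod z <= r ->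
      Cmod (A x z - a x z)%C <= M * (/ 2) ^ n * exp (k * Rabs x) /\
      Cmod (B x z - b x z)%C <= M * (/ 2) ^ n * exp (k * Rabs x) /\
      Cmod (E x z - c x z)%C <= M * (/ 2) ^ n * exp (k * Rabs x)).
  { intros r Hr.
    destruct (continuous_bounded v (Rabs X) Hv) as (V & HV & Hvb).
    destruct (cpoly_bounded_disc (a 0) r Ha0) as (Ka & HKa & Hka).
    destruct (cpoly_bounded_disc (b 0) r Hb0) as (Kb & HKb & Hkb).
    destruct (cpoly_bounded_disc (c 0) r Hc0) as (Kc & HKc & Hkc).
    set (S0 := 2 * Ka ^ 2 + Kb ^ 2 + Kc ^ 2).
    assert (HS0 : 0 <= S0). { unfold S0. pose proof (pow2_ge_0 Ka). pose proof (pow2_ge_0 Kb). pose proof (pow2_ge_0 Kc). lra. }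
    (* [L] is a Lipschitz constant of the Lax equation for |x| <= |X| and |z| <= r; k = 2 L halves
       the weighted error at each iteration. *)
    set (L := 2 * V + 2 * r). set (k := 2 * L).
    assert (HL : 0 < L) by (unfold L; lra). assert (Hk : 0 < k) by (unfold k; lra).
    set (W := S0 * exp (4 * r * Rabs X) + 1).
    assert (HW : 0 <= W). { unfold W. pose proof (exp_pos (4 * r * Rabs X)). nra. }
    assert (Hsq : forall x z, Rabs x <= Rabs X -> Cmod z <= r ->
      Cmod (a x z) <= W /\ Cmod (b x z) <= W /\ Cmod (c x z) <= W).
    { intros x z Hx Hz.
      pose proof (lax_energy v z _ _ _ x (Hode z)) as En. cbv beta in En.
      assert (E1 : 2 * Cmod (a 0 z) ^ 2 + Cmod (b 0 z) ^ 2 + Cmod (c 0 z) ^ 2 <= S0).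
      { unfold S0. specialize (Hka z Hz). specialize (Hkb z Hz). specialize (Hkc z Hz).
        pose proof (Cmod_ge_0 (a 0 z)). pose proof (Cmod_ge_0 (b 0 z)). pose proof (Cmod_ge_0 (c 0 z)).
        assert (Cmod (a 0 z) ^ 2 <= Ka ^ 2) by (apply pow_incr; lra).
        assert (Cmod (b 0 z) ^ 2 <= Kb ^ 2) by (apply pow_incr; lra).
        assert (Cmod (c 0 z) ^ 2 <= Kc ^ 2) by (apply pow_incr; lra). lra. }
      assert (E2 : exp (4 * Rabs (Im z) * Rabs x) <= exp (4 * r * Rabs X)).
      { apply exp_le_compat. pose proof (Rabs_snd_le z). unfold Im. pose proof (Rabs_pos (snd z)). pose proof (Rabs_pos x).
        apply Rmult_le_compat; lra. }
      assert (E3 : 2 * Cmod (a x z) ^ 2 + Cmod (b x z) ^ 2 + Cmod (c x z) ^ 2 <= S0 * exp (4 * r * Rabs X)).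
      { eapply Rle_trans; [exact En|]. apply Rmult_le_compat; auto.
        - pose proof (pow2_ge_0 (Cmod (a 0 z))). pose proof (pow2_ge_0 (Cmod (b 0 z))). pose proof (pow2_ge_0 (Cmod (c 0 z))). lra.
        - left; apply exp_pos. }
      pose proof (pow2_ge_0 (Cmod (a x z))). pose proof (pow2_ge_0 (Cmod (b x z))). pose proof (pow2_ge_0 (Cmod (c x z))).
      pose proof (pow2_ge_0 (Cmod (a x z) - 1)). pose proof (pow2_ge_0 (Cmod (b x z) - 1)). pose proof (pow2_ge_0 (Cmod (c x z) - 1)).
      pose proof (Cmod_ge_0 (a x z)). pose proof (Cmod_ge_0 (b x z)). pose proof (Cmod_ge_0 (c x z)).
      unfold W. repeat split; nra. }
    exists (2 * W), k. split; [auto|split; [lra|]].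
    induction n as [|n (A & B & E & HA & HB & HE & Herr)].
    - exists (fun _ z => a 0 z), (fun _ z => b 0 z), (fun _ z => c 0 z).
      split; [now apply pfun_const|split; [now apply pfun_const|split; [now apply pfun_const|]]].
      intros x z Hx Hz.
      assert (H0 : Rabs 0 <= Rabs X) by (rewrite Rabs_R0; apply Rabs_pos).
      destruct (Hsq x z Hx Hz) as (X1 & X2 & X3). destruct (Hsq 0 z H0 Hz) as (Y1 & Y2 & Y3).
      assert (Hex : 1 <= exp (k * Rabs x)).
      { pose proof (exp_ineq1_le (k * Rabs x)). pose proof (Rabs_pos x). nra. }
      simpl pow. rewrite Rmult_1_r.
      assert (Tri : forall p q : C, Cmod p <= W -> Cmod q <= W -> Cmod (p - q)%C <= 2 * W * exp (k * Rabs x)).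
      { intros p q Hp Hq. eapply Rle_trans; [apply (Cmod_triangle p (- q))|]. rewrite Cmod_opp. nra. }
      auto.
    - destruct (pfun_primitive (fun x z => - (1) * (v x * E x z) + - (1) * (Cconj (v x) * B x z))%C) as (A' & HA' & A0 & Ad).
      { apply pfun_plus; apply pfun_scal; apply pfun_cmul; auto. intros; now apply continuous_Cconj. }
      destruct (pfun_primitive (fun x z => - (2 * Ci) * (z * B x z) + 2 * (v x * A x z))%C) as (B' & HB' & B0 & Bd).
      { apply pfun_plus; apply pfun_scal; [now apply pfun_zmul|apply pfun_cmul; auto]. }
      destruct (pfun_primitive (fun x z => (2 * Ci) * (z * E x z) + 2 * (Cconj (v x) * A x z))%C) as (E' & HE' & E0 & Ed).
      { apply pfun_plus; apply pfun_scal; [now apply pfun_zmul|apply pfun_cmul; auto]. intros; now apply continuous_Cconj. }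
      exists (fun x z => a 0 z + A' x z)%C, (fun x z => b 0 z + B' x z)%C, (fun x z => c 0 z + E' x z)%C.
      split; [now apply (pfun_plus (fun _ z => a 0 z) A'); [apply pfun_const|]|].
      split; [now apply (pfun_plus (fun _ z => b 0 z) B'); [apply pfun_const|]|].
      split; [now apply (pfun_plus (fun _ z => c 0 z) E'); [apply pfun_const|]|].
      intros x z Hx Hz.
      set (eps := 2 * W * (/ 2) ^ n) in *.
      assert (Heps : 0 <= eps). { unfold eps. apply Rmult_le_pos; [lra|apply pow_le; lra]. }
      assert (Fin : forall (w : R -> C) (dw : R -> C), w 0 = 0%C -> (forall s, is_cderive w s (dw s)) ->
        (forall s, Rabs s <= Rabs x -> Cmod (dw s) <= L * eps * exp (k * Rabs s)) ->
        Cmod (w x) <= 2 * W * (/ 2) ^ S n * exp (k * Rabs x)).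
      { intros w dw Hw0 Hw Hdw.
        replace (w x) with (w x - w 0)%C by (rewrite Hw0; ring).
        eapply Rle_trans; [apply (mean_value_ineq_exp w dw (L * eps) k x Hk); auto|].
        replace (2 * W * (/ 2) ^ S n) with (L * eps / k) by (unfold eps, k; simpl; field; lra).
        apply Rmult_le_compat_l; [|lra]. apply Rdiv_le_0_compat; nra. }
      assert (Hn2 : Cmod (2 * Ci)%C = 2). { rewrite Cmod_mult, Cmod_Ci, Cmod_R, Rabs_right; lra. }
      assert (Hn3 : Cmod (RtoC 2) = 2). { rewrite Cmod_R, Rabs_right; lra. }
      destruct (Hode z) as (Oa & Ob & Oc).
      assert (Hvs : forall s, Rabs s <= Rabs x -> Cmod (v s) <= V /\ Cmod (Cconj (v s)) <= V).
      { intros s Hs. rewrite Cmod_conj. split; apply Hvb; lra. }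
      assert (Tri : forall p1 p2 q1 q2 G, Cmod p1 * Cmod q1 + Cmod p2 * Cmod q2 <= G ->
         Cmod (p1 * q1 + p2 * q2)%C <= G).
      { intros. eapply Rle_trans; [apply Cmod_triangle|]. now rewrite !Cmod_mult. }
      assert (Two : forall P G Q e, 0 <= P <= Q -> 0 <= G <= e -> P * G <= Q * e).
      { intros; apply Rmult_le_compat; lra. }
      split; [|split].
      + apply (Fin (fun x => a 0 z + A' x z - a x z)%C
          (fun s => (- v s) * (E s z - c s z) + (- Cconj (v s)) * (B s z - b s z))%C).
        * rewrite A0. ring.
        * intros s. eapply is_cderive_eq. apply is_cderive_minus; [apply is_cderive_plus; [apply is_cderive_const|apply Ad]|apply Oa]. ring.
        * intros s Hs. destruct (Herr s z ltac:(lra) Hz) as (R1 & R2 & R3). destruct (Hvs s Hs) as (V1 & V2).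
          apply Tri. rewrite !Cmod_opp.
          pose proof (Two _ _ _ _ (conj (Cmod_ge_0 (v s)) V1) (conj (Cmod_ge_0 _) R3)).
          pose proof (Two _ _ _ _ (conj (Cmod_ge_0 (Cconj (v s))) V2) (conj (Cmod_ge_0 _) R2)).
          assert (0 <= eps * exp (k * Rabs s)) by (apply Rmult_le_pos; [auto|left; apply exp_pos]).
          unfold L. nra.
      + apply (Fin (fun x => b 0 z + B' x z - b x z)%C
          (fun s => (- (2 * Ci) * z) * (B s z - b s z) + (2 * v s) * (A s z - a s z))%C).
        * rewrite B0. ring.
        * intros s. eapply is_cderive_eq. apply is_cderive_minus; [apply is_cderive_plus; [apply is_cderive_const|apply Bd]|apply Ob]. ring.
        * intros s Hs. destruct (Herr s z ltac:(lra) Hz) as (R1 & R2 & R3). destruct (Hvs s Hs) as (V1 & V2).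
          apply Tri. rewrite (Cmod_mult (- (2 * Ci))), Cmod_opp, Hn2, (Cmod_mult 2), Hn3.
          pose proof (Two _ _ _ _ (conj (Cmod_ge_0 (v s)) V1) (conj (Cmod_ge_0 _) R1)).
          pose proof (Two _ _ _ _ (conj (Cmod_ge_0 z) Hz) (conj (Cmod_ge_0 _) R2)).
          unfold L. nra.
      + apply (Fin (fun x => c 0 z + E' x z - c x z)%C
          (fun s => ((2 * Ci) * z) * (E s z - c s z) + (2 * Cconj (v s)) * (A s z - a s z))%C).
        * rewrite E0. ring.
        * intros s. eapply is_cderive_eq. apply is_cderive_minus; [apply is_cderive_plus; [apply is_cderive_const|apply Ed]|apply Oc]. ring.
        * intros s Hs. destruct (Herr s z ltac:(lra) Hz) as (R1 & R2 & R3). destruct (Hvs s Hs) as (V1 & V2).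
          apply Tri. rewrite (Cmod_mult (2 * Ci)), Hn2, (Cmod_mult 2), Hn3.
          pose proof (Two _ _ _ _ (conj (Cmod_ge_0 (Cconj (v s))) V2) (conj (Cmod_ge_0 _) R1)).
          pose proof (Two _ _ _ _ (conj (Cmod_ge_0 z) Hz) (conj (Cmod_ge_0 _) R3)).
          unfold L. nra. }
  split; [|split]; apply pfun_locpoly_slice with X; intros r eps Hr Heps;
    destruct (Main r Hr) as (M & k & Hk & HM & HH);
    destruct (half_pow_small (M * exp (k * Rabs X)) eps Heps) as [n Hn];
    destruct (HH n) as (A & B & E & HA & HB & HE & Herr).
  - exists A; split; auto. intros z Hz. destruct (Herr X z (Rle_refl _) Hz) as (R1 & R2 & R3).
    rewrite <- Cmod_opp. replace (- (a X z - A X z))%C with (A X z - a X z)%C by ring. lra.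
  - exists B; split; auto. intros z Hz. destruct (Herr X z (Rle_refl _) Hz) as (R1 & R2 & R3).
    rewrite <- Cmod_opp. replace (- (b X z - B X z))%C with (B X z - b X z)%C by ring. lra.
  - exists E; split; auto. intros z Hz. destruct (Herr X z (Rle_refl _) Hz) as (R1 & R2 & R3).
    rewrite <- Cmod_opp. replace (- (c X z - E X z))%C with (E X z - c X z)%C by ring. lra.
Qed.

(** * The matrix polynomial conjugated by the fundamental matrix *)

Ltac cder :=
  lazymatch goal with
  | |- is_derive (fun _ => ?c) _ _ => apply (is_cderive_const c)
  | |- is_derive (fun t => Cplus (@?f t) (@?g t)) _ _ => apply (is_cderive_plus f g); cder
  | |- is_derive (fun t => Cminus (@?f t) (@?g t)) _ _ => apply (is_cderive_minus f g); cder
  | |- is_derive (fun t => Cmult (@?f t) (@?g t)) _ _ => apply (is_cderive_mult f g); cder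
  | |- is_derive (fun t => Copp (@?f t)) _ _ => apply (is_cderive_opp f); cder
  | |- is_derive (fun t => Cconj (@?f t)) _ _ => apply (is_cderive_conj f); cder
  | |- _ => eassumption
  end.

Lemma Cconj_Ci : Cconj Ci = (- Ci)%C.
Proof. apply injective_projections; simpl; ring. Qed.

Lemma mon_imag_bound m e : mon m e ->
  exists K, 0 < K /\ forall t, 1 <= t -> Cmod (e (RtoC t * Ci)%C) <= K * t ^ m.
Proof.
  intros He. destruct (mon_upper_bound m e He) as (K & HK & H).
  exists ((K + 1) * 2 ^ m). assert (H2 : 0 < 2 ^ m) by (apply pow_lt; lra). split; [nra|].
  intros t Ht. eapply Rle_trans; [apply H|]. rewrite Cmod_imag by lra.
  rewrite Rmult_assoc, <- Rpow_mult_distr.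
  assert (P : (1 + t) ^ m <= (2 * t) ^ m) by (apply pow_incr; lra).
  assert (Q : 0 <= (2 * t) ^ m) by (apply pow_le; lra).
  apply Rle_trans with (K * (2 * t) ^ m); [apply Rmult_le_compat_l; lra|lra].
Qed.

Section ConjugatedPolynomial.
Variables (l : R) (u : R -> C) (P11 P12 P21 P22 : R -> C -> C).
Variables (m : nat) (e b H : C -> C).
Hypothesis Hl : 0 < l.
Hypothesis Hper : periodic l u.
Hypothesis Hu : forall x, continuous u x.
Hypothesis HP : fundamental_matrix u P11 P12 P21 P22.
Hypothesis He : mon m e.
Hypothesis Hb : cpoly b.
Hypothesis Hreal : forall z, Cconj (e (Cconj z)) = e z.
(** Taken together, the last three hypotheses say that Phi(l) is a scalar matrix plus [H] times
    [[i e, b], [- b^*, - i e]]. *)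
Hypothesis Hf : forall z, (P11 l z - P22 l z = 2 * Ci * (e z * H z))%C.
Hypothesis Hpsi : forall z, P12 l z = (b z * H z)%C.
Hypothesis Hphi : forall z, P21 l z = (- Cconj (b (Cconj z)) * H z)%C.

Let c (z : C) : C := (- Cconj (b (Cconj z)))%C.

(* The entries of [Phi * [[i e, b], [c, - i e]] * Phi^-1]; [det Phi = 1]. *)
Definition Na (x : R) (z : C) : C :=
  ((P11 x z * (Ci * e z) + P12 x z * - Cconj (b (Cconj z))) * P22 x z - (P11 x z * b z - P12 x z * (Ci * e z)) * P21 x z)%C.
Definition Nb (x : R) (z : C) : C :=
  ((P11 x z * b z - P12 x z * (Ci * e z)) * P11 x z - (P11 x z * (Ci * e z) + P12 x z * - Cconj (b (Cconj z))) * P12 x z)%C.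
Definition Nc (x : R) (z : C) : C :=
  ((P21 x z * (Ci * e z) + P22 x z * - Cconj (b (Cconj z))) * P22 x z - (P21 x z * b z - P22 x z * (Ci * e z)) * P21 x z)%C.

Lemma column1 z : dirac_ode u z (fun x => P11 x z) (fun x => P21 x z).
Proof. destruct (HP z) as (D & _). now apply dirac_solution_ode in D. Qed.
Lemma column2 z : dirac_ode u z (fun x => P12 x z) (fun x => P22 x z).
Proof. destruct (HP z) as (_ & D & _). now apply dirac_solution_ode in D. Qed.
Lemma init11 z : P11 0 z = 1%C.
Proof. now destruct (HP z) as (_ & _ & E & _). Qed.
Lemma init12 z : P12 0 z = 0%C.
Proof. now destruct (HP z) as (_ & _ & _ & E & _). Qed.
Lemma init21 z : P21 0 z = 0%C.
Proof. now destruct (HP z) as (_ & _ & _ & _ & E & _). Qed.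
Lemma init22 z : P22 0 z = 1%C.
Proof. now destruct (HP z) as (_ & _ & _ & _ & _ & E). Qed.

Lemma fundamental_det x z : (P11 x z * P22 x z - P12 x z * P21 x z)%C = 1%C.
Proof.
  destruct (column1 z) as [D1 D2], (column2 z) as [D3 D4].
  rewrite (zero_derive_const (fun x => P11 x z * P22 x z - P12 x z * P21 x z)%C).
  - rewrite init11, init12, init21, init22. ring.
  - intros r. eapply is_cderive_eq.
    + apply is_cderive_minus; apply is_cderive_mult; [apply D1|apply D4|apply D3|apply D2].
    + cbv beta; ring.
Qed.

(** From [dirac_ode_conj] and uniqueness. In matrix form, the adjoint of Phi(conj z) is the inverse
    of Phi(z). *)
Lemma fundamental_conj x z :
  P12 x z = (- Cconj (P21 x (Cconj z)))%C /\ P22 x z = Cconj (P11 x (Cconj z)).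
Proof.
  apply (dirac_unique u z (fun x => P12 x z) (fun x => P22 x z)
    (fun x => - Cconj (P21 x (Cconj z)))%C (fun x => Cconj (P11 x (Cconj z)))).
  - apply column2.
  - apply (dirac_ode_conj u z (fun x => P11 x (Cconj z)) (fun x => P21 x (Cconj z))). apply column1.
  - rewrite init12, init21. apply injective_projections; simpl; ring.
  - rewrite init22, init11. apply injective_projections; simpl; ring.
Qed.

(** Both sides of Phi(x + l) = Phi(x) Phi(l) solve the system, as [u] is periodic, and agree at x =
    0. *)
Lemma fundamental_shift x z :
  P11 (x + l) z = (P11 l z * P11 x z + P21 l z * P12 x z)%C /\
  P21 (x + l) z = (P11 l z * P21 x z + P21 l z * P22 x z)%C /\
  P12 (x + l) z = (P12 l z * P11 x z + P22 l z * P12 x z)%C /\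
  P22 (x + l) z = (P12 l z * P21 x z + P22 l z * P22 x z)%C.
Proof.
  assert (S : forall y1 y2, dirac_ode u z y1 y2 -> dirac_ode u z (fun x => y1 (x + l)) (fun x => y2 (x + l))).
  { intros y1 y2 D. apply (dirac_ode_potential_ext (fun x => u (x + l))); auto. now apply dirac_ode_shift. }
  destruct (dirac_unique u z (fun x => P11 (x + l) z) (fun x => P21 (x + l) z)
    (fun x => P11 l z * P11 x z + P21 l z * P12 x z)%C (fun x => P11 l z * P21 x z + P21 l z * P22 x z)%C) with (x := x) as [E1 E2].
  - apply (S (fun x => P11 x z) (fun x => P21 x z)), column1.
  - apply dirac_ode_lin; [apply column1|apply column2].
  - rewrite Rplus_0_l, init11, init12. ring.
  - rewrite Rplus_0_l, init21, init22. ring.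
  - destruct (dirac_unique u z (fun x => P12 (x + l) z) (fun x => P22 (x + l) z)
      (fun x => P12 l z * P11 x z + P22 l z * P12 x z)%C (fun x => P12 l z * P21 x z + P22 l z * P22 x z)%C) with (x := x) as [E3 E4].
    + apply (S (fun x => P12 x z) (fun x => P22 x z)), column2.
    + apply dirac_ode_lin; [apply column1|apply column2].
    + rewrite Rplus_0_l, init11, init12. ring.
    + rewrite Rplus_0_l, init21, init22. ring.
    + auto.
Qed.

Lemma N_lax z : lax_ode u z (fun x => Na x z) (fun x => Nb x z) (fun x => Nc x z).
Proof.
  destruct (column1 z) as [D1 D2], (column2 z) as [D3 D4].
  split; [|split]; intros x; specialize (D1 x); specialize (D2 x); specialize (D3 x); specialize (D4 x);
    unfold Na, Nb, Nc; (eapply is_cderive_eq; [cder|cbv beta; ring]).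
Qed.

Lemma N_init z : Na 0 z = (Ci * e z)%C /\ Nb 0 z = b z /\ Nc 0 z = (- Cconj (b (Cconj z)))%C.
Proof. unfold Na, Nb, Nc. rewrite init11, init12, init21, init22. repeat split; ring. Qed.

Lemma N_real x z :
  Cconj (Na x (Cconj z)) = (- Na x z)%C /\ Nc x z = (- Cconj (Nb x (Cconj z)))%C.
Proof.
  destruct (fundamental_conj x z) as [E1 E2]. destruct (fundamental_conj x (Cconj z)) as [E3 E4].
  rewrite Cconj_conj in E3, E4.
  assert (E5 : Cconj (P12 x (Cconj z)) = (- P21 x z)%C) by (rewrite E3, Copp_conj, Cconj_conj; reflexivity).
  assert (E6 : Cconj (P22 x (Cconj z)) = P11 x z) by (rewrite E4, Cconj_conj; reflexivity).
  assert (E7 : Cconj (P21 x (Cconj z)) = (- P12 x z)%C) by (rewrite E1; ring).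
  assert (E8 : Cconj (P11 x (Cconj z)) = P22 x z) by (rewrite E2; ring).
  unfold Na, Nb, Nc.
  split; repeat rewrite ?Cminus_conj, ?Cplus_conj, ?Copp_conj, ?Cmult_conj, ?Cconj_conj;
    rewrite ?Cconj_Ci, ?E5, ?E6, ?E7, ?E8, ?Hreal; ring.
Qed.

(** Phi(l), a combination of the identity and the matrix at x = 0, commutes with that matrix. *)
Lemma N_periodic x z : Na (x + l) z = Na x z /\ Nb (x + l) z = Nb x z.
Proof.
  destruct (fundamental_shift x z) as (E1 & E2 & E3 & E4).
  assert (E0 : P11 l z = (P22 l z + 2 * Ci * (e z * H z))%C) by (rewrite <- Hf; ring).
  pose proof (fundamental_det l z) as Dl.
  unfold Na, Nb. rewrite E1, E2, E3, E4. rewrite Hpsi, Hphi, E0 in *.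
  set (c' := Cconj (b (Cconj z))) in *. set (t := P22 l z) in *.
  (* The identity becomes a ring identity only after the right side is multiplied by det Phi(l) =
     1. *)
  split; (etransitivity; [|etransitivity; [apply Cmult_1_l|reflexivity]]); rewrite <- Dl; ring.
Qed.

(** The left sides come from Phi(x + l) Phi(x)^-1, the monodromy at base point [x]. It equals Phi(x)
    Phi(l) Phi(x)^-1, so its traceless part has the same factor [H] for every x. *)
Lemma N_monodromy x z :
  (P22 x z * P11 (l + x) z + - P21 x z * P12 (l + x) z - (- P12 x z * P21 (l + x) z + P11 x z * P22 (l + x) z)
    = 2 * (Na x z * H z))%C /\
  (- P12 x z * P11 (l + x) z + P11 x z * P12 (l + x) z = Nb x z * H z)%C /\
  (P22 x z * P21 (l + x) z + - P21 x z * P22 (l + x) z = Nc x z * H z)%C.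
Proof.
  rewrite (Rplus_comm l x).
  destruct (fundamental_shift x z) as (E1 & E2 & E3 & E4).
  assert (E0 : P11 l z = (P22 l z + 2 * Ci * (e z * H z))%C) by (rewrite <- Hf; ring).
  unfold Na, Nb, Nc. rewrite E1, E2, E3, E4. rewrite Hpsi, Hphi, E0.
  repeat split; ring.
Qed.

(** The columns of Phi(x + s) Phi(x)^-1 solve the system with shifted potential and unit initial
    data, so [dirac_half_plane] applies at every base point. *)
Lemma N_half_plane_H x eta : 0 < eta ->
  exists C0, 0 < C0 /\ forall z, C0 <= Im z ->
    Cmod (cexp z l * (2 * (Na x z * H z)) - 1)%C <= 2 * eta /\
    Cmod (cexp z l * (Nb x z * H z))%C <= eta /\
    Cmod (cexp z l * (Nc x z * H z))%C <= eta.
Proof.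
  intros Heta.
  destruct (continuous_bounded u (Rabs x + l) Hu) as (V & HV & Hvb).
  destruct (dirac_half_plane l V eta Hl HV Heta) as (C0 & HC0 & HH).
  exists C0; split; auto. intros z Hz.
  destruct (N_monodromy x z) as (M1 & M2 & M3). rewrite <- M1, <- M2, <- M3.
  assert (Hw : forall s, 0 <= s <= l -> Cmod (u (s + x)) <= V).
  { intros s Hs. apply Hvb. eapply Rle_trans; [apply Rabs_triang|]. rewrite (Rabs_right s); lra. }
  pose proof (fundamental_det x z) as Dx.
  destruct (HH z (fun s => u (s + x))
    (fun s => P22 x z * P11 (s + x)%R z + - P21 x z * P12 (s + x)%R z)%C
    (fun s => P22 x z * P21 (s + x)%R z + - P21 x z * P22 (s + x)%R z)%C) as [A1 A2]; auto.
  { apply (dirac_ode_shift u z (fun s => P22 x z * P11 s z + - P21 x z * P12 s z)%C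
      (fun s => P22 x z * P21 s z + - P21 x z * P22 s z)%C).
    apply dirac_ode_lin; [apply column1|apply column2]. }
  { rewrite Rplus_0_l.
    replace (P22 x z * P11 x z + - P21 x z * P12 x z)%C with (RtoC 1) by (rewrite <- Dx; ring).
    replace (P22 x z * P21 x z + - P21 x z * P22 x z)%C with (RtoC 0) by ring.
    rewrite Cmod_0, Cmod_1. lra. }
  destruct (HH z (fun s => u (s + x))
    (fun s => - P12 x z * P11 (s + x)%R z + P11 x z * P12 (s + x)%R z)%C
    (fun s => - P12 x z * P21 (s + x)%R z + P11 x z * P22 (s + x)%R z)%C) as [A3 A4]; auto.
  { apply (dirac_ode_shift u z (fun s => - P12 x z * P11 s z + P11 x z * P12 s z)%C
      (fun s => - P12 x z * P21 s z + P11 x z * P22 s z)%C).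
    apply dirac_ode_lin; [apply column1|apply column2]. }
  { rewrite Rplus_0_l.
    replace (- P12 x z * P21 x z + P11 x z * P22 x z)%C with (RtoC 1) by (rewrite <- Dx; ring).
    replace (- P12 x z * P11 x z + P11 x z * P12 x z)%C with (RtoC 0) by ring.
    rewrite Cmod_0, Cmod_1. lra. }
  rewrite Rplus_0_l in A1, A3.
  replace (P22 x z * P11 x z + - P21 x z * P12 x z)%C with (RtoC 1) in A1 by (rewrite <- Dx; ring).
  replace (cexp z l * (- P12 x z * P11 (l + x)%R z + P11 x z * P12 (l + x)%R z) - (- P12 x z * P11 x z + P11 x z * P12 x z))%C
    with (cexp z l * (- P12 x z * P11 (l + x)%R z + P11 x z * P12 (l + x)%R z))%C in A3 by ring.
  split; [|split]; auto.
  set (p := (P22 x z * P11 (l + x)%R z + - P21 x z * P12 (l + x)%R z)%C) in *.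
  set (q := (- P12 x z * P21 (l + x)%R z + P11 x z * P22 (l + x)%R z)%C) in *.
  replace (cexp z l * (p - q) - 1)%C with ((cexp z l * p - 1) + - (cexp z l * q))%C by ring.
  eapply Rle_trans; [apply Cmod_triangle|]. rewrite Cmod_opp. lra.
Qed.

(** At x = 0 the quantity 2 i e H exp (i z l) is near 1, which bounds |e H exp (i z l)| below by 3 /
    8. Dividing by it turns the estimate at [x] into one relative to [e], free of [H]. *)
Lemma N_half_plane x eta : 0 < eta ->
  exists C0, 0 < C0 /\ forall z, C0 <= Im z ->
    Cmod (Na x z - Ci * e z)%C <= eta * Cmod (e z) /\
    Cmod (Nb x z) <= eta * Cmod (e z) /\ Cmod (Nc x z) <= eta * Cmod (e z).
Proof.
  intros Heta.
  (* At most 1 / 8, so that 1 - 2 d >= 3 / 4; at most eta / 8, because the final bounds are 8 d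
     |e|. *)
  set (d := Rmin (1 / 8) (eta / 8)).
  assert (Hd : 0 < d) by (unfold d; apply Rmin_pos; lra).
  assert (Hd1 : d <= 1 / 8) by apply Rmin_l.
  assert (Hd2 : d <= eta / 8) by apply Rmin_r.
  destruct (N_half_plane_H x d Hd) as (C1 & HC1 & H1).
  destruct (N_half_plane_H 0 d Hd) as (C2 & HC2 & H2).
  exists (Rmax C1 C2). split; [eapply Rlt_le_trans; [exact HC1|apply Rmax_l]|].
  intros z Hz.
  destruct (H1 z) as (A1 & A2 & A3); [eapply Rle_trans; [apply Rmax_l|exact Hz]|].
  destruct (H2 z) as (B1 & _ & _); [eapply Rle_trans; [apply Rmax_r|exact Hz]|].
  destruct (N_init z) as (I1 & _ & _). rewrite I1 in B1. clear I1.
  set (G := (cexp z l * H z)%C).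
  assert (G1 : 3 / 4 <= 2 * (Cmod (e z) * Cmod G)).
  { assert (T : Cmod 1 <= Cmod (cexp z l * (2 * (Ci * e z * H z))) + Cmod (cexp z l * (2 * (Ci * e z * H z)) - 1)).
    { rewrite <- (Cmod_opp (_ - 1)). eapply Rle_trans; [|apply Cmod_triangle]. right; f_equal. ring. }
    rewrite Cmod_1 in T.
    replace (cexp z l * (2 * (Ci * e z * H z)))%C with (2 * Ci * (e z * G))%C in T by (unfold G; ring).
    rewrite Cmod_mult, (Cmod_mult 2), Cmod_Ci, Cmod_R, (Cmod_mult (e z)), Rabs_right in T by lra.
    replace (2 * Ci * (e z * G) - 1)%C with (cexp z l * (2 * (Ci * e z * H z)) - 1)%C in T by (unfold G; ring). lra. }
  assert (HG : 0 < Cmod G).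
  { pose proof (Cmod_ge_0 G). pose proof (Cmod_ge_0 (e z)).
    destruct (Req_dec (Cmod G) 0) as [E0|]; [rewrite E0 in G1; lra|lra]. }
  assert (Fin : forall w k, 0 <= k -> Cmod (w * G)%C <= k * (3 / 4) -> Cmod w <= 2 * k * Cmod (e z)).
  { intros w k Hk Hw. rewrite Cmod_mult in Hw.
    apply Rmult_le_reg_r with (Cmod G); auto. nra. }
  split; [|split].
  - assert (K : Cmod (Na x z - Ci * e z)%C <= 2 * (4 * d) * Cmod (e z)).
    { apply Fin; [lra|].
      assert (T : Cmod (2 * ((Na x z - Ci * e z) * G))%C <= 4 * d).
      { replace (2 * ((Na x z - Ci * e z) * G))%C with
          ((cexp z l * (2 * (Na x z * H z)) - 1) + - (cexp z l * (2 * (Ci * e z * H z)) - 1))%C by (unfold G; ring).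
        eapply Rle_trans; [apply Cmod_triangle|]. rewrite Cmod_opp. lra. }
      rewrite Cmod_mult, Cmod_R, Rabs_right in T by lra. lra. }
    pose proof (Cmod_ge_0 (e z)). nra.
  - assert (K : Cmod (Nb x z) <= 2 * (4 * d) * Cmod (e z)).
    { apply Fin; [lra|]. replace (Nb x z * G)%C with (cexp z l * (Nb x z * H z))%C by (unfold G; ring). lra. }
    pose proof (Cmod_ge_0 (e z)). nra.
  - assert (K : Cmod (Nc x z) <= 2 * (4 * d) * Cmod (e z)).
    { apply Fin; [lra|]. replace (Nc x z * G)%C with (cexp z l * (Nc x z * H z))%C by (unfold G; ring). lra. }
    pose proof (Cmod_ge_0 (e z)). nra.
Qed.

Lemma N_growth x : exists d K, 0 <= K /\ forall z,
  Cmod (Na x z) <= K * (1 + Cmod z) ^ d /\ Cmod (Nb x z) <= K * (1 + Cmod z) ^ d /\ Cmod (Nc x z) <= K * (1 + Cmod z) ^ d.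
Proof.
  destruct (N_half_plane x 1 Rlt_0_1) as (C0 & HC0 & HH).
  destruct Hb as [db Hdb].
  set (d := max (S m) db).
  destruct (ple_bound d e) as (Ke & HKe & Be). { apply (ple_le (S m)); [unfold d; lia|now apply mon_ple]. }
  destruct (ple_bound d b) as (Kb & HKb & Bb). { apply (ple_le db); [unfold d; lia|auto]. }
  set (X := exp (4 * C0 * Rabs x)).
  assert (HX : 1 <= X).
  { unfold X. pose proof (exp_ineq1_le (4 * C0 * Rabs x)). pose proof (Rabs_pos x).
    assert (0 <= C0 * Rabs x) by (apply Rmult_le_pos; lra). lra. }
  set (S0 := 2 * Ke ^ 2 + 2 * Kb ^ 2).
  assert (HS0 : 0 <= S0). { unfold S0. pose proof (pow2_ge_0 Ke). pose proof (pow2_ge_0 Kb). lra. }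
  exists d, (2 * Ke + (S0 * X + 1)). split; [nra|].
  assert (Up : forall z, C0 <= Im z ->
    Cmod (Na x z) <= 2 * Ke * (1 + Cmod z) ^ d /\ Cmod (Nb x z) <= 2 * Ke * (1 + Cmod z) ^ d /\ Cmod (Nc x z) <= 2 * Ke * (1 + Cmod z) ^ d).
  { intros z Hz. destruct (HH z Hz) as (A1 & A2 & A3). specialize (Be z).
    assert (Cmod (Na x z) <= Cmod (Na x z - Ci * e z) + Cmod (e z)).
    { replace (Na x z) with (Na x z - Ci * e z + Ci * e z)%C at 1 by ring.
      eapply Rle_trans; [apply Cmod_triangle|]. rewrite (Cmod_mult Ci), Cmod_Ci. lra. }
    pose proof (Cmod_ge_0 (e z)). repeat split; nra. }
  assert (Mid : forall z, Rabs (Im z) <= C0 ->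
    Cmod (Na x z) <= (S0 * X + 1) * (1 + Cmod z) ^ d /\ Cmod (Nb x z) <= (S0 * X + 1) * (1 + Cmod z) ^ d /\ Cmod (Nc x z) <= (S0 * X + 1) * (1 + Cmod z) ^ d).
  { intros z Hz.
    pose proof (lax_energy u z _ _ _ x (N_lax z)) as En. cbv beta in En.
    destruct (N_init z) as (I1 & I2 & I3). rewrite I1, I2, I3 in En.
    rewrite (Cmod_mult Ci), Cmod_Ci, Rmult_1_l, Cmod_opp, Cmod_conj in En.
    set (Y := (1 + Cmod z) ^ d) in *.
    assert (HY : 1 <= Y). { unfold Y. apply pow_R1_Rle. pose proof (Cmod_ge_0 z). lra. }
    pose proof (Be z) as B1. pose proof (Bb z) as B2. pose proof (Bb (Cconj z)) as B3. rewrite Cmod_conj in B3.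
    fold Y in B1, B2, B3.
    assert (E1 : 2 * Cmod (e z) ^ 2 + Cmod (b z) ^ 2 + Cmod (b (Cconj z)) ^ 2 <= S0 * Y ^ 2).
    { assert (Cmod (e z) ^ 2 <= (Ke * Y) ^ 2) by (apply pow_incr; split; [apply Cmod_ge_0|auto]).
      assert (Cmod (b z) ^ 2 <= (Kb * Y) ^ 2) by (apply pow_incr; split; [apply Cmod_ge_0|auto]).
      assert (Cmod (b (Cconj z)) ^ 2 <= (Kb * Y) ^ 2) by (apply pow_incr; split; [apply Cmod_ge_0|auto]).
      unfold S0. rewrite Rpow_mult_distr in *. lra. }
    assert (E2 : exp (4 * Rabs (Im z) * Rabs x) <= X).
    { apply exp_le_compat, Rmult_le_compat_r; [apply Rabs_pos|lra]. }
    assert (E3 : 2 * Cmod (Na x z) ^ 2 + Cmod (Nb x z) ^ 2 + Cmod (Nc x z) ^ 2 <= S0 * X * Y ^ 2).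
    { eapply Rle_trans; [exact En|]. replace (S0 * X * Y ^ 2) with (S0 * Y ^ 2 * X) by ring.
      apply Rmult_le_compat; auto.
      - pose proof (pow2_ge_0 (Cmod (e z))). pose proof (pow2_ge_0 (Cmod (b z))). pose proof (pow2_ge_0 (Cmod (b (Cconj z)))). lra.
      - left; apply exp_pos. }
    assert (Fin : forall w, 0 <= w -> w ^ 2 <= S0 * X * Y ^ 2 -> w <= (S0 * X + 1) * Y).
    { intros w Hw Hw2. apply Rsqr_incr_0_var; [|nra]. unfold Rsqr.
      assert (HSX : 0 <= S0 * X) by nra. assert (0 <= S0 * X * Y ^ 2) by nra.
      assert (0 <= (S0 * X) * (S0 * X) * Y ^ 2) by (apply Rmult_le_pos; [nra|apply pow2_ge_0]). nra. }
    pose proof (pow2_ge_0 (Cmod (Na x z))). pose proof (pow2_ge_0 (Cmod (Nb x z))). pose proof (pow2_ge_0 (Cmod (Nc x z))).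
    split; [|split]; apply Fin; try apply Cmod_ge_0; lra. }
  assert (Comb : forall w k z, (0 <= k <= 2 * Ke + (S0 * X + 1)) -> w <= k * (1 + Cmod z) ^ d ->
    w <= (2 * Ke + (S0 * X + 1)) * (1 + Cmod z) ^ d).
  { intros w k z Hk Hw. eapply Rle_trans; [exact Hw|]. apply Rmult_le_compat_r; [|lra].
    apply pow_le. pose proof (Cmod_ge_0 z). lra. }
  assert (HSX : 0 <= S0 * X) by nra.
  intros z.
  destruct (Rle_lt_dec C0 (Im z)) as [H1|H1].
  { destruct (Up z H1) as (A1 & A2 & A3). repeat split; eapply Comb; try eassumption; lra. }
  destruct (Rle_lt_dec (Im z) (- C0)) as [H2|H2].
  (* The symmetry [N_real] carries the lower half plane to the upper one. *)
  { destruct (Up (Cconj z)) as (A1 & A2 & A3). { unfold Im, Cconj in *; simpl in *. lra. }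
    rewrite Cmod_conj in A1, A2, A3.
    destruct (N_real x z) as [R1 R2]. destruct (N_real x (Cconj z)) as [_ R3]. rewrite Cconj_conj in R3.
    apply (f_equal Cmod) in R1, R2, R3. rewrite ?Cmod_opp, ?Cmod_conj in R1, R2, R3.
    rewrite <- R1, R2, <- R3. repeat split; eapply Comb; try eassumption; lra. }
  destruct (Mid z) as (A1 & A2 & A3). { apply Rabs_le; lra. }
  repeat split; eapply Comb; try eassumption; lra.
Qed.

(** Liouville's theorem gives only some degree. The exact one comes from the imaginary axis, where
    N_a - i e and N_b are o(|z|^m). *)
Theorem N_polynomial x :
  mon m (fun z => - Ci * Na x z)%C /\ ple m (Nb x).
Proof.
  assert (I0 : forall z, Na 0 z = (Ci * e z)%C /\ Nb 0 z = b z /\ Nc 0 z = (- Cconj (b (Cconj z)))%C) by apply N_init.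
  destruct (lax_locpoly u Na Nb Nc Hu N_lax) with (x := x) as (L1 & L2 & _).
  - destruct (mon_cpoly m e He) as [d Hd]. exists d.
    apply (ple_ext _ (fun z => Ci * e z)%C); [intros; symmetry; apply I0|now apply ple_scal].
  - destruct Hb as [d Hd]. exists d. apply (ple_ext _ b); [intros; symmetry; apply I0|auto].
  - destruct Hb as [d Hd]. exists d. apply (ple_ext _ (fun z => - (1) * Cconj (b (Cconj z)))%C).
    + intros z. rewrite (proj2 (proj2 (I0 z))). ring.
    + apply ple_scal. now apply ple_star.
  - destruct (N_growth x) as (d & K & HK & HG).
    assert (PA : ple (S d) (Na x)) by (apply (liouville _ d K); auto; intros; apply HG).
    assert (PB : ple (S d) (Nb x)) by (apply (liouville _ d K); auto; intros; apply HG).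
    destruct (mon_imag_bound m e He) as (Ke & HKe & Be).
    assert (Asym : forall g : C -> C, (forall eta, 0 < eta -> exists C0, 0 < C0 /\ forall z, C0 <= Im z -> Cmod (g z) <= eta * Cmod (e z)) ->
      forall eta, 0 < eta -> exists T, forall t, T <= t -> Cmod (g (RtoC t * Ci)%C) <= eta * t ^ m).
    { intros g Hg eta Heta. destruct (Hg (eta / Ke)) as (C0 & HC0 & HH); [apply Rdiv_lt_0_compat; auto|].
      exists (Rmax 1 C0). intros t Ht.
      assert (1 <= t) by (eapply Rle_trans; [apply Rmax_l|exact Ht]).
      assert (C0 <= t) by (eapply Rle_trans; [apply Rmax_r|exact Ht]).
      eapply Rle_trans; [apply HH|].
      - unfold Im; simpl. lra.
      - replace (eta * t ^ m) with (eta / Ke * (Ke * t ^ m)) by (field; lra).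
        apply Rmult_le_compat_l; [left; apply Rdiv_lt_0_compat; auto|auto]. }
    split.
    + assert (PD : ple m (fun z => - Ci * (Na x z - Ci * e z))%C).
      { apply ple_scal. apply (ple_drop m (max (S d) (S m))); [|lia|].
        - apply ple_minus; [apply (ple_le (S d)); [lia|auto]|].
          apply ple_scal. apply (ple_le (S m)); [lia|now apply mon_ple].
        - apply (Asym (fun z => Na x z - Ci * e z)%C). intros eta Heta. destruct (N_half_plane x eta Heta) as (C0 & HC0 & HH).
          exists C0; split; auto. intros z Hz. apply HH; auto. }
      destruct He as (h & Hh & Eh).
      exists (fun z => - Ci * (Na x z - Ci * e z) + h z)%C. split; [now apply ple_plus|].
      intros z. transitivity (- Ci * (Na x z - Ci * e z) - (Ci * Ci) * e z)%C; [ring|].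
      rewrite Ci_sq, Eh. ring.
    + apply (ple_drop m (max (S d) (S m))); [apply (ple_le (S d)); [lia|auto]|lia|].
      apply (Asym (Nb x)). intros eta Heta. destruct (N_half_plane x eta Heta) as (C0 & HC0 & HH).
      exists C0; split; auto. intros z Hz. apply HH; auto.
Qed.
End ConjugatedPolynomial.

(** * The Lax equation on coefficients *)

(** Zero coefficients past the end spare a boundary case when multiplication by z becomes the shift
    k -> k + 1. *)
Lemma ple_coef_cut m g : ple m g ->
  exists c, (forall z, g z = hpoly m c z) /\ forall k, (m <= k)%nat -> c k = 0%C.
Proof.
  intros [c Hc]. exists (fun k => if lt_dec k m then c k else RtoC 0). split.
  - intros z. rewrite Hc. apply hpoly_ext. intros k Hk. destruct (lt_dec k m); [auto|lia].
  - intros k Hk. destruct (lt_dec k m); [lia|auto].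
Qed.

(* [d/dx] acts on coefficients because finitely many values determine them. *)
Lemma hpoly_derive_coef m (c : R -> nat -> C) (dg : C -> C) x :
  (forall t k, (m <= k)%nat -> c t k = 0%C) ->
  (forall z, is_cderive (fun t => hpoly m (c t) z) x (dg z)) ->
  exists dc : nat -> C, (forall k, is_cderive (fun t => c t k) x (dc k)) /\
    (forall k, (m <= k)%nat -> dc k = 0%C) /\ forall z, hpoly m dc z = dg z.
Proof.
  intros Hcut Hd.
  assert (Hex : forall k, exists l : C, is_cderive (fun t => c t k) x l /\ ((m <= k)%nat -> l = 0%C)).
  { intros k. destruct (Nat.lt_ge_cases k m) as [Hk|Hk].
    - destruct (sampled_derive 1 m (fun c => c k) c x) as [l Hl].
      + intros z; eexists; apply Hd.
      + apply sampled_coef; auto. exact C1_nz.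
      + exists l; split; auto. lia.
    - exists 0%C. split; auto. apply is_cderive_ext with (fun _ => 0%C).
      + intros t. symmetry. now apply Hcut.
      + apply is_cderive_const. }
  exists (fun k => proj1_sig (constructive_indefinite_description _ (Hex k))).
  split; [|split].
  - intros k. destruct (constructive_indefinite_description _ (Hex k)) as [l [H1 H2]]; auto.
  - intros k. destruct (constructive_indefinite_description _ (Hex k)) as [l [H1 H2]]; auto.
  - intros z. refine (is_cderive_unique (fun t => hpoly m (c t) z) x _ _ _ (Hd z)).
    apply is_cderive_hpoly. intros k _.
    destruct (constructive_indefinite_description _ (Hex k)) as [l [H1 H2]]; auto.
Qed.

(** In b_x = - 2 i z b + 2 v a the coefficient of z^m has no counterpart on the left, which forces
    beta 0 = v. The other coefficients then give a closed system, as v is one of the unknowns. *)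
Lemma lax_coefficients v m (a b c : R -> C -> C) :
  (forall z, lax_ode v z (fun x => a x z) (fun x => b x z) (fun x => c x z)) ->
  (forall x, mon m (fun z => - Ci * a x z)%C) -> (forall x, ple m (b x)) ->
  (forall x z, Cconj (a x (Cconj z)) = (- a x z)%C) ->
  (forall x z, c x z = (- Cconj (b x (Cconj z)))%C) ->
  exists beta gamma : R -> nat -> C,
    (forall x z, a x z = (Ci * (z ^ m + hpoly m (gamma x) z))%C) /\
    (forall x z, b x z = hpoly m (beta x) z) /\
    (forall x k, (m <= k)%nat -> beta x k = 0%C) /\
    (forall x k, (m <= k)%nat -> gamma x k = 0%C) /\
    (forall x k, Cconj (gamma x k) = gamma x k) /\
    (forall x, beta x O = v x) /\
    (forall x k, is_cderive (fun t => beta t k) x (- (2 * Ci) * beta x (S k) + 2 * Ci * (beta x O * gamma x k))%C) /\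
    (forall x k, is_cderive (fun t => gamma t k) x (Ci * (Cconj (beta x O) * beta x k - beta x O * Cconj (beta x k)))%C).
Proof.
  intros Hlax Hmon Hple Hra Hrc.
  assert (Hbx : forall x, exists c, (forall z, b x z = hpoly m c z) /\ forall k, (m <= k)%nat -> c k = 0%C).
  { intros x. now apply ple_coef_cut. }
  assert (Hax : forall x, exists c, (forall z, a x z = (Ci * (z ^ m + hpoly m c z))%C) /\ forall k, (m <= k)%nat -> c k = 0%C).
  { intros x. destruct (Hmon x) as (h & Hh & Eh). destruct (ple_coef_cut m h Hh) as (c0 & Hc0 & Hcut).
    exists c0. split; auto. intros z. rewrite <- Hc0, <- Eh.
    transitivity (- (Ci * Ci) * a x z)%C; [rewrite Ci_sq; ring|ring]. }
  set (beta := fun x => proj1_sig (constructive_indefinite_description _ (Hbx x))).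
  set (gamma := fun x => proj1_sig (constructive_indefinite_description _ (Hax x))).
  assert (Eb : forall x, (forall z, b x z = hpoly m (beta x) z) /\ forall k, (m <= k)%nat -> beta x k = 0%C).
  { intros x. unfold beta. destruct (constructive_indefinite_description _ (Hbx x)); auto. }
  assert (Ea : forall x, (forall z, a x z = (Ci * (z ^ m + hpoly m (gamma x) z))%C) /\ forall k, (m <= k)%nat -> gamma x k = 0%C).
  { intros x. unfold gamma. destruct (constructive_indefinite_description _ (Hax x)); auto. }
  clearbody beta gamma.
  assert (Hgr : forall x k, Cconj (gamma x k) = gamma x k).
  { intros x k. destruct (Nat.lt_ge_cases k m) as [Hk|Hk].
    - apply (hpoly_inj m (fun k => Cconj (gamma x k)) (gamma x)); auto.
      intros z. rewrite <- hpoly_conj. specialize (Hra x z). rewrite !(proj1 (Ea x)) in Hra.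
      rewrite Cmult_conj, Cplus_conj, Cpow_conj, Cconj_conj, Cconj_Ci in Hra.
      transitivity (- (Ci * Ci) * Cconj (hpoly m (gamma x) (Cconj z)))%C; [rewrite Ci_sq; ring|].
      transitivity (Ci * (- Ci * (z ^ m + Cconj (hpoly m (gamma x) (Cconj z)))) + (Ci * Ci) * z ^ m)%C; [ring|].
      rewrite Hra. transitivity (- (Ci * Ci) * hpoly m (gamma x) z)%C; [ring|]. rewrite Ci_sq; ring.
    - rewrite (proj2 (Ea x)) by auto. apply injective_projections; simpl; ring. }
  assert (Hbd : forall x, beta x O = v x /\
    forall k, is_cderive (fun t => beta t k) x (- (2 * Ci) * beta x (S k) + 2 * Ci * (v x * gamma x k))%C).
  { intros x.
    destruct (hpoly_derive_coef m beta (fun z => - (2 * Ci * z * b x z) + 2 * v x * a x z)%C x) as (db & D1 & D2 & D3).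
    - intros t k Hk. now apply (proj2 (Eb t)).
    - intros z. apply is_cderive_ext with (fun t => b t z).
      + intros t. apply (proj1 (Eb t)).
      + apply (proj1 (proj2 (Hlax z))).
    (* Index 0 belongs to z^m, index j + 1 to the coefficient [j] of b_x. *)
    - assert (Z : forall k, (k < S m)%nat ->
        (match k with O => 2 * Ci * (v x - beta x O) | S j => - (2 * Ci) * beta x (S j) + 2 * Ci * (v x * gamma x j) - db j end)%C = 0%C).
      { apply (hpoly_zero_coef 1); [exact C1_nz|].
        intros j. set (z := (RtoC (2 ^ j) * 1)%C).
        rewrite (hpoly_cons (2 * Ci * (v x - beta x O))%C m (fun j => - (2 * Ci) * beta x (S j) + 2 * Ci * (v x * gamma x j) - db j)%C).
        rewrite hpoly_minus, hpoly_plus, !hpoly_scal, D3, (hpoly_shift m (beta x)).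
        rewrite (proj1 (Eb x)), (proj1 (Ea x)), (proj2 (Eb x) m) by lia. ring. }
      assert (H0 : beta x O = v x).
      { specialize (Z O ltac:(lia)). cbv beta iota in Z.
        apply (Cmult_reg_l' (2 * Ci)%C).
        - exact Ci2_nz.
        - transitivity (2 * Ci * v x - 2 * Ci * (v x - beta x O))%C; [ring|]. rewrite Z. ring. }
      split; auto. intros k. eapply is_cderive_eq; [apply D1|].
      destruct (Nat.lt_ge_cases k m) as [Hk|Hk].
      + specialize (Z (S k) ltac:(lia)). cbv beta iota in Z.
        transitivity (- (2 * Ci) * beta x (S k) + 2 * Ci * (v x * gamma x k)
           - (- (2 * Ci) * beta x (S k) + 2 * Ci * (v x * gamma x k) - db k))%C; [ring|]. rewrite Z. ring.
      + rewrite D2, (proj2 (Eb x) (S k)), (proj2 (Ea x) k) by lia. ring. }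
  exists beta, gamma.
  split; [intros; apply (proj1 (Ea x))|].
  split; [intros; apply (proj1 (Eb x))|].
  split; [intros; now apply (proj2 (Eb x))|].
  split; [intros; now apply (proj2 (Ea x))|].
  split; [auto|].
  split; [intros; apply (proj1 (Hbd x))|].
  split.
  - intros x k. rewrite (proj1 (Hbd x)). apply (proj2 (Hbd x)).
  - intros x k.
    destruct (hpoly_derive_coef m gamma (fun z => Ci * (v x * c x z + Cconj (v x) * b x z))%C x) as (dg & D1 & D2 & D3).
    + intros t j Hj. now apply (proj2 (Ea t)).
    + intros z. apply is_cderive_ext with (fun t => - Ci * a t z - z ^ m)%C.
      * intros t. rewrite (proj1 (Ea t)).
        transitivity (- (Ci * Ci) * (z ^ m + hpoly m (gamma t) z) - z ^ m)%C; [ring|]. rewrite Ci_sq; ring.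
      * eapply is_cderive_eq.
        -- apply is_cderive_minus; [apply is_cderive_mult_const, (proj1 (Hlax z))|apply is_cderive_const].
        -- ring.
    + eapply is_cderive_eq; [apply D1|].
      rewrite (proj1 (Hbd x)).
      destruct (Nat.lt_ge_cases k m) as [Hk|Hk].
      * apply (hpoly_inj m dg (fun k => Ci * (Cconj (v x) * beta x k - v x * Cconj (beta x k)))%C); auto.
        intros z. rewrite D3, hpoly_scal, hpoly_minus, !hpoly_scal, <- hpoly_conj, Hrc, !(proj1 (Eb x)). ring.
      * rewrite D2, (proj2 (Eb x) k) by lia. apply injective_projections; simpl; ring.
Qed.

(** * Polynomial vector fields *)

(** Vector fields are kept as syntax, so that differentials, bounds and Taylor remainders come from
    one induction; [PConj] admits polynomials in the conjugates too. *)
Inductive pexp (I : Type) : Type :=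
| PCst (c : C) | PVar (i : I) | PAdd (p q : pexp I) | PMul (p q : pexp I) | PConj (p : pexp I).
Arguments PCst {I}. Arguments PVar {I}. Arguments PAdd {I}. Arguments PMul {I}. Arguments PConj {I}.

Fixpoint ev {I : Type} (p : pexp I) (y : I -> C) : C :=
  match p with
  | PCst c => c
  | PVar i => y i
  | PAdd p q => (ev p y + ev q y)%C
  | PMul p q => (ev p y * ev q y)%C
  | PConj p => Cconj (ev p y)
  end.

(** The differential at [y] in direction [h]; because of [PConj] it is only real-linear in [h]. *)
Fixpoint dev {I : Type} (p : pexp I) (y h : I -> C) : C :=
  match p with
  | PCst c => 0%C
  | PVar i => h i
  | PAdd p q => (dev p y h + dev q y h)%C
  | PMul p q => (dev p y h * ev q y + ev p y * dev q y h)%C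
  | PConj p => Cconj (dev p y h)
  end.

Section Pexp.
Context {I : Type}.
Implicit Type (p : pexp I).

Lemma ev_ext p (y y' : I -> C) : (forall i, y i = y' i) -> ev p y = ev p y'.
Proof. intros H; induction p; simpl; congruence. Qed.

Lemma ev_derive p (y : R -> I -> C) (dy : I -> C) s :
  (forall i, is_cderive (fun t => y t i) s (dy i)) -> is_cderive (fun t => ev p (y t)) s (dev p (y s) dy).
Proof.
  intros H; induction p; cbn [ev dev].
  - apply is_cderive_const.
  - apply H.
  - now apply is_cderive_plus.
  - now apply is_cderive_mult.
  - now apply is_cderive_conj.
Qed.

Lemma ev_continuous {U : UniformSpace} p (y : U -> I -> C) (s : U) :
  (forall i, continuous (fun t => y t i) s) -> continuous (fun t => ev p (y t)) s.
Proof.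
  intros H; induction p; cbn [ev].
  - apply continuous_const.
  - apply H.
  - now apply continuous_Cplus.
  - now apply continuous_Cmult.
  - now apply continuous_Cconj.
Qed.

(** The four bounds go together because products mix them. [K] depends on the radius [M] only, so
    the last one is a genuine second-order remainder. *)
Lemma ev_taylor p (M : R) : exists K, 0 <= K /\ forall (y h : I -> C) B,
  0 <= B -> (forall i, Cmod (y i) <= M) -> (forall i, Cmod (y i + h i)%C <= M) -> (forall i, Cmod (h i) <= B) ->
  Cmod (ev p y) <= K /\ Cmod (dev p y h) <= K * B /\
  Cmod (ev p (fun i => y i + h i)%C - ev p y)%C <= K * B /\
  Cmod (ev p (fun i => y i + h i)%C - ev p y - dev p y h)%C <= K * (B * B).
Proof.
  induction p as [c|i|p (Kp & HKp & IHp) q (Kq & HKq & IHq)|p (Kp & HKp & IHp) q (Kq & HKq & IHq)|p (Kp & HKp & IHp)].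
  - exists (Cmod c). pose proof (Cmod_ge_0 c). split; auto. intros y h B HB _ _ _. cbn [ev dev].
    replace (c - c - 0)%C with (RtoC 0) by ring. replace (c - c)%C with (RtoC 0) by ring. rewrite Cmod_0.
    repeat split; nra.
  - exists (Rabs M + 1). pose proof (Rabs_pos M). pose proof (Rle_abs M). split; [lra|].
    intros y h B HB H1 H2 H3. cbn [ev dev].
    replace (y i + h i - y i - h i)%C with (RtoC 0) by ring. replace (y i + h i - y i)%C with (h i) by ring. rewrite Cmod_0.
    specialize (H1 i). specialize (H3 i). repeat split; nra.
  - exists (Kp + Kq). split; [lra|]. intros y h B HB H1 H2 H3. cbn [ev dev].
    destruct (IHp y h B HB H1 H2 H3) as (A1 & A2 & A3 & A4).
    destruct (IHq y h B HB H1 H2 H3) as (B1 & B2 & B3 & B4).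
    set (p0 := ev p y) in *. set (q0 := ev q y) in *.
    set (p1 := ev p (fun i => y i + h i)%C) in *. set (q1 := ev q (fun i => y i + h i)%C) in *.
    set (dp := dev p y h) in *. set (dq := dev q y h) in *.
    split; [|split; [|split]].
    + eapply Rle_trans; [apply Cmod_triangle|]. lra.
    + eapply Rle_trans; [apply Cmod_triangle|]. lra.
    + replace (p1 + q1 - (p0 + q0))%C with ((p1 - p0) + (q1 - q0))%C by ring.
      eapply Rle_trans; [apply Cmod_triangle|]. lra.
    + replace (p1 + q1 - (p0 + q0) - (dp + dq))%C with ((p1 - p0 - dp) + (q1 - q0 - dq))%C by ring.
      eapply Rle_trans; [apply Cmod_triangle|]. lra.
  - exists (4 * Kp * Kq). assert (HK : 0 <= Kp * Kq) by nra. split; [lra|]. intros y h B HB H1 H2 H3. cbn [ev dev].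
    destruct (IHp y h B HB H1 H2 H3) as (A1 & A2 & A3 & A4).
    destruct (IHq y h B HB H1 H2 H3) as (B1 & B2 & B3 & B4).
    assert (H4 : forall i : I, Cmod (- h i)%C <= B) by (intros; rewrite Cmod_opp; auto).
    (* The bound at y + h is the induction hypothesis with base point y + h and increment - h. *)
    assert (Q1 : Cmod (ev q (fun i => y i + h i)%C) <= Kq).
    { apply (IHq (fun i => y i + h i)%C (fun i => - h i)%C B HB H2); auto.
      intros i. replace (y i + h i + - h i)%C with (y i) by ring. auto. }
    set (p0 := ev p y) in *. set (q0 := ev q y) in *.
    set (p1 := ev p (fun i => y i + h i)%C) in *. set (q1 := ev q (fun i => y i + h i)%C) in *.
    set (dp := dev p y h) in *. set (dq := dev q y h) in *.
    assert (Pr : forall a b X Y, Cmod a <= X -> Cmod b <= Y -> Cmod (a * b)%C <= X * Y).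
    { intros a b X Y Ha Hb. rewrite Cmod_mult. apply Rmult_le_compat; auto; apply Cmod_ge_0. }
    assert (HKB : 0 <= Kp * Kq * B) by nra. assert (HKBB : 0 <= Kp * Kq * (B * B)) by nra.
    split; [|split; [|split]].
    + pose proof (Pr _ _ _ _ A1 B1). lra.
    + eapply Rle_trans; [apply Cmod_triangle|].
      pose proof (Pr _ _ _ _ A2 B1). pose proof (Pr _ _ _ _ A1 B2). nra.
    + replace (p1 * q1 - p0 * q0)%C with ((p1 - p0) * q1 + p0 * (q1 - q0))%C by ring.
      eapply Rle_trans; [apply Cmod_triangle|].
      pose proof (Pr _ _ _ _ A3 Q1). pose proof (Pr _ _ _ _ A1 B3). nra.
    + replace (p1 * q1 - p0 * q0 - (dp * q0 + p0 * dq))%C with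
        ((p1 - p0) * (q1 - q0) + ((p1 - p0 - dp) * q0 + p0 * (q1 - q0 - dq)))%C by ring.
      eapply Rle_trans; [apply Cmod_triangle|].
      eapply Rle_trans; [apply Rplus_le_compat_l, Cmod_triangle|].
      pose proof (Pr _ _ _ _ A3 B3). pose proof (Pr _ _ _ _ A4 B1). pose proof (Pr _ _ _ _ A1 B4). nra.
  - exists Kp. split; auto. intros y h B HB H1 H2 H3. cbn [ev dev].
    destruct (IHp y h B HB H1 H2 H3) as (A1 & A2 & A3 & A4).
    rewrite <- !Cminus_conj, !Cmod_conj. auto.
Qed.

Lemma ev_taylor_list {J : Type} (ix : list J) (T : J -> pexp I) (M : R) : exists K, 0 <= K /\ forall i, In i ix -> forall (y h : I -> C) B,
  0 <= B -> (forall i, Cmod (y i) <= M) -> (forall i, Cmod (y i + h i)%C <= M) -> (forall i, Cmod (h i) <= B) ->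
  Cmod (ev (T i) y) <= K /\ Cmod (dev (T i) y h) <= K * B /\
  Cmod (ev (T i) (fun i => y i + h i)%C - ev (T i) y)%C <= K * B /\
  Cmod (ev (T i) (fun i => y i + h i)%C - ev (T i) y - dev (T i) y h)%C <= K * (B * B).
Proof.
  induction ix as [|j ix (K & HK & IH)].
  - exists 0; split; [lra|]. intros i [].
  - destruct (ev_taylor (T j) M) as (K' & HK' & H').
    exists (K + K'). split; [lra|].
    intros i Hi y h B HB H1 H2 H3.
    assert (HBB : 0 <= B * B) by nra.
    destruct Hi as [<-|Hi]; [destruct (H' y h B HB H1 H2 H3) as (A1 & A2 & A3 & A4)|
      destruct (IH i Hi y h B HB H1 H2 H3) as (A1 & A2 & A3 & A4)]; repeat split; nra.
Qed.

Lemma ev_bound_list {J : Type} (ix : list J) (T : J -> pexp I) (M : R) : exists K, 0 <= K /\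
  forall i, In i ix -> forall y : I -> C, (forall i, Cmod (y i) <= M) -> Cmod (ev (T i) y) <= K.
Proof.
  destruct (ev_taylor_list ix T M) as (K & HK & H). exists K. split; auto. intros i Hi y Hy.
  apply (H i Hi y (fun _ => RtoC 0) 0); auto; [lra| |].
  - intros j. replace (y j + 0)%C with (y j) by ring. auto.
  - intros j. rewrite Cmod_0; lra.
Qed.

Lemma ev_bound p (M : R) : exists K, 0 <= K /\ forall y : I -> C, (forall i, Cmod (y i) <= M) -> Cmod (ev p y) <= K.
Proof.
  destruct (ev_bound_list (tt :: nil) (fun _ => p) M) as (K & HK & H).
  exists K. split; auto. intros y. apply (H tt). simpl; auto.
Qed.
End Pexp.

(** * The NLS hierarchy: the commuting flows in [x] and [t] *)

(* [iB k] and [iG k] are the coefficients of [z ^ (d - 1 - k)] in [b] and in [f - z ^ d],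
   [iY j] the components of a vector solution. The potential is [v = iB 0]. *)
Inductive idx : Type := iB (k : nat) | iG (k : nat) | iY (j : bool).

(* [v_x], read off the top coefficient of [b_x]. *)
Definition pvx : pexp idx :=
  PAdd (PMul (PCst (- (2 * Ci))%C) (PVar (iB 1))) (PMul (PCst (2 * Ci)%C) (PMul (PVar (iB 0)) (PVar (iG 0)))).

Definition pabs2 : pexp idx := PMul (PVar (iB 0)) (PConj (PVar (iB 0))).

(* [P_x = [U, P]] and [y_x = U y]. *)
Definition xfield (z : C) (i : idx) : pexp idx :=
  match i with
  | iB k => PAdd (PMul (PCst (- (2 * Ci))%C) (PVar (iB (S k)))) (PMul (PCst (2 * Ci)%C) (PMul (PVar (iB 0)) (PVar (iG k))))
  | iG k => PMul (PCst Ci) (PAdd (PMul (PConj (PVar (iB 0))) (PVar (iB k)))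
              (PMul (PCst (- (1))%C) (PMul (PVar (iB 0)) (PConj (PVar (iB k))))))
  | iY false => PAdd (PMul (PCst (- (Ci * z))%C) (PVar (iY false))) (PMul (PCst (- (1))%C) (PMul (PVar (iB 0)) (PVar (iY true))))
  | iY true => PAdd (PMul (PConj (PVar (iB 0))) (PVar (iY false))) (PMul (PCst (Ci * z)%C) (PVar (iY true)))
  end.

(* [P_t = [V, P]] and [y_t = V y] with
   [V = [[- 2 i z^2 + i |v|^2, - 2 z v - i v_x], [2 z conj v - i conj v_x, 2 i z^2 - i |v|^2]]]. *)
Definition tfield (z : C) (i : idx) : pexp idx :=
  match i with
  | iB k =>
      PAdd (PAdd (PMul (PCst (- (4 * Ci))%C) (PVar (iB (S (S k))))) (PMul (PCst (2 * Ci)%C) (PMul pabs2 (PVar (iB k)))))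
           (PAdd (PMul (PCst (4 * Ci)%C) (PMul (PVar (iB 0)) (PVar (iG (S k))))) (PMul (PCst (- (2))%C) (PMul pvx (PVar (iG k)))))
  | iG k =>
      PAdd (PMul (PCst (- (2 * Ci))%C) (PAdd (PMul (PVar (iB 0)) (PConj (PVar (iB (S k)))))
                                        (PMul (PCst (- (1))%C) (PMul (PConj (PVar (iB 0))) (PVar (iB (S k)))))))
           (PAdd (PMul pvx (PConj (PVar (iB k)))) (PMul (PConj pvx) (PVar (iB k))))
  | iY false =>
      PAdd (PMul (PAdd (PCst (- (2 * Ci * z * z))%C) (PMul (PCst Ci) pabs2)) (PVar (iY false)))
           (PMul (PAdd (PMul (PCst (- (2 * z))%C) (PVar (iB 0))) (PMul (PCst (- Ci)%C) pvx)) (PVar (iY true)))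
  | iY true =>
      PAdd (PMul (PAdd (PMul (PCst (2 * z)%C) (PConj (PVar (iB 0)))) (PMul (PCst (- Ci)%C) (PConj pvx))) (PVar (iY false)))
           (PMul (PAdd (PCst (2 * Ci * z * z)%C) (PMul (PCst (- Ci)%C) pabs2)) (PVar (iY true)))
  end.

Ltac cnorm := repeat rewrite ?Cminus_conj, ?Cplus_conj, ?Copp_conj, ?Cmult_conj, ?Cconj_conj, ?Cconj_Ci.

Lemma Cconj_R (r : R) : Cconj (RtoC r) = RtoC r.
Proof. apply injective_projections; simpl; ring. Qed.

(** On the vector components this is the zero curvature equation U_t - V_x + [U, V] = 0, that is,
    NLS for v = iB 0. Every case is a polynomial identity modulo i^2 = -1, with the [iG k] equal to
    their conjugates. *)
Theorem fields_commute z (y : idx -> C) i :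
  (forall k, Cconj (y (iG k)) = y (iG k)) ->
  dev (xfield z i) y (fun j => ev (tfield z j) y) = dev (tfield z i) y (fun j => ev (xfield z j) y).
Proof.
  intros Hg. destruct i as [k|k|[|]]; cbn [dev ev xfield tfield pvx pabs2]; cnorm; rewrite ?Cconj_R, ?Hg.
  - ring [Ci_sq].
  - ring [Ci_sq].
  - ring [Ci_sq].
  - ring [Ci_sq].
Qed.

(** * The Lax matrix of a state and its conserved determinant *)

Definition supp (d : nat) (y : idx -> C) : Prop := forall k, (d <= k)%nat -> y (iB k) = 0%C /\ y (iG k) = 0%C.
Definition realg (y : idx -> C) : Prop := forall k, Cconj (y (iG k)) = y (iG k).

Definition fpol (d : nat) (y : idx -> C) (z : C) : C := (z ^ d + hpoly d (fun k => y (iG k)) z)%C.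
Definition bpol (d : nat) (y : idx -> C) (z : C) : C := hpoly d (fun k => y (iB k)) z.
(* For real [s] this is [- det] of the Lax matrix [[i f, b], [- conj b, - i f]]. *)
Definition density (d : nat) (y : idx -> C) (s : R) : R := Cmod (fpol d y (RtoC s)) ^ 2 + Cmod (bpol d y (RtoC s)) ^ 2.

Definition bstar (d : nat) (y : idx -> C) (z : C) : C := Cconj (bpol d y (Cconj z)).

Section Lax.
Variables (d : nat) (y : idx -> C) (z z0 : C).
Hypothesis Hs : supp d y.

Lemma bstar_hpoly : bstar d y z = hpoly d (fun k => Cconj (y (iB k))) z.
Proof. unfold bstar, bpol. now rewrite hpoly_conj. Qed.

Lemma shift_B : hpoly d (fun k => y (iB (S k))) z = (z * bpol d y z - y (iB 0) * z ^ d)%C.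
Proof. rewrite (hpoly_shift d (fun k => y (iB k))). rewrite (proj1 (Hs d (Nat.le_refl d))). unfold bpol. ring. Qed.

Lemma shift_B' : hpoly d (fun k => Cconj (y (iB (S k)))) z = (z * bstar d y z - Cconj (y (iB 0)) * z ^ d)%C.
Proof.
  rewrite bstar_hpoly, (hpoly_shift d (fun k => Cconj (y (iB k)))), (proj1 (Hs d (Nat.le_refl d))).
  rewrite (Cconj_R 0). ring.
Qed.

Lemma shift_G : hpoly d (fun k => y (iG (S k))) z = (z * (fpol d y z - z ^ d) - y (iG 0) * z ^ d)%C.
Proof. rewrite (hpoly_shift d (fun k => y (iG k))). rewrite (proj2 (Hs d (Nat.le_refl d))). unfold fpol. ring. Qed.

Lemma shift_BB : hpoly d (fun k => y (iB (S (S k)))) z = (z * (z * bpol d y z - y (iB 0) * z ^ d) - y (iB 1) * z ^ d)%C.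
Proof.
  rewrite (hpoly_shift d (fun k => y (iB (S k)))), shift_B. rewrite (proj1 (Hs (S d) (Nat.le_succ_diag_r d))). ring.
Qed.

(** The (1, 2) entry of [V, P]. The support condition closes the shifted sums, and the multiples of
    z^d and z^(d + 1) left by the shifts cancel. *)
Lemma tfield_bpol :
  bpol d (fun i => ev (tfield z0 i) y) z =
  (2 * (- (2 * Ci * z * z) + Ci * ev pabs2 y) * bpol d y z
   - 2 * (- (2 * z * y (iB 0)) - Ci * ev pvx y) * (Ci * fpol d y z))%C.
Proof.
  unfold bpol at 1. cbn [ev tfield].
  rewrite (hpoly_ext d _ (fun k =>
    (- (4 * Ci)) * y (iB (S (S k))) + (2 * Ci * ev pabs2 y) * y (iB k)
    + ((4 * Ci * y (iB 0)) * y (iG (S k)) + (- (2) * ev pvx y) * y (iG k)))%C).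
  2:{ intros k _. cbn [ev pabs2 pvx]. ring. }
  rewrite !hpoly_plus, !hpoly_scal, shift_BB, shift_G. fold (bpol d y z).
  replace (hpoly d (fun k => y (iG k)) z) with (fpol d y z - z ^ d)%C by (unfold fpol; ring).
  cbn [ev pabs2 pvx]. ring [Ci_sq].
Qed.

Lemma tfield_fpol :
  (Ci * hpoly d (fun k => ev (tfield z0 (iG k)) y) z)%C =
  ((- (2 * z * y (iB 0)) - Ci * ev pvx y) * (- bstar d y z)
   - bpol d y z * (2 * z * Cconj (y (iB 0)) - Ci * Cconj (ev pvx y)))%C.
Proof.
  cbn [ev tfield].
  rewrite (hpoly_ext d _ (fun k =>
    (- (2 * Ci) * y (iB 0)) * Cconj (y (iB (S k))) + (2 * Ci * Cconj (y (iB 0))) * y (iB (S k))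
    + (ev pvx y * Cconj (y (iB k)) + Cconj (ev pvx y) * y (iB k)))%C).
  2:{ intros k _. cbn [ev pabs2 pvx]. ring. }
  rewrite !hpoly_plus, !hpoly_scal, shift_B, shift_B'. rewrite <- bstar_hpoly. fold (bpol d y z).
  ring [Ci_sq].
Qed.

Lemma xfield_bpol :
  bpol d (fun i => ev (xfield z0 i) y) z =
  (- (2 * Ci * z) * bpol d y z + 2 * y (iB 0) * (Ci * fpol d y z))%C.
Proof.
  unfold bpol at 1. cbn [ev xfield].
  rewrite (hpoly_ext d _ (fun k => (- (2 * Ci)) * y (iB (S k)) + (2 * Ci * y (iB 0)) * y (iG k))%C).
  2:{ intros k _. ring. }
  rewrite !hpoly_plus, !hpoly_scal, shift_B.
  replace (hpoly d (fun k => y (iG k)) z) with (fpol d y z - z ^ d)%C by (unfold fpol; ring).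
  ring [Ci_sq].
Qed.

Lemma xfield_fpol :
  (Ci * hpoly d (fun k => ev (xfield z0 (iG k)) y) z)%C =
  (y (iB 0) * bstar d y z - Cconj (y (iB 0)) * bpol d y z)%C.
Proof.
  cbn [ev xfield].
  rewrite (hpoly_ext d _ (fun k => (Ci * Cconj (y (iB 0))) * y (iB k) + (- Ci * y (iB 0)) * Cconj (y (iB k)))%C).
  2:{ intros k _. ring. }
  rewrite !hpoly_plus, !hpoly_scal. rewrite <- bstar_hpoly. fold (bpol d y z).
  ring [Ci_sq].
Qed.
End Lax.

Lemma fpol_real d y s : realg y -> snd (fpol d y (RtoC s)) = 0.
Proof.
  intros Hr.
  assert (E : Cconj (fpol d y (RtoC s)) = fpol d y (RtoC s)).
  { unfold fpol. rewrite Cplus_conj, Cpow_conj, Cconj_R. f_equal.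
    rewrite <- (Cconj_R s) at 1. rewrite hpoly_conj. apply hpoly_ext. intros; apply Hr. }
  apply (f_equal snd) in E. simpl in E. simpl. lra.
Qed.

Lemma density_derive d (y : R -> idx -> C) s t df db :
  (forall r k, is_cderive (fun r => y r (iG k)) r (df r k)) ->
  (forall r k, is_cderive (fun r => y r (iB k)) r (db r k)) ->
  is_derive (fun r => density d (y r) s) t
    (2 * Re (Cconj (fpol d (y t) (RtoC s)) * hpoly d (df t) (RtoC s)) +
     2 * Re (Cconj (bpol d (y t) (RtoC s)) * hpoly d (db t) (RtoC s))).
Proof.
  intros Hf Hb. unfold density. apply is_rderive_plus.
  - apply (is_derive_Cmod2 (fun r => fpol d (y r) (RtoC s))). unfold fpol.
    eapply is_cderive_eq. apply is_cderive_plus. apply is_cderive_const.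
    apply (is_cderive_hpoly d (fun r k => y r (iG k)) (df t)). intros k _; apply Hf. apply Cplus_0_l.
  - apply (is_derive_Cmod2 (fun r => bpol d (y r) (RtoC s))). unfold bpol.
    apply (is_cderive_hpoly d (fun r k => y r (iB k)) (db t)). intros k _; apply Hb.
Qed.

Lemma zero_derive_const_R (g : R -> R) : (forall r, is_derive g r 0) -> forall s, g s = g 0.
Proof.
  intros H s.
  assert (E : (fun t => RtoC (g t)) s = (fun t => RtoC (g t)) 0).
  { apply (zero_derive_const (fun t => RtoC (g t))). intros r. apply is_cderive_iff; simpl; split; auto.
    exact (is_derive_const (K := R_AbsRing) (V := R_NormedModule) 0 r). }
  now apply RtoC_inj in E.
Qed.

(** P_x is a commutator with P, so det P does not depend on x; hence one bound serves all base
    points. *)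
Lemma density_x_const d (y : R -> idx -> C) s :
  (forall x, supp d (y x)) -> (forall x, realg (y x)) ->
  (forall x k, is_cderive (fun r => y r (iB k)) x (ev (xfield 0 (iB k)) (y x))) ->
  (forall x k, is_cderive (fun r => y r (iG k)) x (ev (xfield 0 (iG k)) (y x))) ->
  forall x, density d (y x) s = density d (y 0) s.
Proof.
  intros Hs Hr Hb Hg. apply (zero_derive_const_R (fun x => density d (y x) s)). intros x.
  eapply is_derive_eq.
  { apply density_derive with (df := fun x k => ev (xfield 0 (iG k)) (y x)) (db := fun x k => ev (xfield 0 (iB k)) (y x)); auto. }
  pose proof (xfield_bpol d (y x) (RtoC s) 0 (Hs x)) as E1.
  pose proof (xfield_fpol d (y x) (RtoC s) 0) as E2.
  unfold bpol at 1 in E1. rewrite E1. clear E1.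
  pose proof (fpol_real d (y x) s (Hr x)) as E3.
  unfold bstar in E2. rewrite Cconj_R in E2.
  set (F := hpoly d (fun k => ev (xfield 0 (iG k)) (y x)) (RtoC s)) in *.
  assert (E4 : F = (- Ci * (y x (iB 0) * Cconj (bpol d (y x) (RtoC s)) - Cconj (y x (iB 0)) * bpol d (y x) (RtoC s)))%C).
  { rewrite <- E2. ring [Ci_sq]. }
  rewrite E4. clear E2 E4 F.
  destruct (fpol d (y x) (RtoC s)) as [f1 f2], (bpol d (y x) (RtoC s)) as [b1 b2], (y x (iB 0)) as [v1 v2].
  simpl in E3. subst f2. unfold Re. simpl. ring.
Qed.

Lemma density_t_const d (y : R -> idx -> C) (chi : R -> R) s :
  (forall t, supp d (y t)) -> (forall t, realg (y t)) ->
  (forall t k, is_cderive (fun r => y r (iB k)) t (RtoC (chi t) * ev (tfield 0 (iB k)) (y t))%C) ->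
  (forall t k, is_cderive (fun r => y r (iG k)) t (RtoC (chi t) * ev (tfield 0 (iG k)) (y t))%C) ->
  forall t, density d (y t) s = density d (y 0) s.
Proof.
  intros Hs Hr Hb Hg. apply (zero_derive_const_R (fun x => density d (y x) s)). intros t.
  eapply is_derive_eq.
  { apply density_derive with (df := fun t k => (RtoC (chi t) * ev (tfield 0 (iG k)) (y t))%C)
      (db := fun t k => (RtoC (chi t) * ev (tfield 0 (iB k)) (y t))%C); auto. }
  rewrite !hpoly_scal.
  pose proof (tfield_bpol d (y t) (RtoC s) 0 (Hs t)) as E1.
  pose proof (tfield_fpol d (y t) (RtoC s) 0 (Hs t)) as E2.
  unfold bpol at 1 in E1. rewrite E1. clear E1.
  pose proof (fpol_real d (y t) s (Hr t)) as E3.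
  unfold bstar in E2. rewrite Cconj_R in E2.
  set (F := hpoly d (fun k => ev (tfield 0 (iG k)) (y t)) (RtoC s)) in *.
  assert (E4 : F = (- Ci * (Ci * F))%C) by ring [Ci_sq].
  rewrite E4, E2. clear E2 E4 F.
  cbn [ev pabs2].
  destruct (fpol d (y t) (RtoC s)) as [f1 f2], (bpol d (y t) (RtoC s)) as [b1 b2], (y t (iB 0)) as [v1 v2], (ev pvx (y t)) as [w1 w2].
  simpl in E3. subst f2. unfold Re. simpl. ring.
Qed.

Lemma finite_sup (g : nat -> R) J : exists B, forall j, (j <= J)%nat -> g j <= B.
Proof.
  induction J as [|J [B HB]].
  - exists (g O). intros j Hj. replace j with O by lia. lra.
  - exists (Rmax B (g (S J))). intros j Hj. destruct (Nat.eq_dec j (S J)) as [->|]; [apply Rmax_r|].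
    eapply Rle_trans; [apply HB; lia|apply Rmax_l].
Qed.

(** Each square is at most the density, so the values of both polynomials at the points 2^j are
    bounded, and with them the coefficients. One [M] serves all states below [G]. *)
Lemma density_bound d (G : R -> R) : exists M, 0 <= M /\ forall y, supp d y ->
  (forall s, density d y s <= G s) -> forall k, Cmod (y (iB k)) <= M /\ Cmod (y (iG k)) <= M.
Proof.
  destruct (hpoly_coef_bound 1 d C1_nz) as (K & J & HK & HH).
  destruct (finite_sup (fun j => Rabs (2 ^ j) ^ d + (Rabs (G (2 ^ j)) + 1)) J) as [B HB].
  exists (K * Rabs B). split; [apply Rmult_le_pos; [auto|apply Rabs_pos]|].
  intros y Hs HG k.
  assert (Hsq : forall w g, 0 <= w -> w ^ 2 <= g -> w <= Rabs g + 1).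
  { intros w g Hw Hw2. pose proof (Rle_abs g). pose proof (pow2_ge_0 (w - 1)). nra. }
  assert (Hpt : forall j, (j <= J)%nat ->
    Cmod (hpoly d (fun k => y (iB k)) (RtoC (2 ^ j) * 1)%C) <= Rabs B /\
    Cmod (hpoly d (fun k => y (iG k)) (RtoC (2 ^ j) * 1)%C) <= Rabs B).
  { intros j Hj. rewrite Cmult_1_r. specialize (HB j Hj). specialize (HG (2 ^ j)). unfold density in HG.
    cbv beta in HB. pose proof (Rle_abs B).
    pose proof (pow_le (Rabs (2 ^ j)) d (Rabs_pos _)).
    assert (B1 : Cmod (bpol d y (RtoC (2 ^ j))) <= Rabs (G (2 ^ j)) + 1).
    { apply Hsq; [apply Cmod_ge_0|]. pose proof (pow2_ge_0 (Cmod (fpol d y (RtoC (2 ^ j))))). lra. }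
    assert (B2 : Cmod (fpol d y (RtoC (2 ^ j))) <= Rabs (G (2 ^ j)) + 1).
    { apply Hsq; [apply Cmod_ge_0|]. pose proof (pow2_ge_0 (Cmod (bpol d y (RtoC (2 ^ j))))). lra. }
    split; [unfold bpol in B1; lra|].
    replace (hpoly d (fun k => y (iG k)) (RtoC (2 ^ j))) with (fpol d y (RtoC (2 ^ j)) + - RtoC (2 ^ j) ^ d)%C by (unfold fpol; ring).
    eapply Rle_trans; [apply Cmod_triangle|]. rewrite Cmod_opp, Cmod_pow, Cmod_R. lra. }
  destruct (Nat.lt_ge_cases k d) as [Hk|Hk].
  - split.
    + apply (HH (fun k => y (iB k))); auto. intros j Hj. now apply Hpt.
    + apply (HH (fun k => y (iG k))); auto. intros j Hj. now apply Hpt.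
  - destruct (Hs k Hk) as [-> ->]. rewrite Cmod_0. split; apply Rmult_le_pos; auto; apply Rabs_pos.
Qed.

(** * Global existence of the t-flow by cut-off *)

Definition clip1 (M r : R) : R := Rmax (- M) (Rmin M r).
(** A square instead of a disc: the Lipschitz constant 1 is inherited from the components, at the
    cost of the bound 2 M. *)
Definition clip (M : R) (w : C) : C := (clip1 M (fst w), clip1 M (snd w)).

Lemma clip1_lip M r r' : Rabs (clip1 M r - clip1 M r') <= Rabs (r - r').
Proof.
  unfold clip1, Rmax, Rmin, Rabs.
  repeat destruct (Rle_dec _ _); repeat destruct (Rcase_abs _); lra.
Qed.

Lemma clip1_id M r : Rabs r <= M -> clip1 M r = r.
Proof.
  intros H. apply Rabs_le_between in H. unfold clip1. rewrite Rmin_right, Rmax_right; lra.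
Qed.

Lemma clip1_bound M r : 0 <= M -> Rabs (clip1 M r) <= M.
Proof.
  intros H. apply Rabs_le. unfold clip1, Rmax, Rmin. repeat destruct (Rle_dec _ _); lra.
Qed.

Lemma clip1_near M r : 0 <= M -> Rabs (r - clip1 M r) <= 1 -> clip1 (M + 1) r = r.
Proof.
  intros HM H. apply clip1_id. pose proof (clip1_bound M r HM).
  replace r with ((r - clip1 M r) + clip1 M r) by ring. eapply Rle_trans; [apply Rabs_triang|]. lra.
Qed.

Lemma Cmod_le_compat (w w' : C) : Rabs (fst w) <= Rabs (fst w') -> Rabs (snd w) <= Rabs (snd w') -> Cmod w <= Cmod w'.
Proof.
  intros H1 H2. apply Rsqr_incr_0; try apply Cmod_ge_0.
  unfold Rsqr. replace (Cmod w * Cmod w) with (Cmod w ^ 2) by ring. replace (Cmod w' * Cmod w') with (Cmod w' ^ 2) by ring.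
  rewrite !Cmod2_alt. unfold Re, Im.
  rewrite <- (pow2_abs (fst w)), <- (pow2_abs (snd w)), <- (pow2_abs (fst w')), <- (pow2_abs (snd w')).
  apply Rplus_le_compat; apply pow_incr; split; auto; apply Rabs_pos.
Qed.

Lemma clip_lip M w w' : Cmod (clip M w - clip M w')%C <= Cmod (w - w')%C.
Proof. apply Cmod_le_compat; simpl; apply clip1_lip. Qed.

Lemma clip_bound M w : 0 <= M -> Cmod (clip M w) <= 2 * M.
Proof.
  intros H. eapply Rle_trans; [apply Cmod_le_sum|]. simpl.
  pose proof (clip1_bound M (fst w) H). pose proof (clip1_bound M (snd w) H). lra.
Qed.

Lemma clip_id M w : Cmod w <= M -> clip M w = w.
Proof.
  intros H. unfold clip. rewrite !clip1_id; [now destruct w| |].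
  - eapply Rle_trans; [apply Rabs_snd_le|auto].
  - eapply Rle_trans; [apply Rabs_fst_le|auto].
Qed.

Lemma clip_near M w : 0 <= M -> Cmod (w - clip M w)%C <= 1 -> clip (M + 1) w = w.
Proof.
  intros HM H. unfold clip at 1. rewrite !clip1_near; auto; [now destruct w| |].
  - eapply Rle_trans; [apply (Rabs_snd_le (w - clip M w)%C)|auto].
  - eapply Rle_trans; [apply (Rabs_fst_le (w - clip M w)%C)|auto].
Qed.

Definition ixP (d : nat) : list idx := map iB (seq 0 d) ++ map iG (seq 0 d).

Lemma in_ixP d i : In i (ixP d) <-> exists k, (k < d)%nat /\ (i = iB k \/ i = iG k).
Proof.
  unfold ixP. rewrite in_app_iff, !in_map_iff. split.
  - intros [(k & <- & Hk)|(k & <- & Hk)]; apply in_seq in Hk; exists k; split; auto; lia.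
  - intros (k & Hk & [->| ->]); [left|right]; exists k; split; auto; apply in_seq; lia.
Qed.

Lemma tfield_cut d z y k : supp d y -> (d <= k)%nat ->
  ev (tfield z (iB k)) y = 0%C /\ ev (tfield z (iG k)) y = 0%C.
Proof.
  intros Hs Hk. destruct (Hs k Hk) as [E1 E2]. destruct (Hs (S k) ltac:(lia)) as [E3 E4].
  destruct (Hs (S (S k)) ltac:(lia)) as [E5 E6].
  cbn [ev tfield]. rewrite E1, E2, E3, E4, E5, (Cconj_R 0). split; ring.
Qed.

Lemma tfield_G_real z y k : Cconj (ev (tfield z (iG k)) y) = ev (tfield z (iG k)) y.
Proof. cbn [ev tfield]. cnorm. rewrite ?Cconj_R. ring. Qed.

Lemma Rmax_lip a b : Rabs (Rmax 0 a - Rmax 0 b) <= Rabs (a - b).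
Proof. unfold Rmax, Rabs. repeat destruct (Rle_dec _ _); repeat destruct (Rcase_abs _); lra. Qed.

Definition tflow_from (d : nat) (y0 : idx -> C) (y : R -> idx -> C) : Prop :=
  (forall k, y 0 (iB k) = y0 (iB k) /\ y 0 (iG k) = y0 (iG k)) /\
  (forall t, supp d (y t)) /\ (forall t, realg (y t)) /\
  (forall t k, is_cderive (fun r => y r (iB k)) t (ev (tfield 0 (iB k)) (y t))) /\
  (forall t k, is_cderive (fun r => y r (iG k)) t (ev (tfield 0 (iG k)) (y t))) /\
  (forall t s, density d (y t) s = density d (y0) s).

(* The field is cut off by a scalar factor [chi]: this only reparametrises the time
   of the true flow, so the density is conserved, which in turn forces [chi = 1]. *)
Theorem tflow_exists d (y0 : idx -> C) :
  supp d y0 -> realg y0 -> exists y, tflow_from d y0 y.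
Proof.
  intros Hs0 Hr0.
  destruct (density_bound d (density d y0)) as (M & HM & HMb).
  set (ix := ixP d).
  (* Only coefficients below [d] move; all other components start at 0 and stay there. *)
  set (live := fun i : idx => match i with iB k | iG k => if lt_dec k d then true else false | iY _ => false end).
  assert (Hlive : forall i, live i = true -> In i ix).
  { intros [k|k|j] Hi; simpl in Hi; try discriminate; destruct (lt_dec k d); try discriminate; apply in_ixP; exists k; auto. }
  (* Equal to 1 when clipping at [M] changes no coefficient, and 0 once the total change reaches 1.
     Where [chi] is positive, clipping at M + 1 changes nothing. *)
  set (chi := fun y : idx -> C => Rmax 0 (1 - lsum ix (fun i => Cmod (y i - clip M (y i))%C))).
  set (cc := fun (y : idx -> C) i => if live i then clip (M + 1) (y i) else RtoC 0).
  set (F := fun (s : R) (y : idx -> C) i => if live i then (RtoC (chi y) * ev (tfield 0 i) (cc y))%C else RtoC 0).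
  destruct (ev_taylor_list ix (tfield 0) (2 * (M + 1))) as (K & HK & HT).
  assert (Hcc : forall y i, Cmod (cc y i) <= 2 * (M + 1)).
  { intros y i. unfold cc. destruct (live i); [apply clip_bound; lra|rewrite Cmod_0; lra]. }
  assert (Hcl : forall y y' i, Cmod (cc y i - cc y' i)%C <= nrm ix (fun j => y j - y' j)%C).
  { intros y y' i. unfold cc. destruct (live i) eqn:E.
    - eapply Rle_trans; [apply clip_lip|].
      apply (lsum_In ix (fun j => Cmod (y j - y' j)%C)); auto. intros; apply Cmod_ge_0.
    - replace (RtoC 0 - RtoC 0)%C with (RtoC 0) by ring. rewrite Cmod_0. apply nrm_ge0. }
  assert (Hchi1 : forall y, 0 <= chi y <= 1).
  { intros y. unfold chi. split; [apply Rmax_l|]. apply Rmax_lub; [lra|].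
    pose proof (lsum_ge0 ix (fun i => Cmod (y i - clip M (y i))%C) (fun i => Cmod_ge_0 _)). lra. }
  assert (Hchil : forall y y', Rabs (chi y - chi y') <= 2 * nrm ix (fun j => y j - y' j)%C).
  { intros y y'. unfold chi. eapply Rle_trans; [apply Rmax_lip|].
    replace (1 - lsum ix (fun i => Cmod (y i - clip M (y i))%C) - (1 - lsum ix (fun i => Cmod (y' i - clip M (y' i))%C)))
      with (lsum ix (fun i => Cmod (y' i - clip M (y' i))%C + -1 * Cmod (y i - clip M (y i))%C)).
    2:{ rewrite lsum_plus, lsum_scal. ring. }
    eapply Rle_trans; [apply Rabs_lsum|]. unfold nrm. rewrite <- lsum_scal. apply lsum_le. intros i _.
    pose proof (clip_lip M (y i) (y' i)) as H1.
    assert (H2 : forall a b : C, Rabs (Cmod a + -1 * Cmod b) <= Cmod (a - b)%C).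
    { intros a b. apply Rabs_le.
      pose proof (Cmod_triangle (a - b) b) as T1. pose proof (Cmod_triangle (- (a - b)) a) as T2.
      replace (a - b + b)%C with a in T1 by ring. replace (- (a - b) + a)%C with b in T2 by ring.
      rewrite Cmod_opp in T2. lra. }
    eapply Rle_trans; [apply H2|].
    replace (y' i - clip M (y' i) - (y i - clip M (y i)))%C with (- (y i - y' i) + (clip M (y i) - clip M (y' i)))%C by ring.
    eapply Rle_trans; [apply Cmod_triangle|]. rewrite Cmod_opp. lra. }
  assert (HevK : forall i, In i ix -> forall y, Cmod (ev (tfield 0 i) (cc y)) <= K).
  { intros i Hi y. apply (HT i Hi (cc y) (fun _ => RtoC 0) 0); [lra|auto| |].
    - intros j. replace (cc y j + 0)%C with (cc y j) by ring. auto.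
    - intros j. rewrite Cmod_0. lra. }
  (* Of the constant 3 K, the part 2 K comes from the variation of [chi] and K from that of the
     field. *)
  assert (HL : forall s y y' i, Cmod (F s y i - F s y' i)%C <= (3 * K) * nrm ix (fun j => y j - y' j)%C).
  { intros s y y' i. unfold F. set (B := nrm ix (fun j => y j - y' j)%C).
    assert (HB : 0 <= B) by apply nrm_ge0.
    destruct (live i) eqn:E.
    - specialize (Hlive i E).
      assert (H1 : Cmod (ev (tfield 0 i) (cc y) - ev (tfield 0 i) (cc y'))%C <= K * B).
      { rewrite (ev_ext _ (cc y) (fun j => cc y' j + (cc y j - cc y' j))%C) by (intros; ring).
        apply (HT i Hlive (cc y') (fun j => cc y j - cc y' j)%C B); auto.
        intros j. replace (cc y' j + (cc y j - cc y' j))%C with (cc y j) by ring. auto. }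
      replace (chi y * ev (tfield 0 i) (cc y) - chi y' * ev (tfield 0 i) (cc y'))%C with
        (RtoC (chi y - chi y') * ev (tfield 0 i) (cc y) + RtoC (chi y') * (ev (tfield 0 i) (cc y) - ev (tfield 0 i) (cc y')))%C
        by (rewrite RtoC_minus; ring).
      eapply Rle_trans; [apply Cmod_triangle|]. rewrite !Cmod_mult, !Cmod_R.
      specialize (Hchil y y'). fold B in Hchil. specialize (HevK i Hlive y). specialize (Hchi1 y').
      rewrite (Rabs_right (chi y')) by lra.
      assert (Rabs (chi y - chi y') * Cmod (ev (tfield 0 i) (cc y)) <= 2 * B * K).
      { apply Rmult_le_compat; auto; [apply Rabs_pos|apply Cmod_ge_0]. }
      assert (chi y' * Cmod (ev (tfield 0 i) (cc y) - ev (tfield 0 i) (cc y'))%C <= 1 * (K * B)).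
      { apply Rmult_le_compat; try lra. apply Cmod_ge_0. }
      lra.
    - replace (RtoC 0 - RtoC 0)%C with (RtoC 0) by ring. rewrite Cmod_0. nra. }
  destruct (picard_lindelof ix F (fun i => match i with iY _ => RtoC 0 | _ => y0 i end) (3 * K) K) as (y & Hy0 & Hy).
  - exact HL.
  - lra.
  - intros s i. unfold F. destruct (live i) eqn:E; [|rewrite Cmod_0; lra].
    rewrite Cmod_mult, Cmod_R. specialize (HevK i (Hlive i E) (fun i => match i with iY _ => RtoC 0 | _ => y0 i end)).
    match goal with |- Rabs (chi ?w) * _ <= _ => specialize (Hchi1 w) end.
    rewrite Rabs_right by lra.
    rewrite <- (Rmult_1_l K). apply Rmult_le_compat; try lra. apply Cmod_ge_0.
  - intros y Hy i s. apply epsdelta_continuous_C. intros eta Heta.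
    assert (Hn : exists delta, 0 < delta /\ forall t, Rabs (t - s) < delta ->
      nrm ix (fun j => y t j - y s j)%C <= eta / (3 * K + 1)).
    { assert (Hpos : 0 < eta / (3 * K + 1)) by (apply Rdiv_lt_0_compat; lra).
      revert Hpos. generalize (eta / (3 * K + 1)) as e1. clearbody ix. clear - Hy.
      induction ix as [|j ix' IH]; intros e1 He1.
      - exists 1; split; [lra|]. intros; unfold nrm; simpl; lra.
      - destruct (IH (e1 / 2) ltac:(lra)) as (d1 & Hd1 & H1).
        destruct (continuous_C_epsdelta _ _ (Hy j s) (e1 / 2) ltac:(lra)) as (d2 & Hd2 & H2).
        exists (Rmin d1 d2). split; [now apply Rmin_pos|]. intros t Ht.
        specialize (H1 t (Rlt_le_trans _ _ _ Ht (Rmin_l _ _))). specialize (H2 t (Rlt_le_trans _ _ _ Ht (Rmin_r _ _))).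
        unfold nrm in *. rewrite lsum_cons. lra. }
    destruct Hn as (delta & Hd & Hn). exists delta; split; auto. intros t Ht.
    unfold F at 1 2. fold (F s (y t) i). fold (F s (y s) i).
    eapply Rle_trans; [apply HL|]. specialize (Hn t Ht).
    apply Rle_trans with (3 * K * (eta / (3 * K + 1))); [apply Rmult_le_compat_l; lra|].
    assert (0 <= eta / (3 * K + 1)) by (apply Rdiv_le_0_compat; lra).
    replace eta with ((3 * K + 1) * (eta / (3 * K + 1))) at 2 by (field; lra). lra.
  - assert (Hsupp : forall t, supp d (y t)).
    { intros t k Hk. split.
      - rewrite (zero_derive_const (fun t => y t (iB k))); [rewrite Hy0; now apply Hs0|].
        intros r. eapply is_cderive_eq; [apply Hy|]. unfold F. simpl. destruct (lt_dec k d); [lia|auto].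
      - rewrite (zero_derive_const (fun t => y t (iG k))); [rewrite Hy0; now apply Hs0|].
        intros r. eapply is_cderive_eq; [apply Hy|]. unfold F. simpl. destruct (lt_dec k d); [lia|auto]. }
    assert (HYz : forall t j, y t (iY j) = 0%C).
    { intros t j. rewrite (zero_derive_const (fun t => y t (iY j))); [now rewrite Hy0|].
      intros r. apply Hy. }
    assert (Hreal : forall t, realg (y t)).
    { intros t k.
      apply Cminus_eq_0. rewrite (zero_derive_const (fun t => Cconj (y t (iG k)) - y t (iG k))%C).
        - rewrite Hy0, Hr0. ring.
        - intros r. eapply is_cderive_eq.
          + apply is_cderive_minus; [apply is_cderive_conj|]; apply Hy.
          + unfold F. destruct (live (iG k)); [|rewrite Cconj_R; ring].
            rewrite Cmult_conj, Cconj_R, tfield_G_real. ring. }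
    assert (Hcceq : forall t, 0 < chi (y t) -> forall i, cc (y t) i = y t i).
    { intros t Ht i. unfold cc. destruct (live i) eqn:E.
      - apply clip_near; auto.
        pose proof (lsum_In ix (fun i => Cmod (y t i - clip M (y t i))%C) i (fun i => Cmod_ge_0 _) (Hlive i E)) as H1.
        cbv beta in H1. unfold chi, Rmax in Ht. destruct (Rle_dec _ _); lra.
      - destruct i as [k|k|j]; simpl in E; [| |now rewrite HYz];
          destruct (lt_dec k d); try discriminate; symmetry; apply Hsupp; lia. }
    assert (HF : forall t i, (exists k, i = iB k \/ i = iG k) -> F t (y t) i = (RtoC (chi (y t)) * ev (tfield 0 i) (y t))%C).
    { intros t i Hi. unfold F.
      assert (Hl : live i = true \/ ev (tfield 0 i) (y t) = 0%C).
      { destruct Hi as [k Hk]. destruct (lt_dec k d) as [Hkd|Hkd].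
        - left. destruct Hk as [-> | ->]; simpl; destruct (lt_dec k d); auto.
        - right. destruct (tfield_cut d 0 (y t) k (Hsupp t)) as [E1 E2]; [lia|]. destruct Hk as [-> | ->]; auto. }
      destruct (live i) eqn:E.
      - destruct (Rle_lt_dec (chi (y t)) 0) as [H0|H0].
        + assert (Hz : chi (y t) = 0) by (specialize (Hchi1 (y t)); lra). rewrite Hz. ring.
        + f_equal. apply ev_ext. now apply Hcceq.
      - destruct Hl as [|Hl]; [discriminate|]. rewrite Hl. ring. }
    assert (Hden : forall s t, density d (y t) s = density d y0 s).
    { intros s t. rewrite (density_t_const d y (fun t => chi (y t)) s); auto.
      - unfold density. f_equal; f_equal; f_equal; [unfold fpol; f_equal|unfold bpol]; apply hpoly_ext; intros k _; apply Hy0.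
      - intros r k. eapply is_cderive_eq; [apply Hy|]. apply HF. exists k; auto.
      - intros r k. eapply is_cderive_eq; [apply Hy|]. apply HF. exists k; auto. }
    (* [M] was computed from the initial density, which the cut-off flow conserves; so the cut-off
       is never active. *)
    assert (Hchi : forall t, chi (y t) = 1).
    { intros t. unfold chi.
      rewrite (lsum_ext ix _ (fun _ => 0)).
      - rewrite lsum_const, Rmult_0_r, Rminus_0_r. apply Rmax_right. lra.
      - intros i Hi. apply in_ixP in Hi. destruct Hi as (k & _ & Hi).
        destruct (HMb (y t) (Hsupp t)) with (k := k) as [B1 B2]; [intros s; rewrite Hden; lra|].
        rewrite clip_id; [|destruct Hi as [-> | ->]; auto].
        replace (y t i - y t i)%C with (RtoC 0) by ring. apply Cmod_0. }
    exists y. split; [intros k; split; apply Hy0|].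
    split; [auto|split; [auto|]].
    split; [|split; [|auto]]; intros t k; (eapply is_cderive_eq; [apply Hy|]); rewrite HF by (exists k; auto);
      rewrite Hchi; ring.
Qed.

(** * Transport of the x-equations along the t-flow *)

Lemma dev_linear {I : Type} (p : pexp I) (y h g : I -> C) (e : R) :
  dev p y (fun i => h i - RtoC e * g i)%C = (dev p y h - RtoC e * dev p y g)%C.
Proof.
  induction p as [c|i|p IHp q IHq|p IHp q IHq|p IHp]; cbn [dev].
  - ring.
  - ring.
  - rewrite IHp, IHq. ring.
  - rewrite IHp, IHq. ring.
  - rewrite IHp, Cminus_conj, Cmult_conj, Cconj_R. ring.
Qed.

Lemma list_common_delta {I : Type} (ix : list I) (Q : I -> R -> Prop) :
  (forall i, In i ix -> exists delta, 0 < delta /\ forall e, Rabs e < delta -> Q i e) ->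
  exists delta, 0 < delta /\ forall i e, In i ix -> Rabs e < delta -> Q i e.
Proof.
  induction ix as [|j ix IH]; intros H.
  - exists 1; split; [lra|]. intros i e [].
  - destruct (H j (or_introl eq_refl)) as (d1 & Hd1 & H1).
    destruct IH as (d2 & Hd2 & H2); [intros; apply H; now right|].
    exists (Rmin d1 d2). split; [now apply Rmin_pos|].
    intros i e [<-|Hi] He.
    + apply H1. eapply Rlt_le_trans; [exact He|apply Rmin_l].
    + apply H2; auto. eapply Rlt_le_trans; [exact He|apply Rmin_r].
Qed.

Lemma Rle_quotient_half A eta : 0 <= A -> 0 < eta -> A * (eta / (1 + 2 * A)) ^ 2 <= eta ^ 2 / 2.
Proof.
  intros HA Heta.
  replace (A * (eta / (1 + 2 * A)) ^ 2) with (eta ^ 2 * (A / (1 + 2 * A) ^ 2)) by (field; lra).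
  assert (A / (1 + 2 * A) ^ 2 <= / 2).
  { apply Rdiv_le_mult; nra. }
  pose proof (pow2_ge_0 eta). nra.
Qed.

(* Both [h = y (x + e) - y x] and [e * X (y x)] solve, up to an error of order [e ^ 2],
   the equation linearised along the [t]-flow: for the second this is the commutation of [X] and [T]. *)
Theorem commuting_flow {I : Type} (ix : list I) (T X : I -> pexp I) (y : R -> R -> I -> C) :
  (forall x t i, is_cderive (fun s => y x s i) t (ev (T i) (y x t))) ->
  (forall x i, is_cderive (fun r => y r 0 i) x (ev (X i) (y x 0))) ->
  (forall x t i, dev (X i) (y x t) (fun j => ev (T j) (y x t)) = dev (T i) (y x t) (fun j => ev (X j) (y x t))) ->
  (forall x0 tau, exists M, forall x t i, Rabs (x - x0) <= 1 -> Rabs t <= tau -> Cmod (y x t i) <= M) ->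
  (forall x t i, ~ In i ix -> y x t i = 0%C /\ ev (X i) (y x t) = 0%C) ->
  forall x t i, is_cderive (fun r => y r t i) x (ev (X i) (y x t)).
Proof.
  intros HT HX Hcom Hbd Hcut x0 t0 i0.
  destruct (excluded_middle_informative (In i0 ix)) as [Hi0|Hi0].
  2:{ eapply is_cderive_eq. 2:{ symmetry; apply (Hcut x0 t0 i0 Hi0). }
      apply is_cderive_ext with (fun _ => 0%C); [intros r; symmetry; apply (Hcut r t0 i0 Hi0)|].
      apply is_cderive_const. }
  destruct (Hbd x0 (Rabs t0)) as (M & HM).
  assert (HM0 : 0 <= M).
  { eapply Rle_trans; [apply (Cmod_ge_0 (y x0 0 i0))|apply HM]; [rewrite Rminus_diag, Rabs_R0; lra|].
    rewrite Rabs_R0. apply Rabs_pos. }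
  destruct (ev_bound_list ix X M) as (KX & HKX & HXb).
  (* The radius covers y, y + h and y + W, the last being y (x + e) minus e X(y). *)
  destruct (ev_taylor_list ix T (3 * M + KX)) as (K & HK & HTb).
  set (N := INR (length ix)). assert (HN : 0 <= N) by apply pos_INR.
  set (E1 := exp ((2 * K * N + N + 1) * Rabs t0)).
  assert (HE1 : 0 < E1) by apply exp_pos.
  set (Q := N * (N * (KX + 1) ^ 2 * E1)).
  assert (HQ : 0 <= Q).
  { unfold Q. pose proof (pow2_ge_0 (KX + 1)).
    apply Rmult_le_pos; auto. apply Rmult_le_pos; [apply Rmult_le_pos; auto|lra]. }
  assert (Hy0 : forall t i, Rabs t <= Rabs t0 -> Cmod (y x0 t i) <= M).
  { intros; apply HM; auto. rewrite Rminus_diag, Rabs_R0; lra. }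
  assert (HXb0 : forall t i, Rabs t <= Rabs t0 -> Cmod (ev (X i) (y x0 t)) <= KX).
  { intros t i Ht. destruct (excluded_middle_informative (In i ix)) as [Hi|Hi].
    - apply (HXb i Hi). auto.
    - rewrite (proj2 (Hcut x0 t i Hi)), Cmod_0. auto. }
  set (h := fun e t i => (y (x0 + e)%R t i - y x0 t i)%C).
  set (W := fun e t i => (h e t i - RtoC e * ev (X i) (y x0 t))%C).
  assert (Hinit : forall eta, 0 < eta -> exists delta, 0 < delta /\
    forall i e, In i ix -> Rabs e < delta -> Cmod (W e 0 i) <= eta * Rabs e).
  { intros eta Heta. apply (list_common_delta ix (fun i e => Cmod (W e 0 i) <= eta * Rabs e)).
    intros i _. apply (proj1 (is_cderive_epsdelta (fun r => y r 0 i) x0 (ev (X i) (y x0 0))) (HX x0 i) eta Heta). }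
  assert (Hsupb : forall e t, Rabs e <= 1 -> (forall i, Cmod (h e t i) <= nrm ix (h e t)) /\ (forall i, Cmod (W e t i) <= nrm ix (W e t))).
  { intros e t He. split; intros i; destruct (excluded_middle_informative (In i ix)) as [Hi|Hi].
    - apply (lsum_In ix (fun i => Cmod (h e t i))); auto. intros; apply Cmod_ge_0.
    - unfold h at 1. rewrite (proj1 (Hcut (x0 + e) t i Hi)), (proj1 (Hcut x0 t i Hi)).
      replace (0 - 0)%C with (RtoC 0) by ring. rewrite Cmod_0. apply nrm_ge0.
    - apply (lsum_In ix (fun i => Cmod (W e t i))); auto. intros; apply Cmod_ge_0.
    - unfold W at 1, h at 1. rewrite (proj1 (Hcut (x0 + e) t i Hi)), (proj1 (Hcut x0 t i Hi)), (proj2 (Hcut x0 t i Hi)).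
      replace (0 - 0 - RtoC e * 0)%C with (RtoC 0) by ring. rewrite Cmod_0. apply nrm_ge0. }
  assert (Hye : forall e t i, Rabs e <= 1 -> Rabs t <= Rabs t0 -> Cmod (y (x0 + e) t i) <= M).
  { intros; apply HM; auto. replace (x0 + e - x0) with e by ring. auto. }
  assert (Hev : forall e t i, ev (T i) (y (x0 + e)%R t) = ev (T i) (fun j => y x0 t j + h e t j)%C).
  { intros. apply ev_ext. intros j. unfold h. ring. }
  destruct (Hinit 1 Rlt_0_1) as (d0 & Hd0 & Hin0).
  (* First Gronwall estimate: h = O(e) for |t| <= |t0|, from the initial size (KX + 1) |e|. *)
  assert (Hh : forall e, Rabs e < d0 -> Rabs e <= 1 -> forall t, Rabs t <= Rabs t0 ->
    nrm ix (h e t) * nrm ix (h e t) <= Q * e ^ 2).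
  { intros e He0 He t Ht.
    assert (G : nrm2 ix (h e t) <= (nrm2 ix (h e 0) + 0 ^ 2) * exp ((2 * K * N + N + 1) * Rabs t)).
    { apply (gronwall_system ix (h e) (fun t i => ev (T i) (y (x0 + e)%R t) - ev (T i) (y x0 t))%C K 0 t); auto; [lra| |].
      - intros r i _ _. apply is_cderive_minus; apply HT.
      - intros r i Hr Hi. rewrite Rplus_0_r, Hev.
        apply (HTb i Hi (y x0 r) (h e r) (nrm ix (h e r))).
        + apply nrm_ge0.
        + intros j. specialize (Hy0 r j ltac:(lra)). lra.
        + intros j. replace (y x0 r j + h e r j)%C with (y (x0 + e)%R r j) by (unfold h; ring).
          specialize (Hye e r j He ltac:(lra)). lra.
        + apply (Hsupb e r He). }
    replace (0 ^ 2) with 0 in G by ring. rewrite Rplus_0_r in G.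
    assert (G0 : nrm2 ix (h e 0) <= N * ((KX + 1) ^ 2 * e ^ 2)).
    { unfold nrm2, N. rewrite <- lsum_const. apply lsum_le. intros i Hi.
      rewrite <- Rpow_mult_distr, <- (pow2_abs ((KX + 1) * e)). apply pow_incr. split; [apply Cmod_ge_0|].
      rewrite Rabs_mult, (Rabs_right (KX + 1)) by lra.
      replace (h e 0 i) with (W e 0 i + RtoC e * ev (X i) (y x0 0))%C by (unfold W; ring).
      eapply Rle_trans; [apply Cmod_triangle|]. rewrite Cmod_mult, Cmod_R.
      specialize (Hin0 i e Hi He0). specialize (HXb0 0 i). rewrite Rabs_R0 in HXb0. specialize (HXb0 (Rabs_pos t0)).
      pose proof (Rabs_pos e). nra. }
    eapply Rle_trans; [apply nrm_sq_le|]. fold N.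
    assert (HEt : exp ((2 * K * N + N + 1) * Rabs t) <= E1).
    { apply exp_le_compat, Rmult_le_compat_l; [|auto]. assert (0 <= K * N) by nra. lra. }
    replace (Q * e ^ 2) with (N * (N * ((KX + 1) ^ 2 * e ^ 2) * E1)) by (unfold Q; ring).
    apply Rmult_le_compat_l; auto. eapply Rle_trans; [exact G|].
    apply Rmult_le_compat; auto; [apply nrm2_ge0|left; apply exp_pos]. }
  apply is_cderive_epsdelta. intros eta Heta.
  (* [A1] and [A2] multiply the contributions of the initial error and of the Taylor remainder; by
     [Rle_quotient_half] each is kept below eta^2 / 2. *)
  set (A1 := N * E1). assert (HA1 : 0 <= A1) by (unfold A1; nra).
  set (A2 := (K * Q) ^ 2 * E1). assert (HA2 : 0 <= A2).
  { unfold A2. pose proof (pow2_ge_0 (K * Q)). nra. }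
  assert (Het1 : 0 < eta / (1 + 2 * A1)) by (apply Rdiv_lt_0_compat; lra).
  assert (Het2 : 0 < eta / (1 + 2 * A2)) by (apply Rdiv_lt_0_compat; lra).
  destruct (Hinit _ Het1) as (d1 & Hd1 & Hin1).
  exists (Rmin (Rmin d0 d1) (Rmin 1 (eta / (1 + 2 * A2)))).
  split; [repeat apply Rmin_pos; auto; lra|].
  intros e He.
  assert (He0 : Rabs e < d0) by (eapply Rlt_le_trans; [exact He|]; eapply Rle_trans; apply Rmin_l).
  assert (He1 : Rabs e < d1) by (eapply Rlt_le_trans; [exact He|]; eapply Rle_trans; [apply Rmin_l|apply Rmin_r]).
  assert (He2 : Rabs e < 1) by (eapply Rlt_le_trans; [exact He|]; eapply Rle_trans; [apply Rmin_r|apply Rmin_l]).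
  assert (He3 : Rabs e < eta / (1 + 2 * A2)) by (eapply Rlt_le_trans; [exact He|]; eapply Rle_trans; [apply Rmin_r|apply Rmin_r]).
  change (Cmod (W e t0 i0) <= eta * Rabs e).
  (* Second Gronwall estimate. Commutation turns the t-derivative of X(y) into the linearised field
     applied to X(y), so W satisfies the linearised equation up to K Q e^2. *)
  assert (G : nrm2 ix (W e t0) <= (nrm2 ix (W e 0) + (K * (Q * e ^ 2)) ^ 2) * E1).
  { unfold E1, N.
    apply (gronwall_system ix (W e)
      (fun t i => (ev (T i) (y (x0 + e)%R t) - ev (T i) (y x0 t)) - RtoC e * dev (X i) (y x0 t) (fun j => ev (T j) (y x0 t)))%C
      K (K * (Q * e ^ 2)) t0); auto.
    - apply Rmult_le_pos; auto. pose proof (pow2_ge_0 e). nra.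
    - intros r i _ _. apply is_cderive_minus; [apply is_cderive_minus; apply HT|].
      apply is_cderive_mult_const. apply ev_derive. intros j. apply HT.
    - intros r i Hr Hi. rewrite Hcom, Hev.
      replace (ev (T i) (fun j => y x0 r j + h e r j)%C - ev (T i) (y x0 r)
               - RtoC e * dev (T i) (y x0 r) (fun j => ev (X j) (y x0 r)))%C
        with ((ev (T i) (fun j => y x0 r j + h e r j)%C - ev (T i) (y x0 r) - dev (T i) (y x0 r) (h e r))
              + (dev (T i) (y x0 r) (h e r) - RtoC e * dev (T i) (y x0 r) (fun j => ev (X j) (y x0 r))))%C by ring.
      rewrite <- dev_linear. fold (W e r).
      eapply Rle_trans; [apply Cmod_triangle|]. rewrite Rplus_comm. apply Rplus_le_compat.
      + apply (HTb i Hi (y x0 r) (W e r) (nrm ix (W e r))).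
        * apply nrm_ge0.
        * intros j. specialize (Hy0 r j ltac:(lra)). lra.
        * intros j. replace (y x0 r j + W e r j)%C with (y (x0 + e)%R r j + - (RtoC e * ev (X j) (y x0 r)))%C
            by (unfold W, h; ring).
          eapply Rle_trans; [apply Cmod_triangle|]. rewrite Cmod_opp, Cmod_mult, Cmod_R.
          specialize (Hye e r j ltac:(lra) ltac:(lra)). specialize (HXb0 r j ltac:(lra)).
          assert (Rabs e * Cmod (ev (X j) (y x0 r)) <= 1 * KX).
          { apply Rmult_le_compat; try lra; [apply Rabs_pos|apply Cmod_ge_0]. }
          lra.
        * apply (Hsupb e r). lra.
      + eapply Rle_trans.
        * apply (HTb i Hi (y x0 r) (h e r) (nrm ix (h e r))).
          -- apply nrm_ge0.
          -- intros j. specialize (Hy0 r j ltac:(lra)). lra.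
          -- intros j. replace (y x0 r j + h e r j)%C with (y (x0 + e)%R r j) by (unfold h; ring).
             specialize (Hye e r j ltac:(lra) ltac:(lra)). lra.
          -- apply (Hsupb e r). lra.
        * apply Rmult_le_compat_l; auto. apply Hh; lra. }
  assert (G0 : nrm2 ix (W e 0) <= N * ((eta / (1 + 2 * A1)) ^ 2 * e ^ 2)).
  { unfold nrm2, N. rewrite <- lsum_const. apply lsum_le. intros i Hi.
    rewrite <- Rpow_mult_distr, <- (pow2_abs (_ * e)). apply pow_incr. split; [apply Cmod_ge_0|].
    rewrite Rabs_mult, (Rabs_right (eta / (1 + 2 * A1))) by lra. auto. }
  assert (G1 : Cmod (W e t0 i0) ^ 2 <= nrm2 ix (W e t0)).
  { apply (lsum_In ix (fun i => Cmod (W e t0 i) ^ 2)); auto. intros; apply pow2_ge_0. }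
  pose proof (Rle_quotient_half A1 eta HA1 Heta) as R1.
  pose proof (Rle_quotient_half A2 eta HA2 Heta) as R2.
  assert (He2p : e ^ 2 <= (eta / (1 + 2 * A2)) ^ 2).
  { rewrite <- (pow2_abs e). apply pow_incr. split; [apply Rabs_pos|lra]. }
  assert (Fin : Cmod (W e t0 i0) ^ 2 <= (eta * Rabs e) ^ 2).
  { rewrite Rpow_mult_distr, pow2_abs.
    apply Rle_trans with ((N * ((eta / (1 + 2 * A1)) ^ 2 * e ^ 2) + (K * (Q * e ^ 2)) ^ 2) * E1).
    - eapply Rle_trans; [exact G1|]. eapply Rle_trans; [exact G|]. apply Rmult_le_compat_r; lra.
    - replace ((N * ((eta / (1 + 2 * A1)) ^ 2 * e ^ 2) + (K * (Q * e ^ 2)) ^ 2) * E1)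
        with ((A1 * (eta / (1 + 2 * A1)) ^ 2 + A2 * e ^ 2) * e ^ 2) by (unfold A1, A2; ring).
      apply Rmult_le_compat_r; [apply pow2_ge_0|].
      assert (A2 * e ^ 2 <= A2 * (eta / (1 + 2 * A2)) ^ 2) by (apply Rmult_le_compat_l; auto). lra. }
  apply Rsqr_incr_0_var.
  - unfold Rsqr. lra.
  - apply Rmult_le_pos; [lra|apply Rabs_pos].
Qed.

(** Glues a vector solution onto a coefficient state, so that both evolve under one field. *)
Definition with_vector (p : idx -> C) (w : bool -> C) (i : idx) : C := match i with iY j => w j | _ => p i end.

Definition bools : list bool := false :: true :: nil.

Lemma in_bools j : In j bools.
Proof. destruct j; simpl; auto. Qed.

(** The field is linear in the vector, with coefficients [c1] and [c2] bounded through the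
    coefficient state; hence a global Lipschitz bound. *)
Lemma tfield_Y_bound z M : exists K, 0 <= K /\ forall p w w' j, (forall i, Cmod (p i) <= M) ->
  Cmod (ev (tfield z (iY j)) (with_vector p w) - ev (tfield z (iY j)) (with_vector p w'))%C <= K * nrm bools (fun j => w j - w' j)%C.
Proof.
  set (c1 := fun j : bool => if j then PAdd (PMul (PCst (2 * z)%C) (PConj (PVar (iB 0)))) (PMul (PCst (- Ci)%C) (PConj pvx))
             else PAdd (PCst (- (2 * Ci * z * z))%C) (PMul (PCst Ci) pabs2)).
  set (c2 := fun j : bool => if j then PAdd (PCst (2 * Ci * z * z)%C) (PMul (PCst (- Ci)%C) pabs2)
             else PAdd (PMul (PCst (- (2 * z))%C) (PVar (iB 0))) (PMul (PCst (- Ci)%C) pvx)).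
  destruct (ev_bound_list bools c1 M) as (K1 & HK1 & H1).
  destruct (ev_bound_list bools c2 M) as (K2 & HK2 & H2).
  exists (K1 + K2). split; [lra|]. intros p w w' j Hp.
  replace (ev (tfield z (iY j)) (with_vector p w) - ev (tfield z (iY j)) (with_vector p w'))%C
    with (ev (c1 j) p * (w false - w' false) + ev (c2 j) p * (w true - w' true))%C
    by (destruct j; cbn [ev tfield c1 c2 with_vector pvx pabs2]; ring).
  eapply Rle_trans; [apply Cmod_triangle|]. rewrite !Cmod_mult.
  pose proof (H1 j (in_bools j) p Hp) as B1. pose proof (H2 j (in_bools j) p Hp) as B2.
  unfold nrm, bools. rewrite !lsum_cons. unfold lsum; simpl fold_right.
  pose proof (Cmod_ge_0 (w false - w' false)%C). pose proof (Cmod_ge_0 (w true - w' true)%C).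
  pose proof (Cmod_ge_0 (ev (c1 j) p)). pose proof (Cmod_ge_0 (ev (c2 j) p)). nra.
Qed.

Lemma tfield_Y_zero z p j : ev (tfield z (iY j)) (with_vector p (fun _ => 0%C)) = 0%C.
Proof. destruct j; cbn [ev tfield with_vector]; ring. Qed.

Lemma tflow_linear z M (p : R -> idx -> C) (w0 : bool -> C) :
  (forall t i, Cmod (p t i) <= M) -> (forall i t, continuous (fun s => p s i) t) ->
  exists w : R -> bool -> C, (forall j, w 0 j = w0 j) /\
    forall j t, is_cderive (fun s => w s j) t (ev (tfield z (iY j)) (with_vector (p t) (w t))).
Proof.
  intros Hp Hc. destruct (tfield_Y_bound z M) as (K & HK & HH).
  apply (picard_lindelof bools (fun t w j => ev (tfield z (iY j)) (with_vector (p t) w)) w0 K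
    (K * nrm bools (fun j => w0 j - 0)%C)); auto.
  - intros s j. specialize (HH (p s) w0 (fun _ => 0%C) j (Hp s)). rewrite tfield_Y_zero in HH.
    replace (ev (tfield z (iY j)) (with_vector (p s) w0)) with (ev (tfield z (iY j)) (with_vector (p s) w0) - 0)%C by ring. exact HH.
  - intros w Hw j s. apply (ev_continuous (tfield z (iY j)) (fun t => with_vector (p t) (w t))).
    intros [k|k|i]; cbn [with_vector]; auto.
Qed.

(** [commuting_flow] for the glued state: at later [t] the coefficients still obey the x-equations,
    and the vector still solves the Dirac system, now for the evolved potential. *)
Theorem joint_flow d M (p : R -> R -> idx -> C) (u : R -> C) :
  (forall x t, supp d (p x t)) -> (forall x t, realg (p x t)) -> (forall x t i, Cmod (p x t i) <= M) ->
  (forall x t k, is_cderive (fun s => p x s (iB k)) t (ev (tfield 0 (iB k)) (p x t))) ->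
  (forall x t k, is_cderive (fun s => p x s (iG k)) t (ev (tfield 0 (iG k)) (p x t))) ->
  (forall x t j, p x t (iY j) = 0%C) ->
  (forall x k, is_cderive (fun r => p r 0 (iB k)) x (ev (xfield 0 (iB k)) (p x 0))) ->
  (forall x k, is_cderive (fun r => p r 0 (iG k)) x (ev (xfield 0 (iG k)) (p x 0))) ->
  (forall x, p x 0 (iB 0) = u x) ->
  forall z y1 y2, dirac_ode u z y1 y2 ->
  exists w : R -> R -> bool -> C,
    (forall x, w x 0 false = y1 x /\ w x 0 true = y2 x) /\
    (forall x t j, is_cderive (fun s => w x s j) t (ev (tfield z (iY j)) (with_vector (p x t) (w x t)))) /\
    (forall t, dirac_ode (fun x => p x t (iB 0)) z (fun x => w x t false) (fun x => w x t true)) /\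
    (forall x t k, is_cderive (fun r => p r t (iB k)) x (ev (xfield 0 (iB k)) (p x t))) /\
    (forall x t k, is_cderive (fun r => p r t (iG k)) x (ev (xfield 0 (iG k)) (p x t))).
Proof.
  intros Hs Hr HM HtB HtG HY HxB HxG Hu z y1 y2 [D1 D2].
  assert (Hcp : forall x i t, continuous (fun s => p x s i) t).
  { intros x [k|k|j] t.
    - eapply is_cderive_continuous, HtB.
    - eapply is_cderive_continuous, HtG.
    - apply (continuous_ext (fun _ : R => RtoC 0)); [intros; symmetry; apply HY|apply continuous_const]. }
  assert (Hw : forall x, exists w : R -> bool -> C, (forall j, w 0 j = if j then y2 x else y1 x) /\
    forall j t, is_cderive (fun s => w s j) t (ev (tfield z (iY j)) (with_vector (p x t) (w t)))).
  { intros x. apply (tflow_linear z M (p x) (fun j => if j then y2 x else y1 x)); auto. }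
  set (w := fun x => proj1_sig (constructive_indefinite_description _ (Hw x))).
  assert (Ew : forall x, (forall j, w x 0 j = if j then y2 x else y1 x) /\
    forall j t, is_cderive (fun s => w x s j) t (ev (tfield z (iY j)) (with_vector (p x t) (w x t)))).
  { intros x. unfold w. destruct (constructive_indefinite_description _ (Hw x)); auto. }
  clearbody w. clear Hw.
  set (y := fun x t => with_vector (p x t) (w x t)).
  destruct (tfield_Y_bound z M) as (K & HK & HKb).
  assert (Hflow : forall x t i, is_cderive (fun r => y r t i) x (ev (xfield z i) (y x t))).
  { apply (commuting_flow (ixP d ++ iY false :: iY true :: nil) (tfield z) (xfield z) y).
    - intros x t [k|k|j].
      + apply (HtB x t k).
      + apply (HtG x t k).
      + apply (proj2 (Ew x)).
    - intros x [k|k|[|]].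
      + apply (HxB x k).
      + apply (HxG x k).
      + apply is_cderive_ext with y2; [intros r; symmetry; apply (proj1 (Ew r) true)|].
        eapply is_cderive_eq; [apply D2|]. cbn [ev xfield y with_vector].
        rewrite !(proj1 (Ew x)), Hu. ring.
      + apply is_cderive_ext with y1; [intros r; symmetry; apply (proj1 (Ew r) false)|].
        eapply is_cderive_eq; [apply D1|]. cbn [ev xfield y with_vector].
        rewrite !(proj1 (Ew x)), Hu. ring.
    - intros x t i. apply fields_commute. intros k. apply (Hr x t k).
    (* The coefficients are bounded by [M], the vector by Gronwall in t from its initial values near
       [x0]. *)
    - intros x0 tau.
      destruct (continuous_bounded y1 (Rabs x0 + 1)) as (V1 & HV1 & B1). { intros r; eapply is_cderive_continuous, D1. }
      destruct (continuous_bounded y2 (Rabs x0 + 1)) as (V2 & HV2 & B2). { intros r; eapply is_cderive_continuous, D2. }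
      set (k := 2 * K * INR (length bools) + INR (length bools) + 1).
      assert (Hk : 0 <= k). { unfold k. simpl. lra. }
      set (B := (V1 ^ 2 + V2 ^ 2) * exp (k * Rabs tau)).
      exists (M + (B + 1)). intros x t i Hx Ht.
      assert (HB : 0 <= B).
      { unfold B. apply Rmult_le_pos; [|left; apply exp_pos]. pose proof (pow2_ge_0 V1). pose proof (pow2_ge_0 V2). lra. }
      assert (HM0 : 0 <= M). { eapply Rle_trans; [apply Cmod_ge_0|apply (HM x t (iB 0))]. }
      assert (Hx' : Rabs x <= Rabs x0 + 1).
      { replace x with ((x - x0) + x0) by ring. eapply Rle_trans; [apply Rabs_triang|]. lra. }
      assert (G : nrm2 bools (w x t) <= (nrm2 bools (w x 0) + 0 ^ 2) * exp (k * Rabs t)).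
      { apply (gronwall_system bools (w x) (fun t j => ev (tfield z (iY j)) (with_vector (p x t) (w x t))) K 0 t); auto; [lra| |].
        - intros r j _ _. apply (proj2 (Ew x)).
        - intros r j _ _. rewrite Rplus_0_r.
          specialize (HKb (p x r) (w x r) (fun _ => 0%C) j (HM x r)). rewrite tfield_Y_zero in HKb.
          replace (ev (tfield z (iY j)) (with_vector (p x r) (w x r))) with (ev (tfield z (iY j)) (with_vector (p x r) (w x r)) - 0)%C by ring.
          eapply Rle_trans; [exact HKb|]. apply Rmult_le_compat_l; auto. apply lsum_le. intros i0 _.
          replace (w x r i0 - 0)%C with (w x r i0) by ring. lra. }
      assert (G0 : nrm2 bools (w x 0) + 0 ^ 2 <= V1 ^ 2 + V2 ^ 2).
      { unfold nrm2, bools. rewrite !lsum_cons. unfold lsum; simpl fold_right. rewrite !(proj1 (Ew x)).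
        assert (Cmod (y1 x) ^ 2 <= V1 ^ 2) by (apply pow_incr; split; [apply Cmod_ge_0|auto]).
        assert (Cmod (y2 x) ^ 2 <= V2 ^ 2) by (apply pow_incr; split; [apply Cmod_ge_0|auto]). lra. }
      assert (G2 : nrm2 bools (w x t) <= B).
      { eapply Rle_trans; [exact G|]. unfold B. apply Rmult_le_compat; auto.
        - pose proof (nrm2_ge0 bools (w x 0)). lra.
        - left; apply exp_pos.
        - apply exp_le_compat, Rmult_le_compat_l; auto. eapply Rle_trans; [exact Ht|apply Rle_abs]. }
      destruct i as [j|j|j]; cbn [y with_vector].
      + specialize (HM x t (iB j)). lra.
      + specialize (HM x t (iG j)). lra.
      + assert (Cmod (w x t j) ^ 2 <= B).
        { eapply Rle_trans; [|exact G2]. apply (lsum_In bools (fun j => Cmod (w x t j) ^ 2)); [intros; apply pow2_ge_0|apply in_bools]. }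
        pose proof (pow2_ge_0 (Cmod (w x t j) - 1)). nra.
    - intros x t i Hi.
      assert (Hi' : exists k, (d <= k)%nat /\ (i = iB k \/ i = iG k)).
      { destruct i as [k|k|j].
        - exists k. split; auto. apply Nat.nlt_ge. intros Hk. apply Hi. apply in_app_iff. left. apply in_ixP. exists k; auto.
        - exists k. split; auto. apply Nat.nlt_ge. intros Hk. apply Hi. apply in_app_iff. left. apply in_ixP. exists k; auto.
        - exfalso. apply Hi. apply in_app_iff. right. destruct j; simpl; auto. }
      destruct Hi' as (k & Hk & Hik).
      destruct (Hs x t k Hk) as [E1 E2]. destruct (Hs x t (S k) ltac:(lia)) as [E3 _].
      destruct Hik as [-> | ->]; cbn [y with_vector ev xfield]; rewrite ?E1, ?E2, ?E3, ?(Cconj_R 0); split; auto; ring. }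
  exists w. split; [|split; [|split; [|split]]].
  - intros x. split; apply (proj1 (Ew x)).
  - intros x t j. apply (proj2 (Ew x)).
  - intros t. split; intros x; (eapply is_cderive_eq; [apply (Hflow x t (iY _))|]); cbn [ev xfield y with_vector]; ring.
  - intros x t k. apply (Hflow x t (iB k)).
  - intros x t k. apply (Hflow x t (iG k)).
Qed.

(** * Uniqueness for the periodic Cauchy problem *)

Lemma continuity_2d_bounded (f : R -> R -> R) (A : R) :
  (forall x y, continuity_2d_pt f x y) ->
  exists B, forall x y, Rabs x <= A -> Rabs y <= A -> Rabs (f x y) <= B.
Proof.
  intros Hf.
  assert (Hd : forall x y, exists d : posreal, forall u v, Rabs (u - x) < d -> Rabs (v - y) < d -> Rabs (f u v - f x y) < 1).
  { intros x y. destruct (Hf x y (mkposreal 1 Rlt_0_1)) as [d Hd]. exists d. exact Hd. }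
  set (delta := fun p : Compactness.Tn 2 R =>
    proj1_sig (constructive_indefinite_description _ (Hd (fst p) (fst (snd p))))).
  (* The covering lemma is doubly negated and needs the goal False. *)
  apply NNPP. intros Hno.
  apply (compactness_list 2 (- A, (- A, tt)) (A, (A, tt)) delta). intros [ls Hls].
  apply Hno. clear Hno.
  assert (HB : exists B, forall p, In p ls -> Rabs (f (fst p) (fst (snd p))) <= B).
  { clear Hls. induction ls as [|p ls [B HB]].
    - exists 0. intros p [].
    - exists (Rmax B (Rabs (f (fst p) (fst (snd p))))). intros q [<-|Hq]; [apply Rmax_r|].
      eapply Rle_trans; [apply HB; auto|apply Rmax_l]. }
  destruct HB as [B HB]. exists (B + 1). intros x y Hx Hy.
  apply Rabs_le_between in Hx. apply Rabs_le_between in Hy.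
  destruct (Hls (x, (y, tt))) as (p & Hp & _ & Hclose).
  { simpl. auto. }
  specialize (HB p Hp).
  assert (K : Rabs (f x y - f (fst p) (fst (snd p))) < 1).
  { unfold delta in Hclose. destruct (constructive_indefinite_description _ (Hd (fst p) (fst (snd p)))) as [d Hdd].
    destruct p as [p1 [p2 []]]. simpl in *. apply Hdd; tauto. }
  replace (f x y) with ((f x y - f (fst p) (fst (snd p))) + f (fst p) (fst (snd p))) by ring.
  eapply Rle_trans; [apply Rabs_triang|]. lra.
Qed.

(** The order is swapped because differentiation under the integral over x takes the parameter t
    first. *)
Lemma continuity_2d_swap_fst (v : R -> R -> C) x t :
  continuous (fun p : R * R => v (fst p) (snd p)) (x, t) -> continuity_2d_pt (fun t x => fst (v x t)) t x.
Proof.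
  intros H eps. destruct (H _ (locally_ball _ eps)) as [d Hd]. exists d. intros s y Hs Hy.
  destruct (Hd (y, s)) as [B _]; [split; assumption|]. exact B.
Qed.

Lemma continuity_2d_swap_snd (v : R -> R -> C) x t :
  continuous (fun p : R * R => v (fst p) (snd p)) (x, t) -> continuity_2d_pt (fun t x => snd (v x t)) t x.
Proof.
  intros H eps. destruct (H _ (locally_ball _ eps)) as [d Hd]. exists d. intros s y Hs Hy.
  destruct (Hd (y, s)) as [_ B]; [split; assumption|]. exact B.
Qed.

Lemma continuous_2d_bounded (v : R -> R -> C) (A : R) :
  (forall x t, continuous (fun p : R * R => v (fst p) (snd p)) (x, t)) ->
  exists B, forall x t, Rabs x <= A -> Rabs t <= A -> Cmod (v x t) <= B.
Proof.
  intros Hv.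
  destruct (continuity_2d_bounded (fun t x => fst (v x t)) A) as [B1 H1].
  { intros t x. now apply continuity_2d_swap_fst. }
  destruct (continuity_2d_bounded (fun t x => snd (v x t)) A) as [B2 H2].
  { intros t x. now apply continuity_2d_swap_snd. }
  exists (B1 + B2). intros x t Hx Ht. eapply Rle_trans; [apply Cmod_le_sum|].
  specialize (H1 t x Ht Hx). specialize (H2 t x Ht Hx). simpl in *. lra.
Qed.

(** The primitive is nondecreasing, 0 at [a] and at most 0 at [b], hence constant, and [g] is its
    derivative. *)
Lemma integral_zero_pointwise (g : R -> R) a b x :
  (forall y, continuous g y) -> (forall y, 0 <= g y) -> a < x < b -> RInt g a b <= 0 -> g x = 0.
Proof.
  intros Hc Hpos Hx Hint.
  set (F := fun y => RInt g a y).
  assert (HF : forall y, is_derive F y (g y)).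
  { intros y. apply (is_derive_RInt g F a y); auto.
    exists (mkposreal 1 Rlt_0_1); intros r _. apply (@RInt_correct R_CompleteNormedModule).
    apply (@ex_RInt_continuous R_CompleteNormedModule); auto. }
  assert (Hmon : forall p q, p <= q -> F p <= F q).
  { intros p q Hpq. assert (- F q <= - F p); [|lra].
    apply (derive_nonpos_decr (fun s => - F s) (fun s => - g s)); auto.
    - intros s _. now apply (is_derive_opp F).
    - intros s _. specialize (Hpos s). lra. }
  assert (Fa : F a = 0) by exact (RInt_point a g).
  assert (Hz : forall y, a <= y <= b -> F y = 0).
  { intros y Hy. pose proof (Hmon a y (proj1 Hy)). pose proof (Hmon y b (proj2 Hy)). unfold F in *. lra. }
  rewrite <- (is_derive_unique F x (g x) (HF x)).
  apply is_derive_unique.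
  apply (is_derive_ext_loc (fun _ => 0) F x).
  - assert (Hd : 0 < Rmin (x - a) (b - x)) by (apply Rmin_pos; lra).
    exists (mkposreal _ Hd). intros y Hy. symmetry. apply Hz.
    unfold ball in Hy; simpl in Hy; unfold AbsRing_ball, abs, minus, plus, opp in Hy; simpl in Hy.
    pose proof (Rmin_l (x - a) (b - x)). pose proof (Rmin_r (x - a) (b - x)).
    apply Rabs_lt_between in Hy. lra.
  - exact (is_derive_const (K := R_AbsRing) (V := R_NormedModule) 0 x).
Qed.

Lemma periodic_derive (l : R) (f df : R -> C) :
  (forall x, f (x + l) = f x) -> (forall x, is_cderive f x (df x)) -> forall x, df (x + l) = df x.
Proof.
  intros Hp Hd x. apply (is_cderive_unique f x); auto.
  apply is_cderive_ext with (fun t => f (t + l)); auto.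
  now apply is_cderive_comp_shift.
Qed.

Lemma Cmod_sq_lip (a b : C) : Rabs (Cmod a ^ 2 - Cmod b ^ 2) <= (Cmod a + Cmod b) * Cmod (a - b)%C.
Proof.
  pose proof (Cmod_ge_0 a). pose proof (Cmod_ge_0 b).
  pose proof (Cmod_triangle (a - b) b) as T1. pose proof (Cmod_triangle (- (a - b)) a) as T2.
  replace (a - b + b)%C with a in T1 by ring. replace (- (a - b) + a)%C with b in T2 by ring.
  rewrite Cmod_opp in T2. apply Rabs_le. nra.
Qed.

(* [L^2] energy estimate for the difference of two solutions over one period. *)
Theorem nls_unique (l : R) (u : R -> C) (v w : R -> R -> C) :
  0 < l -> nls_solution l u v -> nls_solution l u w -> forall x t, w x t = v x t.
Proof.
  intros Hl (Pv & (vx & vxx & vt & Dv1 & Dv2 & Dv3 & Cv & Cv1 & Cv2 & Cv3 & Ev) & Iv)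
    (Pw & (wx & wxx & wt & Dw1 & Dw2 & Dw3 & Cw & Cw1 & Cw2 & Cw3 & Ew) & Iw) x0 t0.
  (* A period centred at [x0], which makes [x0] an interior point. *)
  set (a := x0 - l / 2). set (b := x0 + l / 2).
  assert (Hab : a < b) by (unfold a, b; lra).
  assert (Eb : b = a + l) by (unfold a, b; field).
  set (D := fun x t => (w x t - v x t)%C).
  set (Dx := fun x t => (wx x t - vx x t)%C).
  set (Dxx := fun x t => (wxx x t - vxx x t)%C).
  set (Dt := fun x t => (wt x t - vt x t)%C).
  set (g := fun t x => Cmod (D x t) ^ 2).
  set (G := fun t x => 2 * Re (Cconj (D x t) * Dt x t)).
  assert (Hg : forall t x, is_derive (fun s => g s x) t (G t x)).
  { intros t x. apply (is_derive_Cmod2 (fun s => D x s)). apply is_cderive_minus; auto. }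
  assert (HGc : forall t x, continuity_2d_pt G t x).
  { intros t x.
    apply continuity_2d_pt_ext with (fun t x =>
      2 * ((fst (w x t) - fst (v x t)) * (fst (wt x t) - fst (vt x t)) + (snd (w x t) - snd (v x t)) * (snd (wt x t) - snd (vt x t)))).
    { intros s y. unfold G, D, Dt, Re. simpl. ring. }
    apply continuity_2d_pt_mult; [apply continuity_2d_pt_const|].
    apply continuity_2d_pt_plus; apply continuity_2d_pt_mult; apply continuity_2d_pt_minus;
      try (now apply continuity_2d_swap_fst); now apply continuity_2d_swap_snd. }
  assert (Cx : forall f : R -> R -> C, (forall x t, continuous (fun p : R * R => f (fst p) (snd p)) (x, t)) ->
     forall t x, continuous (fun y => f y t) x).
  { intros f Hf t x. apply (continuous_comp (fun y => (y, t)) (fun p : R * R => f (fst p) (snd p))); auto.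
    intros P [eps HP]. exists eps. intros y Hy. apply HP. split; [exact Hy|apply ball_center]. }
  assert (CD : forall t x, continuous (fun y => D y t) x).
  { intros t x. unfold D. eapply is_cderive_continuous, is_cderive_minus; auto. }
  assert (Cre : forall (f : R -> C) x, continuous f x -> continuous (fun y => Re (f y)) x).
  { intros f x Hf. now apply continuous_C_iff in Hf. }
  assert (Cgx : forall t x, continuous (g t) x).
  { intros t x. apply (continuous_ext (fun y => Re (Cconj (D y t) * D y t))).
    - intros y. unfold g. rewrite Cmod2_alt. unfold Re, Im. simpl. ring.
    - apply Cre. apply continuous_Cmult; [apply continuous_Cconj|]; apply CD. }
  assert (CDt : forall t x, continuous (fun y => Dt y t) x).
  { intros t x. apply (continuous_Cminus (fun y => wt y t) (fun y => vt y t)); now apply Cx. }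
  assert (CDxx : forall t x, continuous (fun y => Dxx y t) x).
  { intros t x. apply (continuous_Cminus (fun y => wxx y t) (fun y => vxx y t)); now apply Cx. }
  assert (CGx : forall t x, continuous (G t) x).
  { intros t x. unfold G. apply (continuous_scal_r 2 (fun y => Re (Cconj (D y t) * Dt y t))).
    apply Cre. apply continuous_Cmult; [apply continuous_Cconj, CD|apply CDt]. }
  assert (exR : forall f : R -> R, (forall x, continuous f x) -> ex_RInt f a b).
  { intros f Hf. apply (@ex_RInt_continuous R_CompleteNormedModule); auto. }
  assert (He : forall t, is_derive (fun s => RInt (g s) a b) t (RInt (G t) a b)).
  { intros t.
    replace (RInt (G t) a b) with (RInt (fun x => Derive (fun s => g s x) t) a b).
    2:{ apply RInt_ext. intros x _. now apply is_derive_unique. }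
    apply (is_derive_RInt_param g a b t).
    - exists (mkposreal 1 Rlt_0_1). intros s _ x _. eexists; apply Hg.
    - intros x _. apply continuity_2d_pt_ext with G; [|apply HGc].
      intros s y. symmetry. now apply is_derive_unique.
    - exists (mkposreal 1 Rlt_0_1). intros s _. now apply exR. }
  set (A := Rabs t0 + Rabs x0 + l).
  assert (HA : forall x, a <= x <= b -> Rabs x <= A).
  { intros x Hx. unfold A, a, b in *. pose proof (Rle_abs x0). pose proof (Rle_abs (- x0)). rewrite Rabs_Ropp in *.
    pose proof (Rabs_pos t0). apply Rabs_le. lra. }
  destruct (continuous_2d_bounded v A Cv) as [Bv HBv]. destruct (continuous_2d_bounded w A Cw) as [Bw HBw].
  (* The cubic difference is at most 3 B^2 |D|: B^2 from |w|^2 D and 2 B^2 from (|w|^2 - |v|^2) v.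
     The factor 4 combines the 2 of the derivative of a square with the 2 of the equation. *)
  set (B := Rabs Bv + Rabs Bw). set (k := 4 * (3 * B * B)).
  assert (HB0 : 0 <= B) by (unfold B; pose proof (Rabs_pos Bv); pose proof (Rabs_pos Bw); lra).
  (* The flux of the dispersive term: [dH] equals 2 Re (i conj D D_xx), as i |D_x|^2 is imaginary,
     and integrates to 0 over a period. *)
  set (H := fun t x => 2 * Re (Ci * (Cconj (D x t) * Dx x t))).
  set (dH := fun t x => 2 * Re (Ci * (Cconj (Dx x t) * Dx x t + Cconj (D x t) * Dxx x t))).
  assert (HdH : forall t x, is_derive (H t) x (dH t x)).
  { intros t x. unfold H, dH. apply is_derive_scal.
    apply (is_cderive_iff (fun x => Ci * (Cconj (D x t) * Dx x t))%C x (Ci * (Cconj (Dx x t) * Dx x t + Cconj (D x t) * Dxx x t))%C).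
    apply is_cderive_mult_const. apply (is_cderive_mult (fun x => Cconj (D x t)) (fun x => Dx x t)).
    - apply (is_cderive_conj (fun x => D x t)). apply is_cderive_minus; auto.
    - apply is_cderive_minus; auto. }
  assert (CDx : forall t x, continuous (fun y => Dx y t) x).
  { intros t x. eapply is_cderive_continuous, is_cderive_minus; auto. }
  assert (CdH : forall t x, continuous (dH t) x).
  { intros t x. unfold dH. apply (continuous_scal_r 2 (fun y => Re (Ci * (Cconj (Dx y t) * Dx y t + Cconj (D y t) * Dxx y t)))).
    apply Cre. apply continuous_Cmult; [apply continuous_const|].
    apply continuous_Cplus; apply continuous_Cmult; auto; apply continuous_Cconj; auto. }
  assert (IdH : forall t, RInt (dH t) a b = 0).
  { intros t. apply (@is_RInt_unique R_CompleteNormedModule).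
    replace 0 with (minus (H t b) (H t a)).
    - apply (@is_RInt_derive R_CompleteNormedModule); auto.
    - assert (ED : D b t = D a t) by (unfold D; rewrite Eb, Pv, Pw; reflexivity).
      assert (EDx : Dx b t = Dx a t).
      { unfold Dx. rewrite Eb.
        rewrite (periodic_derive l (fun x => v x t) (fun x => vx x t)), (periodic_derive l (fun x => w x t) (fun x => wx x t)); auto. }
      unfold H. rewrite ED, EDx. unfold minus, plus, opp; simpl. ring. }
  assert (Hpt : forall t x, Rabs t <= Rabs t0 -> a <= x <= b -> Rabs (G t x - dH t x) <= k * g t x).
  { intros t x Ht Hx.
    assert (Bnd : Cmod (v x t) <= B /\ Cmod (w x t) <= B).
    { assert (Ht' : Rabs t <= A) by (unfold A; pose proof (Rabs_pos x0); lra).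
      specialize (HBv x t (HA x Hx) Ht'). specialize (HBw x t (HA x Hx) Ht').
      unfold B. pose proof (Rle_abs Bv). pose proof (Rle_abs Bw). pose proof (Rabs_pos Bv). pose proof (Rabs_pos Bw). lra. }
    destruct Bnd as [B1 B2].
    set (Rm := (RtoC (Cmod (w x t) ^ 2) * D x t + RtoC (Cmod (w x t) ^ 2 - Cmod (v x t) ^ 2) * v x t)%C).
    assert (EDt : Dt x t = (Ci * Dxx x t + 2 * Ci * Rm)%C).
    { specialize (Ev x t). specialize (Ew x t). unfold Dt, Dxx, Rm, D.
      assert (E1 : wt x t = (- Ci * (Ci * wt x t))%C) by ring [Ci_sq].
      assert (E2 : vt x t = (- Ci * (Ci * vt x t))%C) by ring [Ci_sq].
      assert (E3 : (Ci * wt x t)%C = (- wxx x t - 2 * RtoC (Cmod (w x t) ^ 2) * w x t)%C).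
      { transitivity (Ci * wt x t + wxx x t + 2 * RtoC (Cmod (w x t) ^ 2) * w x t - wxx x t - 2 * RtoC (Cmod (w x t) ^ 2) * w x t)%C; [ring|].
        rewrite Ew. ring. }
      assert (E4 : (Ci * vt x t)%C = (- vxx x t - 2 * RtoC (Cmod (v x t) ^ 2) * v x t)%C).
      { transitivity (Ci * vt x t + vxx x t + 2 * RtoC (Cmod (v x t) ^ 2) * v x t - vxx x t - 2 * RtoC (Cmod (v x t) ^ 2) * v x t)%C; [ring|].
        rewrite Ev. ring. }
      rewrite E1, E2, E3, E4, RtoC_minus. ring. }
    assert (EG : G t x - dH t x = 4 * Re (Cconj (D x t) * (Ci * Rm))).
    { unfold G, dH. rewrite EDt. destruct (D x t), (Dx x t), (Dxx x t), Rm. unfold Re. simpl. ring. }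
    rewrite EG, Rabs_mult, (Rabs_right 4) by lra. unfold k. rewrite Rmult_assoc. apply Rmult_le_compat_l; [lra|].
    eapply Rle_trans; [apply re_le_Cmod|]. rewrite !Cmod_mult, Cmod_conj, Cmod_Ci, Rmult_1_l.
    assert (HR : Cmod Rm <= 3 * B * B * Cmod (D x t)).
    { unfold Rm. eapply Rle_trans; [apply Cmod_triangle|]. rewrite !Cmod_mult, !Cmod_R.
      pose proof (Cmod_sq_lip (w x t) (v x t)) as S. fold (D x t) in S.
      pose proof (Cmod_ge_0 (v x t)). pose proof (Cmod_ge_0 (w x t)). pose proof (Cmod_ge_0 (D x t)).
      rewrite (Rabs_right (Cmod (w x t) ^ 2)) by (apply Rle_ge, pow2_ge_0).
      assert (S1 : Cmod (w x t) ^ 2 <= B * B) by nra.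
      assert (S2 : Cmod (w x t) ^ 2 * Cmod (D x t) <= B * B * Cmod (D x t)) by (apply Rmult_le_compat_r; auto).
      assert (S3 : (Cmod (w x t) + Cmod (v x t)) * Cmod (D x t) <= 2 * B * Cmod (D x t)) by (apply Rmult_le_compat_r; lra).
      assert (S4 : Rabs (Cmod (w x t) ^ 2 - Cmod (v x t) ^ 2) * Cmod (v x t) <= 2 * B * Cmod (D x t) * B).
      { apply Rmult_le_compat; auto; [apply Rabs_pos|lra]. }
      lra. }
    unfold g. pose proof (Cmod_ge_0 (D x t)). nra. }
  assert (Hgr : RInt (g t0) a b <= RInt (g 0) a b * exp (k * Rabs t0)).
  { apply (gronwall (fun t => RInt (g t) a b) (fun t => RInt (G t) a b)); auto.
    intros t Ht.
    assert (Eq : RInt (G t) a b = RInt (fun x => G t x - dH t x) a b).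
    { transitivity (RInt (G t) a b - RInt (dH t) a b); [rewrite IdH; symmetry; apply Rminus_0_r|].
      symmetry. apply (@RInt_minus R_CompleteNormedModule); apply exR; auto. }
    assert (exk : ex_RInt (fun x => k * g t x) a b) by (apply exR; intros; now apply (continuous_scal_r k (g t))).
    assert (exm : ex_RInt (fun x => - (k * g t x)) a b).
    { apply exR; intros. apply (continuous_opp (fun x => k * g t x)). now apply (continuous_scal_r k (g t)). }
    assert (exd : ex_RInt (fun x => G t x - dH t x) a b) by (apply exR; intros; now apply (continuous_minus (G t) (dH t))).
    assert (Ek : RInt (fun x => k * g t x) a b = k * RInt (g t) a b).
    { apply (@RInt_scal R_CompleteNormedModule (g t) a b k). apply exR; auto. }
    assert (Em : RInt (fun x => - (k * g t x)) a b = - (k * RInt (g t) a b)).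
    { rewrite <- Ek. apply (@RInt_opp R_CompleteNormedModule). auto. }
    rewrite Eq. apply Rabs_le. rewrite <- Em, <- Ek. split; apply RInt_le; auto; try lra;
      intros x Hx; specialize (Hpt t x Ht ltac:(lra)); apply Rabs_le_between in Hpt; lra. }
  assert (H0 : RInt (g 0) a b = 0).
  { rewrite (RInt_ext (g 0) (fun _ => 0)).
    - rewrite RInt_const. unfold scal; simpl; unfold mult; simpl. ring.
    - intros x _. unfold g, D. rewrite Iv, Iw. replace (u x - u x)%C with (RtoC 0) by ring. rewrite Cmod_0. apply pow_i. lia. }
  assert (Hz : g t0 x0 = 0).
  { apply (integral_zero_pointwise (g t0) a b x0); auto.
    - intros y. apply pow2_ge_0.
    - unfold a, b; lra.
    - rewrite H0 in Hgr. lra. }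
  apply Cminus_eq_0, Cmod_eq_0. unfold g, D in Hz. pose proof (Cmod_ge_0 (w x0 t0 - v x0 t0)%C). nra.
Qed.

(** * Trace-free linear systems and joint continuity *)

(** The derivative along the field [X] is again an expression, so v_xx is as regular as the state
    itself. *)
Fixpoint pdev {I : Type} (p : pexp I) (X : I -> pexp I) : pexp I :=
  match p with
  | PCst c => PCst 0%C
  | PVar i => X i
  | PAdd p q => PAdd (pdev p X) (pdev q X)
  | PMul p q => PAdd (PMul (pdev p X) q) (PMul p (pdev q X))
  | PConj p => PConj (pdev p X)
  end.

Lemma ev_pdev {I : Type} (p : pexp I) X y : ev (pdev p X) y = dev p y (fun i => ev (X i) y).
Proof. induction p; cbn [ev dev pdev]; congruence. Qed.

Definition sl2_ode (A B D : R -> C) (y1 y2 : R -> C) : Prop :=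
  (forall t, is_cderive y1 t (A t * y1 t + B t * y2 t)%C) /\
  (forall t, is_cderive y2 t (D t * y1 t - A t * y2 t)%C).

(** The trace is zero. For two columns of one matrix this preserves the determinant; between the
    solutions at x = 0 and at x = l it determines the transition matrix. *)
Lemma sl2_wronskian A B D y1 y2 w1 w2 : sl2_ode A B D y1 y2 -> sl2_ode A B D w1 w2 ->
  forall t, (y1 t * w2 t - y2 t * w1 t = y1 0 * w2 0 - y2 0 * w1 0)%C.
Proof.
  intros [H1 H2] [H3 H4] t.
  apply (zero_derive_const (fun t => y1 t * w2 t - y2 t * w1 t)%C).
  intros r. specialize (H1 r). specialize (H2 r). specialize (H3 r). specialize (H4 r).
  eapply is_cderive_eq; [cder|]. cbv beta. ring.
Qed.

(** With Y the matrix of both solutions and L = [[a, b], [c, - a]], the equation L_t = [V, L] makes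
    Y^-1 L Y constant. [Ka], [Kb] and [Kc] are its entries. *)
Lemma sl2_adjoint A B D y11 y21 y12 y22 a b c :
  sl2_ode A B D y11 y21 -> sl2_ode A B D y12 y22 ->
  (forall t, y11 t * y22 t - y12 t * y21 t = 1)%C ->
  (forall t, is_cderive a t (B t * c t - b t * D t)%C) ->
  (forall t, is_cderive b t (2 * A t * b t - 2 * B t * a t)%C) ->
  (forall t, is_cderive c t (2 * D t * a t - 2 * A t * c t)%C) ->
  y11 0 = 1%C -> y21 0 = 0%C -> y12 0 = 0%C -> y22 0 = 1%C ->
  forall t,
    (a t = (y11 t * a 0 + y12 t * c 0) * y22 t - (y11 t * b 0 - y12 t * a 0) * y21 t)%C /\
    (b t = (y11 t * b 0 - y12 t * a 0) * y11 t - (y11 t * a 0 + y12 t * c 0) * y12 t)%C /\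
    (c t = (y21 t * a 0 + y22 t * c 0) * y22 t - (y21 t * b 0 - y22 t * a 0) * y21 t)%C.
Proof.
  intros [H1 H2] [H3 H4] Hdet Ha Hb Hc E1 E2 E3 E4 t.
  assert (Ka : a 0 = (y22 t * (a t * y11 t + b t * y21 t) - y12 t * (c t * y11 t - a t * y21 t))%C).
  { symmetry. etransitivity.
    - apply (zero_derive_const (fun t => y22 t * (a t * y11 t + b t * y21 t) - y12 t * (c t * y11 t - a t * y21 t))%C).
      intros r. specialize (H1 r). specialize (H2 r). specialize (H3 r). specialize (H4 r).
      specialize (Ha r). specialize (Hb r). specialize (Hc r).
      eapply is_cderive_eq; [cder|]. cbv beta. ring.
    - cbv beta. rewrite ?E1, ?E2, ?E3, ?E4. ring. }
  assert (Kb : b 0 = (y22 t * (a t * y12 t + b t * y22 t) - y12 t * (c t * y12 t - a t * y22 t))%C).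
  { symmetry. etransitivity.
    - apply (zero_derive_const (fun t => y22 t * (a t * y12 t + b t * y22 t) - y12 t * (c t * y12 t - a t * y22 t))%C).
      intros r. specialize (H1 r). specialize (H2 r). specialize (H3 r). specialize (H4 r).
      specialize (Ha r). specialize (Hb r). specialize (Hc r).
      eapply is_cderive_eq; [cder|]. cbv beta. ring.
    - cbv beta. rewrite ?E1, ?E2, ?E3, ?E4. ring. }
  assert (Kc : c 0 = (y11 t * (c t * y11 t - a t * y21 t) - y21 t * (a t * y11 t + b t * y21 t))%C).
  { symmetry. etransitivity.
    - apply (zero_derive_const (fun t => y11 t * (c t * y11 t - a t * y21 t) - y21 t * (a t * y11 t + b t * y21 t))%C).
      intros r. specialize (H1 r). specialize (H2 r). specialize (H3 r). specialize (H4 r).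
      specialize (Ha r). specialize (Hb r). specialize (Hc r).
      eapply is_cderive_eq; [cder|]. cbv beta. ring.
    - cbv beta. rewrite ?E1, ?E2, ?E3, ?E4. ring. }
  specialize (Hdet t). rewrite Ka, Kb, Kc.
  split; [|split].
  (* The substitution yields each entry of L times the squared determinant. *)
  - transitivity (a t * ((y11 t * y22 t - y12 t * y21 t) * (y11 t * y22 t - y12 t * y21 t)))%C; [rewrite Hdet; ring|ring].
  - transitivity (b t * ((y11 t * y22 t - y12 t * y21 t) * (y11 t * y22 t - y12 t * y21 t)))%C; [rewrite Hdet; ring|ring].
  - transitivity (c t * ((y11 t * y22 t - y12 t * y21 t) * (y11 t * y22 t - y12 t * y21 t)))%C; [rewrite Hdet; ring|ring].
Qed.

Lemma mean_value_lipschitz (w dw : R -> C) K :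
  (forall s, is_cderive w s (dw s)) -> (forall s, Cmod (dw s) <= K) ->
  forall s r, Cmod (w s - w r)%C <= K * Rabs (s - r).
Proof.
  intros Hw Hd.
  assert (Main : forall s r, r <= s -> Cmod (w s - w r)%C <= K * (s - r)).
  { intros s r Hrs. replace (K * (s - r)) with (K * s - K * r) by ring.
    apply (mean_value_ineq w dw (fun s => K * s) (fun _ => K)); auto.
    intros; auto_derive; auto; ring. }
  intros s r. destruct (Rle_lt_dec r s) as [H|H].
  - rewrite Rabs_right by lra. auto.
  - rewrite Rabs_left by lra. rewrite <- Cmod_opp.
    replace (- (w s - w r))%C with (w r - w s)%C by ring. replace (- (s - r)) with (r - s) by ring. apply Main; lra.
Qed.

(** Bounded partial derivatives make the function Lipschitz in each variable separately, hence
    jointly continuous. *)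
Lemma continuous_2d_of_derivatives (f fx ft : R -> R -> C) K :
  (forall x t, is_cderive (fun y => f y t) x (fx x t)) ->
  (forall x t, is_cderive (fun s => f x s) t (ft x t)) ->
  (forall x t, Cmod (fx x t) <= K) -> (forall x t, Cmod (ft x t) <= K) ->
  forall p, continuous (fun p : R * R => f (fst p) (snd p)) p.
Proof.
  intros Hx Ht Bx Bt [x t] P [eps HP]. simpl in HP.
  assert (HK : 0 <= K) by (eapply Rle_trans; [apply Cmod_ge_0|apply (Bx 0 0)]).
  assert (Hd : 0 < eps / (2 * (K + 1))) by (apply Rdiv_lt_0_compat; [apply cond_pos|lra]).
  exists (mkposreal _ Hd). intros [y s] [B1 B2]. apply HP.
  apply C_NormedModule_mixin_compat1. simpl in *.
  unfold ball in B1, B2; simpl in B1, B2; unfold AbsRing_ball, abs, minus, plus, opp in B1, B2; simpl in B1, B2.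
  change (Cmod (f y s - f x t)%C < eps).
  replace (f y s - f x t)%C with ((f y s - f x s) + (f x s - f x t))%C by ring.
  eapply Rle_lt_trans; [apply Cmod_triangle|].
  pose proof (mean_value_lipschitz (fun y => f y s) (fun y => fx y s) K (fun r => Hx r s) (fun r => Bx r s) y x) as L1.
  pose proof (mean_value_lipschitz (fun s => f x s) (fun s => ft x s) K (fun r => Ht x r) (fun r => Bt x r) s t) as L2.
  simpl in L1, L2. unfold Rminus in L1, L2.
  apply Rle_lt_trans with (K * (2 * (eps / (2 * (K + 1))))).
  - eapply Rle_trans; [apply Rplus_le_compat; [exact L1|exact L2]|].
    rewrite <- Rmult_plus_distr_l. apply Rmult_le_compat_l; lra.
  - replace (K * (2 * (eps / (2 * (K + 1))))) with (eps * (K / (K + 1))) by (field; lra).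
    assert (K / (K + 1) < 1). { apply Rmult_lt_reg_r with (K + 1); [lra|]. field_simplify; lra. }
    pose proof (cond_pos eps). nra.
Qed.

(** * From the n-gap potential to a global family of states *)

(** With a star for reflection, the monodromy satisfies f h = f* h* and psi h = - phi* h*, which
    gives the claim times h h*. High on the imaginary axis P11 dominates P22, so f h is nonzero and
    h h* cancels; a polynomial identity on that ray holds everywhere. *)
Lemma n_gap_reflection (u : R -> C) l P11 P12 P21 P22 (f psi phi h : C -> C) :
  0 < l -> (forall x, continuous u x) -> fundamental_matrix u P11 P12 P21 P22 ->
  cpoly f -> cpoly psi -> cpoly phi ->
  (forall z, (P11 l z - P22 l z) / (2 * Ci) = f z * h z)%C ->
  (forall z, P12 l z = psi z * h z)%C -> (forall z, P21 l z = phi z * h z)%C ->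
  forall z, (Cconj (f (Cconj z)) * psi z = - (f z * Cconj (phi (Cconj z))))%C.
Proof.
  intros Hl Hu HP Hf Hpsi Hphi E1 E2 E3.
  assert (S1 : forall z, (f z * h z = Cconj (f (Cconj z)) * Cconj (h (Cconj z)))%C).
  { intros z. rewrite <- Cmult_conj, <- !E1. 
    destruct (fundamental_conj u P11 P12 P21 P22 HP l z) as [_ R1].
    destruct (fundamental_conj u P11 P12 P21 P22 HP l (Cconj z)) as [_ R2]. rewrite Cconj_conj in R2.
    rewrite Cdiv_conj, Cminus_conj, Cmult_conj, Cconj_Ci, Cconj_R, <- R1, R2, Cconj_conj by exact Ci2_nz.
    field. exact Ci_nz. }
  assert (S2 : forall z, (psi z * h z = - (Cconj (phi (Cconj z)) * Cconj (h (Cconj z))))%C).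
  { intros z. rewrite <- Cmult_conj, <- E2, <- E3. apply (fundamental_conj u P11 P12 P21 P22 HP l z). }
  apply (cpoly_eq_large (fun z => Cconj (f (Cconj z)) * psi z)%C (fun z => - (f z * Cconj (phi (Cconj z))))%C).
  - apply cpoly_mult; auto. now apply cpoly_star.
  - destruct (cpoly_mult f (fun z => Cconj (phi (Cconj z)))) as [d Hd]; auto; [now apply cpoly_star|].
    exists d. apply (ple_ext _ (fun z => - (1) * (f z * Cconj (phi (Cconj z))))%C); [intros; ring|now apply ple_scal].
  - destruct (continuous_bounded u l Hu) as (V & HV & Hvb).
    (* Any constant below 1 / 2 separates the diagonal entries after multiplication by exp (i z
       l). *)
    destruct (dirac_half_plane l V (1 / 4) Hl HV ltac:(lra)) as (C0 & HC0 & HH).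
    exists C0. intros t Ht. set (z := (RtoC t * Ci)%C).
    assert (Hz : C0 <= Im z) by (unfold z, Im; simpl; lra).
    assert (Hw : forall s, 0 <= s <= l -> Cmod (u s) <= V) by (intros; apply Hvb; rewrite Rabs_right; lra).
    destruct (HH z u (fun x => P11 x z) (fun x => P21 x z) Hz (column1 u P11 P12 P21 P22 HP z) Hw) as [A1 _].
    { rewrite (init11 u P11 P12 P21 P22 HP), (init21 u P11 P12 P21 P22 HP), Cmod_1, Cmod_0. lra. }
    destruct (HH z u (fun x => P12 x z) (fun x => P22 x z) Hz (column2 u P11 P12 P21 P22 HP z) Hw) as [_ A2].
    { rewrite (init12 u P11 P12 P21 P22 HP), (init22 u P11 P12 P21 P22 HP), Cmod_1, Cmod_0. lra. }
    rewrite (init11 u P11 P12 P21 P22 HP) in A1.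
    assert (Hnz : (f z * h z)%C <> 0%C).
    { rewrite <- E1. intros E.
      assert (E0 : (P11 l z - P22 l z)%C = 0%C).
      { transitivity ((P11 l z - P22 l z) / (2 * Ci) * (2 * Ci))%C; [field; exact Ci_nz|]. rewrite E. ring. }
      assert (Cmod 1 <= Cmod (cexp z l * P11 l z - 1) + Cmod (cexp z l * P22 l z)); [|rewrite Cmod_1 in *; lra].
      rewrite <- (Cmod_opp (_ - 1)). eapply Rle_trans; [|apply Cmod_triangle].
      right. f_equal. transitivity (1 - cexp z l * (P11 l z - P22 l z))%C; [rewrite E0; ring|ring]. }
    assert (Hh : h z <> 0%C) by (intros E; apply Hnz; rewrite E; ring).
    assert (Hh' : Cconj (h (Cconj z)) <> 0%C) by (intros E; apply Hnz; rewrite S1, E; ring).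
    apply (Cmult_reg_l' (h z * Cconj (h (Cconj z)))%C); [now apply Cmult_neq_0|].
    transitivity ((Cconj (f (Cconj z)) * Cconj (h (Cconj z))) * (psi z * h z))%C; [ring|].
    rewrite <- S1, S2. ring.
Qed.

(** From matrix functions to coefficient states. Periodicity is an equality of states, so that every
    function of the state inherits it. *)
Lemma initial_family (l : R) (u : R -> C) P11 P12 P21 P22 m (e b H : C -> C) :
  0 < l -> periodic l u -> (forall x, continuous u x) -> fundamental_matrix u P11 P12 P21 P22 ->
  mon m e -> cpoly b -> (forall z, Cconj (e (Cconj z)) = e z) ->
  (forall z, P11 l z - P22 l z = 2 * Ci * (e z * H z))%C ->
  (forall z, P12 l z = b z * H z)%C ->
  (forall z, P21 l z = - Cconj (b (Cconj z)) * H z)%C ->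
  exists p : R -> idx -> C,
    (forall x, supp m (p x)) /\ (forall x, realg (p x)) /\
    (forall x j, p x (iY j) = 0%C) /\
    (forall x, p (x + l) = p x) /\
    (forall x, p x (iB 0) = u x) /\
    (forall z, fpol m (p 0) z = e z) /\ (forall z, bpol m (p 0) z = b z) /\
    (forall x k, is_cderive (fun r => p r (iB k)) x (ev (xfield 0 (iB k)) (p x))) /\
    (forall x k, is_cderive (fun r => p r (iG k)) x (ev (xfield 0 (iG k)) (p x))).
Proof.
  intros Hl Hper Hu HP He Hb Hreal Hf Hpsi Hphi.
  destruct (lax_coefficients u m (Na P11 P12 P21 P22 e b) (Nb P11 P12 e b) (Nc P21 P22 e b))
    as (beta & gamma & Ea & Eb & Cb & Cg & Rg & B0 & Db & Dg).
  - now apply N_lax.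
  - intros x. apply (N_polynomial l u P11 P12 P21 P22 m e b H); auto.
  - intros x. apply (N_polynomial l u P11 P12 P21 P22 m e b H); auto.
  - intros x z. now apply (N_real u P11 P12 P21 P22 e b).
  - intros x z. now apply (N_real u P11 P12 P21 P22 e b).
  - pose proof Ci_nz as HCi.
    exists (fun x i => match i with iB k => beta x k | iG k => gamma x k | iY _ => RtoC 0 end).
    split; [intros x k Hk; split; auto|].
    split; [intros x k; apply Rg|].
    split; [reflexivity|].
    split.
    { intros x.
      assert (EP : forall z, Na P11 P12 P21 P22 e b (x + l) z = Na P11 P12 P21 P22 e b x z /\
        Nb P11 P12 e b (x + l) z = Nb P11 P12 e b x z).
      { intros z. now apply (N_periodic l u P11 P12 P21 P22 e b H). }
      apply functional_extensionality. intros [k|k|j]; auto; destruct (Nat.lt_ge_cases k m) as [Hk|Hk].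
      - apply (hpoly_inj m); auto. intros z. rewrite <- !Eb. apply EP.
      - now rewrite !Cb.
      - apply (hpoly_inj m); auto. intros z. destruct (EP z) as [E _]. rewrite !Ea in E.
        apply Cmult_reg_l' in E; auto.
        transitivity (z ^ m + hpoly m (gamma (x + l)%R) z - z ^ m)%C; [ring|]. rewrite E. ring.
      - now rewrite !Cg. }
    split; [exact B0|].
    split.
    { intros z. unfold fpol. apply (Cmult_reg_l' Ci); auto.
      rewrite <- Ea. now apply (N_init u P11 P12 P21 P22 e b). }
    split.
    { intros z. unfold bpol. rewrite <- Eb. now apply (N_init u P11 P12 P21 P22 e b). }
    split.
    + intros x k. apply Db.
    + intros x k. eapply is_cderive_eq; [apply Dg|]. cbn [ev xfield]. ring.
Qed.

(** The x-equations are recorded at t = 0 only; [family_x_field] supplies them for other t. *)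
Definition nls_family (m : nat) (M : R) (p : R -> R -> idx -> C) : Prop :=
  (forall x t, supp m (p x t)) /\ (forall x t, realg (p x t)) /\ (forall x t i, Cmod (p x t i) <= M) /\
  (forall x t j, p x t (iY j) = 0%C) /\
  (forall x t k, is_cderive (fun s => p x s (iB k)) t (ev (tfield 0 (iB k)) (p x t))) /\
  (forall x t k, is_cderive (fun s => p x s (iG k)) t (ev (tfield 0 (iG k)) (p x t))) /\
  (forall x k, is_cderive (fun r => p r 0 (iB k)) x (ev (xfield 0 (iB k)) (p x 0))) /\
  (forall x k, is_cderive (fun r => p r 0 (iG k)) x (ev (xfield 0 (iG k)) (p x 0))).

Lemma evolve_family m l (p0 : R -> idx -> C) :
  (forall x, supp m (p0 x)) -> (forall x, realg (p0 x)) ->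
  (forall x j, p0 x (iY j) = 0%C) -> (forall x, p0 (x + l) = p0 x) ->
  (forall x k, is_cderive (fun r => p0 r (iB k)) x (ev (xfield 0 (iB k)) (p0 x))) ->
  (forall x k, is_cderive (fun r => p0 r (iG k)) x (ev (xfield 0 (iG k)) (p0 x))) ->
  exists M p, nls_family m M p /\ (forall x i, p x 0 i = p0 x i) /\ (forall x t, p (x + l) t = p x t).
Proof.
  intros Hs Hr HY Hp HB HG.
  destruct (density_bound m (density m (p0 0))) as (M & HM & HMb).
  assert (Hex : forall y0 : idx -> C, exists y : R -> idx -> C, supp m y0 -> realg y0 -> tflow_from m y0 y).
  { intros y0. destruct (excluded_middle_informative (supp m y0 /\ realg y0)) as [[H1 H2]|Hn].
    - destruct (tflow_exists m y0 H1 H2) as (y & Hy). exists y. auto.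
    - exists (fun _ => y0). intros H1 H2. exfalso. auto. }
  (* Chosen as a function of the initial state and not of x: equal states at x and x + l evolve
     equally, so periodicity persists. *)
  set (flow := fun y0 => proj1_sig (constructive_indefinite_description _ (Hex y0))).
  assert (Hflow : forall x, tflow_from m (p0 x) (flow (p0 x))).
  { intros x. unfold flow. destruct (constructive_indefinite_description _ (Hex (p0 x))) as [y Hy]. now apply Hy. }
  clearbody flow. clear Hex.
  set (p := fun x t i => match i with iY _ => RtoC 0 | _ => flow (p0 x) t i end).
  assert (Hev : forall x t z i, (exists k, i = iB k \/ i = iG k) ->
    ev (tfield z i) (p x t) = ev (tfield z i) (flow (p0 x) t) /\ ev (xfield z i) (p x t) = ev (xfield z i) (flow (p0 x) t)).
  { intros x t z i (k & [-> | ->]); split; reflexivity. }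
  assert (E0 : forall x i, p x 0 i = p0 x i).
  { intros x [k|k|j]; [apply (Hflow x)|apply (Hflow x)|now rewrite HY]. }
  assert (E0' : forall x, p x 0 = p0 x) by (intros x; apply functional_extensionality, E0).
  exists M, p. split; [|split].
  - unfold nls_family.
    split; [intros x t; apply (Hflow x)|].
    split; [intros x t; apply (Hflow x)|].
    split.
    (* The density is conserved in t by the flow and in x at t = 0, so its value at the origin
       bounds every state. *)
    { assert (Hb : forall x t k, Cmod (p x t (iB k)) <= M /\ Cmod (p x t (iG k)) <= M).
      { intros x t k. apply (HMb (flow (p0 x) t)); [apply (Hflow x)|].
        intros s. destruct (Hflow x) as (_ & _ & _ & _ & _ & Hd). rewrite Hd.
        rewrite (density_x_const m p0 s); auto. lra. }
      intros x t [k|k|j]; [apply Hb|apply Hb|]. unfold p. rewrite Cmod_0. auto. }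
    split; [reflexivity|].
    split; [intros x t k; apply (Hflow x)|].
    split; [intros x t k; apply (Hflow x)|].
    split; intros x k; rewrite E0'.
    + apply is_cderive_ext with (fun r => p0 r (iB k)); auto.
    + apply is_cderive_ext with (fun r => p0 r (iG k)); auto.
  - exact E0.
  - intros x t. unfold p. now rewrite Hp.
Qed.

Lemma family_x_field m M p z : nls_family m M p -> 
  (forall x t k, is_cderive (fun r => p r t (iB k)) x (ev (xfield z (iB k)) (p x t))) /\
  (forall x t k, is_cderive (fun r => p r t (iG k)) x (ev (xfield z (iG k)) (p x t))).
Proof.
  intros (Hs & Hr & HM & HY & HtB & HtG & HxB & HxG).
  destruct (joint_flow m M p (fun x => p x 0 (iB 0)) Hs Hr HM HtB HtG HY HxB HxG (fun x => eq_refl) 0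
    (fun _ => 0%C) (fun _ => 0%C)) as (w & _ & _ & _ & EB & EG).
  - split; intros x; (eapply is_cderive_eq; [apply is_cderive_const|ring]).
  - split; [exact EB|exact EG].
Qed.

(** NLS is the [iB 0] component of the t-field once v_xx is computed by differentiating [pvx] along
    the x-field: a polynomial identity modulo i^2 = -1. *)
Lemma family_nls m M p : nls_family m M p ->
  exists vx vxx vt : R -> R -> C,
    (forall x t, is_cderive (fun y => p y t (iB 0)) x (vx x t)) /\
    (forall x t, is_cderive (fun y => vx y t) x (vxx x t)) /\
    (forall x t, is_cderive (fun s => p x s (iB 0)) t (vt x t)) /\
    (forall q, continuous (fun q : R * R => p (fst q) (snd q) (iB 0)) q) /\
    (forall q, continuous (fun q : R * R => vx (fst q) (snd q)) q) /\
    (forall q, continuous (fun q : R * R => vxx (fst q) (snd q)) q) /\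
    (forall q, continuous (fun q : R * R => vt (fst q) (snd q)) q) /\
    (forall x t, (Ci * vt x t + vxx x t + 2 * RtoC (Cmod (p x t (iB 0)) ^ 2) * p x t (iB 0) = 0)%C).
Proof.
  intros Hfam. destruct (family_x_field m M p 0 Hfam) as [HxB HxG].
  destruct Hfam as (Hs & Hr & HM & HY & HtB & HtG & _ & _).
  assert (Hx : forall x t i, is_cderive (fun r => p r t i) x (ev (xfield 0 i) (p x t))).
  { intros x t [k|k|j]; auto.
    apply is_cderive_ext with (fun _ => 0%C); [intros r; symmetry; apply HY|].
    eapply is_cderive_eq; [apply is_cderive_const|]. destruct j; cbn [ev xfield]; rewrite !HY; ring. }
  assert (Ht : forall x t i, is_cderive (fun s => p x s i) t (ev (tfield 0 i) (p x t))).
  { intros x t [k|k|j]; auto.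
    apply is_cderive_ext with (fun _ => 0%C); [intros r; symmetry; apply HY|].
    eapply is_cderive_eq; [apply is_cderive_const|]. destruct j; cbn [ev tfield]; rewrite !HY; ring. }
  assert (Hc : forall i q, continuous (fun q : R * R => p (fst q) (snd q) i) q).
  { intros i.
    destruct (ev_bound (xfield 0 i) M) as (K1 & HK1 & H1). destruct (ev_bound (tfield 0 i) M) as (K2 & HK2 & H2).
    apply (continuous_2d_of_derivatives (fun x t => p x t i) (fun x t => ev (xfield 0 i) (p x t)) (fun x t => ev (tfield 0 i) (p x t)) (K1 + K2)); auto.
    - intros x t. specialize (H1 (p x t) (HM x t)). lra.
    - intros x t. specialize (H2 (p x t) (HM x t)). lra. }
  assert (Hce : forall e q, continuous (fun q : R * R => ev e (p (fst q) (snd q))) q).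
  { intros e q. apply (ev_continuous e (fun q : R * R => p (fst q) (snd q))). auto. }
  exists (fun x t => ev pvx (p x t)), (fun x t => ev (pdev pvx (xfield 0)) (p x t)), (fun x t => ev (tfield 0 (iB 0)) (p x t)).
  split; [intros x t; apply (Hx x t (iB 0))|].
  split.
  { intros x t. rewrite ev_pdev. apply (ev_derive pvx (fun y => p y t)). intros i. apply Hx. }
  split; [intros x t; apply Ht|].
  split; [apply Hc|].
  split; [apply Hce|].
  split; [apply Hce|].
  split; [apply Hce|].
  intros x t. rewrite Cmod2_conj. rewrite ev_pdev.
  cbn [ev dev pvx xfield tfield pabs2]. ring [Ci_sq].
Qed.

Lemma fpol_star m y z : realg y -> Cconj (fpol m y (Cconj z)) = fpol m y z.
Proof.
  intros Hr. unfold fpol. rewrite Cplus_conj, Cpow_conj, Cconj_conj, hpoly_conj. f_equal.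
  apply hpoly_ext. intros; apply Hr.
Qed.

(** * Evolution of the monodromy *)

Lemma family_lax_t m M p x z : nls_family m M p ->
  let A := fun s => (- (2 * Ci * z * z) + Ci * ev pabs2 (p x s))%C in
  let B := fun s => (- (2 * z) * p x s (iB 0) + - Ci * ev pvx (p x s))%C in
  let D := fun s => (2 * z * Cconj (p x s (iB 0)) + - Ci * Cconj (ev pvx (p x s)))%C in
  let a := fun s => (Ci * fpol m (p x s) z)%C in
  let b := fun s => bpol m (p x s) z in
  let c := fun s => (- bstar m (p x s) z)%C in
  (forall t, is_cderive a t (B t * c t - b t * D t)%C) /\
  (forall t, is_cderive b t (2 * A t * b t - 2 * B t * a t)%C) /\
  (forall t, is_cderive c t (2 * D t * a t - 2 * A t * c t)%C).
Proof.
  intros (Hs & Hr & HM & HY & HtB & HtG & _ & _) A B D a b c.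
  assert (Hbd : forall w t, is_cderive (fun s => bpol m (p x s) w) t
    (2 * (- (2 * Ci * w * w) + Ci * ev pabs2 (p x t)) * bpol m (p x t) w
     - 2 * (- (2 * w * p x t (iB 0)) - Ci * ev pvx (p x t)) * (Ci * fpol m (p x t) w))%C).
  { intros w t. eapply is_cderive_eq; [|apply (tfield_bpol m (p x t) w 0 (Hs x t))].
    unfold bpol. apply (is_cderive_hpoly m (fun s k => p x s (iB k)) (fun k => ev (tfield 0 (iB k)) (p x t))).
    intros k _. apply HtB. }
  split; [|split]; intros t.
  - eapply is_cderive_eq.
    + apply is_cderive_mult_const. unfold fpol. apply is_cderive_plus; [apply is_cderive_const|].
      apply (is_cderive_hpoly m (fun s k => p x s (iG k)) (fun k => ev (tfield 0 (iG k)) (p x t))).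
      intros k _. apply HtG.
    + rewrite Cplus_0_l, (tfield_fpol m (p x t) z 0 (Hs x t)). unfold A, B, D, a, b, c. ring.
  - eapply is_cderive_eq; [apply Hbd|]. unfold A, B, D, a, b, c. ring.
  - eapply is_cderive_eq; [apply is_cderive_opp, is_cderive_conj, Hbd|].
    unfold A, B, D, a, b, c, bstar.
    assert (E2 : Cconj (ev pabs2 (p x t)) = ev pabs2 (p x t)).
    { cbn [ev pabs2]. rewrite Cmult_conj, Cconj_conj. ring. }
    assert (E3 : Cconj (fpol m (p x t) (Cconj z)) = fpol m (p x t) z) by (apply fpol_star, Hr).
    cnorm. rewrite ?E2, ?E3, ?Cconj_R. ring.
Qed.

(** Let Y_s = V Y with Y(x, 0) = Phi(x). As V is l-periodic in x, Y(l, s) = Y(0, s) Phi(l). The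
    fundamental matrix at time t is Y(x, t) Y(0, t)^-1; at x = l it equals Y(0, t) Phi(l) Y(0,
    t)^-1, the conjugation that takes P at time 0 to P at time t. *)
Theorem family_monodromy l u P11 P12 P21 P22 m (e b H : C -> C) M p t :
  fundamental_matrix u P11 P12 P21 P22 ->
  (forall z, P11 l z - P22 l z = 2 * Ci * (e z * H z))%C ->
  (forall z, P12 l z = b z * H z)%C ->
  (forall z, P21 l z = - Cconj (b (Cconj z)) * H z)%C ->
  nls_family m M p -> (forall x, p x 0 (iB 0) = u x) -> (forall x s, p (x + l) s = p x s) ->
  (forall z, fpol m (p 0 0) z = e z) -> (forall z, bpol m (p 0 0) z = b z) ->
  exists Q11 Q12 Q21 Q22, fundamental_matrix (fun x => p x t (iB 0)) Q11 Q12 Q21 Q22 /\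
    forall z, (Q11 l z - Q22 l z = 2 * Ci * (fpol m (p 0 t) z * H z))%C /\
      (Q12 l z = bpol m (p 0 t) z * H z)%C /\ (Q21 l z = - bstar m (p 0 t) z * H z)%C.
Proof.
  intros HP Hf Hpsi Hphi Hfam Hu0 Hper Ef Eb.
  assert (Hz : forall z, exists Q : (R -> C) * (R -> C) * (R -> C) * (R -> C),
    let '(q11, q12, q21, q22) := Q in
    dirac_ode (fun x => p x t (iB 0)) z q11 q21 /\ dirac_ode (fun x => p x t (iB 0)) z q12 q22 /\
    (q11 0 = 1%C /\ q12 0 = 0%C /\ q21 0 = 0%C /\ q22 0 = 1%C) /\
    (q11 l - q22 l = 2 * Ci * (fpol m (p 0 t) z * H z))%C /\
    (q12 l = bpol m (p 0 t) z * H z)%C /\ (q21 l = - bstar m (p 0 t) z * H z)%C).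
  { intros z.
    destruct (family_lax_t m M p 0 z Hfam) as (La & Lb & Lc).
    destruct Hfam as (Hs & Hr & HM & HY & HtB & HtG & HxB & HxG).
    destruct (joint_flow m M p u Hs Hr HM HtB HtG HY HxB HxG Hu0 z (fun x => P11 x z) (fun x => P21 x z)
      (column1 u P11 P12 P21 P22 HP z)) as (w1 & I1 & T1 & X1 & _).
    destruct (joint_flow m M p u Hs Hr HM HtB HtG HY HxB HxG Hu0 z (fun x => P12 x z) (fun x => P22 x z)
      (column2 u P11 P12 P21 P22 HP z)) as (w2 & I2 & T2 & X2 & _).
    set (A := fun s => (- (2 * Ci * z * z) + Ci * ev pabs2 (p 0 s))%C) in *.
    set (B := fun s => (- (2 * z) * p 0 s (iB 0) + - Ci * ev pvx (p 0 s))%C) in *.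
    set (D := fun s => (2 * z * Cconj (p 0 s (iB 0)) + - Ci * Cconj (ev pvx (p 0 s)))%C) in *.
    assert (Hpl : forall s, p l s = p 0 s) by (intros s; rewrite <- (Hper 0 s), Rplus_0_l; reflexivity).
    assert (Sl : forall w : R -> R -> bool -> C,
      (forall x t j, is_cderive (fun s => w x s j) t (ev (tfield z (iY j)) (with_vector (p x t) (w x t)))) ->
      forall x, (forall s, p x s = p 0 s) -> sl2_ode A B D (fun s => w x s false) (fun s => w x s true)).
    { intros w Hw x Hx. split; intros s; (eapply is_cderive_eq; [apply Hw|]); rewrite Hx; unfold A, B, D;
        cbn [ev tfield with_vector pabs2 pvx]; ring. }
    assert (S10 := Sl w1 T1 0 (fun s => eq_refl)). assert (S20 := Sl w2 T2 0 (fun s => eq_refl)).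
    assert (S1l := Sl w1 T1 l Hpl). assert (S2l := Sl w2 T2 l Hpl).
    pose proof (init11 u P11 P12 P21 P22 HP z) as J1. pose proof (init12 u P11 P12 P21 P22 HP z) as J2.
    pose proof (init21 u P11 P12 P21 P22 HP z) as J3. pose proof (init22 u P11 P12 P21 P22 HP z) as J4.
    assert (Hdet : forall s, (w1 0 s false * w2 0 s true - w2 0 s false * w1 0 s true = 1)%C).
    { intros s. pose proof (sl2_wronskian _ _ _ _ _ _ _ S10 S20 s) as W. cbv beta in W.
      rewrite (proj1 (I1 0)), (proj2 (I1 0)), (proj1 (I2 0)), (proj2 (I2 0)), J1, J2, J3, J4 in W.
      transitivity (w1 0 s false * w2 0 s true - w1 0 s true * w2 0 s false)%C; [ring|]. rewrite W. ring. }
    destruct (sl2_adjoint A B D _ _ _ _ (fun s => Ci * fpol m (p 0 s) z)%C (fun s => bpol m (p 0 s) z)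
      (fun s => - bstar m (p 0 s) z)%C S10 S20 Hdet La Lb Lc) with (t := t) as (Ga & Gb & Gc).
    { rewrite (proj1 (I1 0)); auto. }
    { rewrite (proj2 (I1 0)); auto. }
    { rewrite (proj1 (I2 0)); auto. }
    { rewrite (proj2 (I2 0)); auto. }
    rewrite Ef, Eb in Ga, Gb, Gc.
    assert (Es : bstar m (p 0 0) z = Cconj (b (Cconj z))) by (unfold bstar; rewrite Eb; reflexivity).
    rewrite Es in Ga, Gb, Gc. clear Es.
    (* Up to sign, these Wronskians are the entries of Y(0, t)^-1 Y(l, t), evaluated at t = 0. *)
    pose proof (sl2_wronskian _ _ _ _ _ _ _ S20 S1l t) as W1. pose proof (sl2_wronskian _ _ _ _ _ _ _ S10 S1l t) as W2.
    pose proof (sl2_wronskian _ _ _ _ _ _ _ S20 S2l t) as W3. pose proof (sl2_wronskian _ _ _ _ _ _ _ S10 S2l t) as W4.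
    cbv beta in W1, W2, W3, W4.
    rewrite (proj1 (I2 0)), (proj2 (I2 0)), (proj1 (I1 l)), (proj2 (I1 l)), J2, J4 in W1.
    rewrite (proj1 (I1 0)), (proj2 (I1 0)), (proj1 (I1 l)), (proj2 (I1 l)), J1, J3 in W2.
    rewrite (proj1 (I2 0)), (proj2 (I2 0)), (proj1 (I2 l)), (proj2 (I2 l)), J2, J4 in W3.
    rewrite (proj1 (I1 0)), (proj2 (I1 0)), (proj1 (I2 l)), (proj2 (I2 l)), J1, J3 in W4.
    specialize (Hdet t).
    set (y11 := w1 0 t false) in *. set (y21 := w1 0 t true) in *.
    set (y12 := w2 0 t false) in *. set (y22 := w2 0 t true) in *.
    set (l11 := w1 l t false) in *. set (l21 := w1 l t true) in *.
    set (l12 := w2 l t false) in *. set (l22 := w2 l t true) in *.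
    assert (E11 : P11 l z = (P22 l z + 2 * Ci * (e z * H z))%C) by (rewrite <- Hf; ring).
    rewrite E11, ?Hpsi, ?Hphi in *. set (mu := P22 l z) in *. set (bs := Cconj (b (Cconj z))) in *.
    assert (L11 : l11 = (y11 * (mu + 2 * Ci * (e z * H z)) + y12 * (- bs * H z))%C).
    { transitivity ((y11 * y22 - y12 * y21) * l11)%C; [rewrite Hdet; ring|].
      transitivity (- y11 * (y12 * l21 - y22 * l11) + y12 * (y11 * l21 - y21 * l11))%C; [ring|].
      rewrite W1, W2. ring. }
    assert (L21 : l21 = (y21 * (mu + 2 * Ci * (e z * H z)) + y22 * (- bs * H z))%C).
    { transitivity ((y11 * y22 - y12 * y21) * l21)%C; [rewrite Hdet; ring|].
      transitivity (- y21 * (y12 * l21 - y22 * l11) + y22 * (y11 * l21 - y21 * l11))%C; [ring|].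
      rewrite W1, W2. ring. }
    assert (L12 : l12 = (y11 * (b z * H z) + y12 * mu)%C).
    { transitivity ((y11 * y22 - y12 * y21) * l12)%C; [rewrite Hdet; ring|].
      transitivity (- y11 * (y12 * l22 - y22 * l12) + y12 * (y11 * l22 - y21 * l12))%C; [ring|].
      rewrite W3, W4. ring. }
    assert (L22 : l22 = (y21 * (b z * H z) + y22 * mu)%C).
    { transitivity ((y11 * y22 - y12 * y21) * l22)%C; [rewrite Hdet; ring|].
      transitivity (- y21 * (y12 * l22 - y22 * l12) + y22 * (y11 * l22 - y21 * l12))%C; [ring|].
      rewrite W3, W4. ring. }
    (* Columns of Y(x, t) Y(0, t)^-1, inverted by Cramer's rule with determinant 1. *)
    exists ((fun x => y22 * w1 x t false + - y21 * w2 x t false)%C, (fun x => - y12 * w1 x t false + y11 * w2 x t false)%C,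
      (fun x => y22 * w1 x t true + - y21 * w2 x t true)%C, (fun x => - y12 * w1 x t true + y11 * w2 x t true)%C).
    split; [apply dirac_ode_lin; [apply X1|apply X2]|].
    split; [apply dirac_ode_lin; [apply X1|apply X2]|].
    split.
    { fold y11 y21 y12 y22. repeat split; try ring.
      - transitivity (y11 * y22 - y12 * y21)%C; [ring|exact Hdet].
      - transitivity (y11 * y22 - y12 * y21)%C; [ring|exact Hdet]. }
    fold l11 l21 l12 l22. rewrite L11, L21, L12, L22.
    split; [|split].
    - transitivity (2 * (Ci * fpol m (p 0 t) z) * H z)%C; [|ring]. rewrite Ga. ring.
    - rewrite Gb. ring.
    - rewrite Gc. ring. }
  set (Q := fun z => proj1_sig (constructive_indefinite_description _ (Hz z))).
  assert (HQ := fun z => proj2_sig (constructive_indefinite_description _ (Hz z))).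
  change (forall z, let '(q11, q12, q21, q22) := Q z in
    dirac_ode (fun x => p x t (iB 0)) z q11 q21 /\ dirac_ode (fun x => p x t (iB 0)) z q12 q22 /\
    (q11 0 = 1%C /\ q12 0 = 0%C /\ q21 0 = 0%C /\ q22 0 = 1%C) /\
    (q11 l - q22 l = 2 * Ci * (fpol m (p 0 t) z * H z))%C /\
    (q12 l = bpol m (p 0 t) z * H z)%C /\ (q21 l = - bstar m (p 0 t) z * H z)%C) in HQ.
  clearbody Q. clear Hz.
  exists (fun x z => fst (fst (fst (Q z))) x), (fun x z => snd (fst (fst (Q z))) x),
    (fun x z => snd (fst (Q z)) x), (fun x z => snd (Q z) x).
  split.
  - intros z. specialize (HQ z). destruct (Q z) as [[[q11 q12] q21] q22]. simpl.
    destruct HQ as (H1 & H2 & (H3 & H4 & H5 & H6) & _).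
    split; [apply dirac_solution_ode; exact H1|]. split; [apply dirac_solution_ode; exact H2|]. auto.
  - intros z. specialize (HQ z). destruct (Q z) as [[[q11 q12] q21] q22]. simpl. tauto.
Qed.

Theorem theorem2 (l : R) (n : nat) (u : R -> C) :
  0 < l ->
  n_gap_potential l n u ->
  (exists v : R -> R -> C,
     nls_solution l u v /\
     (forall w : R -> R -> C, nls_solution l u w -> forall x t, w x t = v x t) /\
     (forall t : R, n_gap_potential l n (fun x => v x t))).
Proof.
  intros Hl (Hper & (u1 & u2 & Hu1 & _ & _) & P11 & P12 & P21 & P22 & HP & h & f0 & psi0 & phi0 & Hent & Hmon & Heq).
  assert (Hu : forall x, continuous u x) by (intros x; eapply is_cderive_continuous, Hu1).
  apply monic_deg_mon in Hmon.
  assert (Hpsi0 : cpoly (peval psi0)) by (eexists; apply peval_ple).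
  assert (Hphi0 : cpoly (peval phi0)) by (eexists; apply peval_ple).
  destruct (real_reduction (S n) (peval f0) (peval psi0) (peval phi0)) as
    (m & q & e & b & Hm & Hq & He & Hb & Ef & Epsi & Ephi & Hreal); auto.
  { apply (n_gap_reflection u l P11 P12 P21 P22 _ _ _ h); auto; [eapply mon_cpoly; eauto| | |]; intros z; apply Heq. }
  (* The factor [q], which may be neither real nor free of zeros, travels with [h]. *)
  set (H := fun z => (q z * h z)%C).
  assert (H1 : forall z, (P11 l z - P22 l z = 2 * Ci * (e z * H z))%C).
  { intros z. destruct (Heq z) as [E _]. unfold H.
    transitivity ((P11 l z - P22 l z) / (2 * Ci) * (2 * Ci))%C.
    - field. exact Ci_nz.
    - rewrite E, Ef. ring. }
  assert (H2 : forall z, P12 l z = (b z * H z)%C).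
  { intros z. destruct (Heq z) as (_ & E & _). rewrite E, Epsi. unfold H. ring. }
  assert (H3 : forall z, P21 l z = (- Cconj (b (Cconj z)) * H z)%C).
  { intros z. destruct (Heq z) as (_ & _ & E). rewrite E, Ephi. unfold H. ring. }
  destruct (initial_family l u P11 P12 P21 P22 m e b H) as (p0 & A1 & A2 & A3 & A4 & A5 & A6 & A7 & A8 & A9); auto.
  destruct (evolve_family m l p0) as (M & p & Hfam & B1 & B2); auto.
  assert (B1' : p 0 0 = p0 0) by (apply functional_extensionality, B1).
  destruct (family_nls m M p Hfam) as (vx & vxx & vt & C1 & C2 & C3 & C4 & C5 & C6 & C7 & C8).
  assert (Hsol : nls_solution l u (fun x t => p x t (iB 0))).
  { split; [intros x t; now rewrite B2|]. split; [|intros x; now rewrite B1].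
    exists vx, vxx, vt. 
    split; [exact C1|]. split; [exact C2|]. split; [exact C3|].
    split; [intros; apply C4|]. split; [intros; apply C5|]. split; [intros; apply C6|].
    split; [intros; apply C7|]. exact C8. }
  exists (fun x t => p x t (iB 0)). split; [exact Hsol|]. split.
  - intros w Hw x t. now apply (nls_unique l u (fun x t => p x t (iB 0)) w).
  - intros t. split; [intros x; now rewrite B2|]. split.
    { exists (fun x => vx x t), (fun x => vxx x t). split; [intros x; apply C1|]. split; [intros x; apply C2|].
      intros x. apply (continuous_comp (fun y => (y, t)) (fun q : R * R => vxx (fst q) (snd q))); [|apply C6].
      intros P [eps HP']. exists eps. intros y Hy. apply HP'. split; [exact Hy|apply ball_center]. }
    destruct (family_monodromy l u P11 P12 P21 P22 m e b H M p t) as (Q11 & Q12 & Q21 & Q22 & HQ & HQl); auto.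
    { intros x. now rewrite B1. }
    { intros z. now rewrite B1'. }
    { intros z. now rewrite B1'. }
    exists Q11, Q12, Q21, Q22. split; [exact HQ|].
    (* Multiplying [q] back into the polynomials restores degree n + 1 and leaves [h] as the entire
       factor. *)
    assert (Hqf : mon (S n) (fun z => q z * fpol m (p 0 t) z)%C).
    { replace (S n) with (S n - m + m)%nat by lia. apply mon_mult; auto.
      exists (hpoly m (fun k => p 0 t (iG k))). split; [eexists; reflexivity|reflexivity]. }
    assert (Hqp : cpoly q) by (eapply mon_cpoly; eauto).
    assert (Hbp : cpoly (bpol m (p 0 t))) by (exists m; eexists; reflexivity).
    destruct (cpoly_mult q (bpol m (p 0 t)) Hqp Hbp) as [d1 Hd1].
    destruct (cpoly_mult q (bstar m (p 0 t)) Hqp (cpoly_star _ Hbp)) as [d2 Hd2].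
    destruct (mon_monic_deg _ _ Hqf) as (ft & Hft & Eft).
    destruct (ple_peval _ _ Hd1) as (psit & _ & Epsit).
    destruct (ple_peval _ _ (ple_scal d2 (- (1))%C _ Hd2)) as (phit & _ & Ephit).
    exists h, ft, psit, phit. split; [exact Hent|]. split; [exact Hft|].
    intros z. destruct (HQl z) as (F1 & F2 & F3). rewrite <- Eft, <- Epsit, <- Ephit, F1, F2, F3.
    unfold H. split; [|split].
    + field. exact Ci_nz.
    + ring.
    + ring.
Qed.
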